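(* Let $\mathcal{G}_1=(\mathcal{E}_1,\mathcal{V}_1,m_1)$ (with $\mathcal{V}_1$ infinite) and $\mathcal{G}_2=(\mathcal{E}_2,\mathcal{V}_2,m_2)$ be graphs with magnetic potentials $\theta_1,\theta_2$, and let $\mathcal{I}\subset\mathcal{V}_2$ be non-empty, such that $\mathcal{G}:=\mathcal{G}_1\times_{\mathcal{I}}\mathcal{G}_2$ is a discrete cusp. Suppose that $\deg_{\mathcal{G}_2}$ is constant on $\mathcal{V}_2$ and that $\mathrm{Hol}_{\theta_2}\neq0$. Then, for all $a\in[1,+\infty)$, there exists a graph $\widetilde{\mathcal{G}}_1=(\widetilde{\mathcal{E}}_1,\mathcal{V}_1,\widetilde m_1)$ (same vertex set) such that: 1) $\widetilde{\mathcal{G}}:=\widetilde{\mathcal{G}}_1\times_{\mathcal{I}}\mathcal{G}_2$ is a discrete cusp; 2) $\mathcal{E}_1$ and $\widetilde{\mathcal{E}}_1$ have the same zero set; 3) $\deg_{\widetilde{\mathcal{G}}_1}(x)\le\deg_{\mathcal{G}_1}(x)$ for all $x\in\mathcal{V}_1$; 4) $\Delta_{\widetilde{\mathcal{G}},\theta}$ has compact resolvent, and \[\lim_{\lambda\to\infty}\frac{\mathcal{N}_\lambda(\Delta_{\widetilde{\mathcal{G}},\theta})}{\mathcal{N}_\lambda(\deg_{\widetilde{\mathcal{G}}}(\cdot))}=a,\] where $\theta$ is the product magnetic potential built from $\theta_1$ and $\theta_2$.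
   Context: A (weighted) graph is a triple $\mathcal{G}=(\mathcal{E},\mathcal{V},m)$ with $\mathcal{V}$ a countable set, $\mathcal{E}:\mathcal{V}\times\mathcal{V}\to[0,\infty)$ symmetric, and $m:\mathcal{V}\to(0,\infty)$. Write $x\sim y$ if $\mathcal{E}(x,y)>0$. All graphs are locally finite, connected, and without loops ($\mathcal{E}(x,x)=0$). $\ell^2(\mathcal{V},m)$ is the Hilbert space of $f:\mathcal{V}\to\mathbb{C}$ with $\sum_x m(x)|f(x)|^2<\infty$; $\mathcal{C}_c(\mathcal{V})$ denotes finitely supported functions. A magnetic potential is a map $\theta:\mathcal{V}\times\mathcal{V}\to\mathbb{R}/2\pi\mathbb{Z}$ with $\theta_{x,y}=-\theta_{y,x}$ and $\theta_{x,y}=0$ if $\mathcal{E}(x,y)=0$. The magnetic Laplacian $\Delta_{\mathcal{G},\theta}$ is the Friedrichs extension in $\ell^2(\mathcal{V},m)$ of $(\Delta_{\mathcal{G},\theta}f)(x)=\frac1{m(x)}\sum_{y}\mathcal{E}(x,y)(f(x)-e^{i\theta_{x,y}}f(y))$ on $\mathcal{C}_c(\mathcal{V})$; it is the non-negative self-adjoint operator associated with the closure of the form $Q_{\mathcal{G},\theta}(f)=\frac12\sum_{x,y}\mathcal{E}(x,y)|f(x)-e^{i\theta_{x,y}}f(y)|^2$ on $\mathcal{C}_c(\mathcal{V})$. The degree is $\deg_{\mathcal{G}}(x)=\frac1{m(x)}\sum_y\mathcal{E}(x,y)$; $\deg_{\mathcal{G}}(\cdot)$ is the self-adjoint multiplication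 operator in $\ell^2(\mathcal{V},m)$. The holonomy of $\theta$ assigns to each cycle (closed walk) $(x_0,\dots,x_N=x_0)$ with $x_i\sim x_{i+1}$ the element $\theta_{x_0,x_1}+\dots+\theta_{x_{N-1},x_N}\in\mathbb{R}/2\pi\mathbb{Z}$; $\mathrm{Hol}_\theta=0$ means that this vanishes for every cycle, and $\mathrm{Hol}_\theta\ne0$ otherwise. Product through $\mathcal{I}$: $\mathcal{G}_1\times_{\mathcal{I}}\mathcal{G}_2=(\mathcal{E},\mathcal{V},m)$ has $\mathcal{V}=\mathcal{V}_1\times\mathcal{V}_2$, $m(x,y)=m_1(x)m_2(y)$, $\mathcal{E}((x,y),(x',y'))=\mathcal{E}_1(x,x')\delta_{y,y'}1_{\mathcal{I}}(y)+\delta_{x,x'}\mathcal{E}_2(y,y')$, and $\theta((x,y),(x',y'))=\theta_1(x,x')\delta_{y,y'}+\delta_{x,x'}\theta_2(y,y')$ (values on non-edges play no role and are set to $0$). $\mathcal{G}_1\times_{\mathcal{I}}\mathcal{G}_2$ is a discrete cusp if: (H1) $m_1(x)\to0$ as $|x|\to\infty$, where $|x|$ is the combinatorial graph distance in $\mathcal{G}_1$ from $x$ to a fixed vertex; (H2) $\mathcal{G}_2$ is finite; (H3) $\sup_{x\in\mathcal{V}_1}\deg_{\mathcal{G}_1}(x)<\infty$ (equivalently, $\Delta_{\mathcal{G}_1,\theta_1}$ is bounded). For a self-adjoint operator $H$, $\mathcal{N}_\lambda(H)=\dim\operatorname{ran}1_{]-\infty,\lambda]}(H)$. *)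

(* Defs.v *)
From HB Require Import structures.
From mathcomp Require Import all_boot all_order all_algebra.
From mathcomp Require Import complex.
From mathcomp Require Import all_classical all_reals all_analysis.

Set Implicit Arguments.
Unset Strict Implicit.
Unset Printing Implicit Defensive.

Import Order.TTheory GRing.Theory Num.Theory.
Import numFieldNormedType.Exports.

Local Open Scope classical_set_scope.
Local Open Scope ring_scope.
Local Open Scope complex_scope.

Section Graphs.
Context {R : realType}.

Record wgraph (V : countType) := WGraph {
  weight : V -> V -> R;
  mass : V -> R
}.

Definition adj (V : countType) (G : wgraph V) : rel V :=
  fun x y => 0 < weight G x y.

Definition is_graph (V : countType) (G : wgraph V) : Prop :=
  [/\ (forall x y, 0 <= weight G x y) /\
      (forall x y, weight G x y = weight G y x),
      forall x, 0 < mass G x,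
      forall x, weight G x x = 0,
      forall x, finite_set [set y | adj G x y]
    & forall x y, exists2 p : seq V, path (adj G) x p & last x p = y].

(* A finite sum, by local finiteness. *)
Definition deg (V : countType) (G : wgraph V) (x : V) : R :=
  (mass G x)^-1 * \sum_(y \in [set: V]) weight G x y.

(* The only element of the set when [x] and [y] are connected. *)
Definition gdist (V : countType) (G : wgraph V) (x y : V) : nat :=
  xget 0%N [set n |
    (exists p : seq V, [/\ path (adj G) x p, last x p = y & size p = n]) /\
    (forall p : seq V, path (adj G) x p -> last x p = y -> (n <= size p)%N)].

(* Elements of R / 2 pi Z are given by real representatives; equality in the
   quotient is [eq2pi]. *)
Definition eq2pi (s t : R) : Prop := exists k : int, s - t = 2 * pi * k%:~R.

Definition is_potential (V : countType) (G : wgraph V) (theta : V -> V -> R) :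
    Prop :=
  (forall x y, eq2pi (theta x y) (- theta y x)) /\
  (forall x y, weight G x y = 0 -> eq2pi (theta x y) 0).

(* [p] lists x_1, ..., x_N for the walk (x_0 = x, x_1, ..., x_N). *)
Definition holonomy (V : countType) (theta : V -> V -> R) (x : V) (p : seq V) :
    R :=
  \sum_(t <- pairmap theta x p) t.

Definition Hol_zero (V : countType) (G : wgraph V) (theta : V -> V -> R) :
    Prop :=
  forall (x : V) (p : seq V), path (adj G) x p -> last x p = x ->
    eq2pi (holonomy theta x p) 0.

Definition gprod (V1 V2 : countType) (G1 : wgraph V1) (G2 : wgraph V2)
    (I : set V2) : wgraph (V1 * V2)%type :=
  {| weight := fun p q =>
       weight G1 p.1 q.1 * (p.2 == q.2)%:R * \1_I p.2 +
       (p.1 == q.1)%:R * weight G2 p.2 q.2;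
     mass := fun p => mass G1 p.1 * mass G2 p.2 |}.

Definition theta_prod (V1 V2 : countType) (G1 : wgraph V1) (G2 : wgraph V2)
    (I : set V2) (theta1 : V1 -> V1 -> R) (theta2 : V2 -> V2 -> R)
    (p q : V1 * V2) : R :=
  if weight (gprod G1 G2 I) p q == 0 then 0
  else theta1 p.1 q.1 * (p.2 == q.2)%:R + (p.1 == q.1)%:R * theta2 p.2 q.2.

(* The conditions do not involve the set [I] through which the product is
   taken.  By connectedness the choice of the base vertex [o] is irrelevant. *)
Definition discrete_cusp (V1 V2 : countType) (G1 : wgraph V1) (G2 : wgraph V2) :
    Prop :=
  [/\ exists o : V1, forall e : R, 0 < e -> exists N : nat,
        forall x, (N <= gdist G1 o x)%N -> mass G1 x < e,
      finite_set [set: V2]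
    & has_ubound (range (deg G1))].

End Graphs.

Section Operators.
Context {R : realType}.
Notation C := R[i].
Notation normc := ComplexField.Normc.normc.

(* Unordered sum of an absolutely summable family of reals, resp. of complex
   numbers (the value is meaningless without summability). *)
Definition rsum (V : countType) (u : V -> R) : R :=
  fine (\esum_(x in [set: V]) (u^\+ x)%:E) -
  fine (\esum_(x in [set: V]) (u^\- x)%:E).

Definition csum (V : countType) (u : V -> C) : C :=
  rsum (fun x => complex.Re (u x)) +i* rsum (fun x => complex.Im (u x)).

Section L2.
Context {V : countType} (m : V -> R).

Definition sqnorm (f : V -> C) : \bar R :=
  \esum_(x in [set: V]) (m x * normc (f x) ^+ 2)%:E.

Definition ell2 : set (V -> C) := [set f | (sqnorm f < +oo)%E].

Definition inner (f g : V -> C) : C :=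
  csum (fun x => (m x)%:C * f x * (g x)^*).

Definition cvg_ell2 (u : nat -> V -> C) (f : V -> C) : Prop :=
  sqnorm (u n \- f) @[n --> \oo] --> (0 : \bar R).

(* An unbounded operator on l^2(V, m) is represented by its graph:
   [H f h] means that f is in the domain and H f = h. *)
Definition operator := (V -> C) -> (V -> C) -> Prop.

Definition compact_op (B : (V -> C) -> (V -> C)) : Prop :=
  forall (u : nat -> V -> C) (M : R), (forall n, (sqnorm (u n) <= M%:E)%E) ->
    exists (s : nat -> nat) (g : V -> C),
      [/\ {homo s : i j / (i < j)%N}, ell2 g
        & cvg_ell2 (fun n => B (u (s n))) g].

(* B is the inverse of H - z, a bijection from the domain of H onto
   l^2(V, m). *)
Definition is_resolvent (H : operator) (z : C) (B : (V -> C) -> (V -> C)) :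
    Prop :=
  (forall f, ell2 f -> ell2 (B f) /\ H (B f) (fun x => f x + z * B f x)) /\
  (forall f h, H f h -> B (fun x => h x - z * f x) = f).

Definition compact_resolvent (H : operator) : Prop :=
  exists (z : C) (B : (V -> C) -> (V -> C)), is_resolvent H z B /\ compact_op B.

Definition is_orth_proj (P : (V -> C) -> (V -> C)) : Prop :=
  [/\ forall f, ell2 f -> ell2 (P f),
      forall (c : C) f g, ell2 f -> ell2 g ->
        P (fun x => c * f x + g x) = (fun x => c * P f x + P g x),
      forall f, ell2 f -> P (P f) = P f
    & forall f g, ell2 f -> ell2 g -> inner (P f) g = inner f (P g)].

Notation Borel := (@measurable _ (measurableTypeR R)).

Definition is_pvm (E : set R -> (V -> C) -> (V -> C)) : Prop :=
  [/\ forall A, Borel A -> is_orth_proj (E A),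
      forall f, ell2 f -> E [set: R] f = f,
      forall A B f, Borel A -> Borel B -> ell2 f ->
        E (A `&` B) f = E A (E B f)
    & forall (A : nat -> set R) f, (forall n, Borel (A n)) ->
        trivIset [set: nat] A -> ell2 f ->
        cvg_ell2 (fun n => fun x => \sum_(k < n) E (A k) f x)
                 (E (\bigcup_n A n) f)].

(* The measure A |-> <E(A) f, f>. *)
Definition scalar_measure (E : set R -> (V -> C) -> (V -> C)) (f : V -> C) :
    set (measurableTypeR R) -> \bar R :=
  fun A => (complex.Re (inner (E A f) f))%:E.

(* H is the integral of t with respect to E: its domain consists of the f such
   that t is square integrable for the measure <E f, f>, and on the domain
   <H f, f> is the integral of t against <E f, f> (which determines the linear
   operator H by polarization). *)
Definition is_spectral_measure (H : operator)
    (E : set R -> (V -> C) -> (V -> C)) : Prop :=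
  [/\ is_pvm E,
      forall f, (exists h, H f h) <->
        ell2 f /\
        (\int[scalar_measure E f]_(t in [set: R]) (t ^+ 2)%:E < +oo)%E
    & forall f h, H f h ->
        inner h f =
        (fine (\int[scalar_measure E f]_(t in [set: R]) t%:E)%E)%:C].

(* It exists and is unique for a self-adjoint operator, by the spectral
   theorem. *)
Definition spectral_measure (H : operator) : set R -> (V -> C) -> (V -> C) :=
  xget ((fun _ f => f) : set R -> (V -> C) -> V -> C)
    [set E | is_spectral_measure H E].

Definition lin_indep (n : nat) (b : 'I_n -> V -> C) : Prop :=
  forall c : 'I_n -> C,
    (forall x, \sum_(i < n) c i * b i x = 0) -> forall i, c i = 0.

Definition dimension (S : set (V -> C)) : \bar R :=
  ereal_sup [set (n%:R : R)%:E | n in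
    [set n : nat | exists2 b : 'I_n -> V -> C,
       (forall i, S (b i)) & lin_indep b]].

Definition counting_function (H : operator) (lambda : R) : \bar R :=
  dimension [set spectral_measure H [set` `]-oo, lambda]] f | f in ell2].

Definition mult_op (q : V -> R) : operator := fun f h =>
  [/\ ell2 f, ell2 h & h = (fun x => (q x)%:C * f x)].

End L2.

Section MagneticLaplacian.
Context {V : countType} (G : @wgraph R V) (theta : V -> V -> R).

Definition Cc : set (V -> C) := [set f | finite_set [set x | f x != 0]].

Definition expi (t : R) : C := cos t +i* sin t.

Definition mgrad (f : V -> C) (x y : V) : C :=
  f x - expi (theta x y) * f y.

(* The sesquilinear form polarizing Q(f) = mform f f, on Cc (where the sum is
   finite by local finiteness). *)
Definition mform (f g : V -> C) : C :=
  2^-1 * \sum_(p \in [set: V * V])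
    (weight G p.1 p.2)%:C * mgrad f p.1 p.2 * (mgrad g p.1 p.2)^*.

(* u is a sequence of Cc converging to f for the closure of the form. *)
Definition form_approx (u : nat -> V -> C) (f : V -> C) : Prop :=
  [/\ forall n, Cc (u n),
      cvg_ell2 (mass G) u f
    & forall e : R, 0 < e -> exists N : nat, forall n k,
        (N <= n)%N -> (N <= k)%N ->
        normc (mform (u n \- u k) (u n \- u k)) < e].

Definition form_domain : set (V -> C) :=
  [set f | ell2 (mass G) f /\ exists u, form_approx u f].

(* The value at (f, g) of the closure of the form is w. *)
Definition closed_form (f g : V -> C) (w : C) : Prop :=
  forall u v, form_approx u f -> form_approx v g ->
    normc (mform (u n) (v n) - w) @[n --> \oo] --> (0 : R).

(* The self-adjoint operator associated with the closure of the form on Cc,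
   that is the Friedrichs extension. *)
Definition magnetic_laplacian : operator := fun f h =>
  [/\ form_domain f, ell2 (mass G) h
    & forall g, form_domain g -> closed_form f g (inner (mass G) h g)].

Definition deg_op : operator := mult_op (mass G) (deg G).

End MagneticLaplacian.

End Operators.

(* Main.v *)
(* Let [m1'] be small masses with [1 / m1' x = Phi (rho x)], [rho] an enumeration
   of [V1], and shrink the weights of [G1] so that degrees do not grow.  On the
   product, the magnetic form is the vertical form, diagonalized by the spectrum
   [la] of the finite magnetic Laplacian of [G2], up to a bounded perturbation
   coming from [G1].  Thus the Laplacian behaves like the eigenvalues
   [la k / m1' x], and the degree like [d / m1' x].  By min-max, if [gr] is the
   growth of the counting function of [Phi], both counting functions are
   [\sum_k gr (l / la k)] and [\sum_k gr (l / d)] up to lower order.  With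
   [gr l = l ^ s] the quotient tends to [(1 / N) \sum_k (d / la k) ^ s].
   The mean of the [la k] is [d] (trace) and, the holonomy being nontrivial, all
   are positive and some is [< d]; hence this limit, which is [1] at [s = 0],
   tends to infinity with [s] and takes the value [a].  At [s = 0] the growth
   [gr] is taken to be logarithmic. *)
From HB Require Import structures.
Require Import Defs.
From mathcomp Require Import all_boot all_order all_algebra.
From mathcomp Require Import complex spectral sesquilinear.
From mathcomp Require Import all_classical all_reals all_analysis.
From mathcomp Require Import measurable_realfun.
From mathcomp Require Import ring lra.
Import Order.TTheory GRing.Theory Num.Theory.
Import numFieldNormedType.Exports.
Set Implicit Arguments.
Unset Strict Implicit.
Unset Printing Implicit Defensive.
Local Open Scope classical_set_scope.
Local Open Scope ring_scope.
Local Open Scope complex_scope.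

(** [spectral_measure] is whatever the choice operator returns, so a counting function is accessible
    only through the axioms of a spectral measure. Existence has to be proved for both operators,
    and the min-max bounds have to hold for every spectral measure of the operator; for the
    Laplacian, existence comes from its compact inverse. The Friedrichs extension becomes explicit
    because positivity of all [la k] makes the form on the product comparable, from both sides, with
    the squared norm of l^2 for the weight [m / m1']. The form domain is that weighted space, weak
    solutions come from Riesz representation, and properness of [1 / m1'] gives compactness. The
    perturbation lies between [0] and [2 K] times the squared norm, where
    [deg G1' x <= K * mass G2 y]. No eigenvalue on the product is ever located: trial functions and
    linear functionals trap each counting function at [l] between counts for the diagonal model at
    [l - 1 - 2 K] and at [l + 1]. The [1] is a safety margin in min-max, and the regular variation
    of [gr] erases all such shifts. *)

Notation normc := ComplexField.Normc.normc.

(** * Squared modulus of complex numbers *)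

Section ComplexFacts.
Context {R : realType}.
Implicit Types z w : R[i].

(** The squared modulus as a polynomial in the coordinates, so that [ring] and [nra] apply; [normc]
    hides a square root. *)
Definition sq z : R := complex.Re z ^+ 2 + complex.Im z ^+ 2.

Lemma normc_sq z : normc z ^+ 2 = sq z.
Proof. by case: z => a b; rewrite /sq /= sqr_sqrtr// addr_ge0// sqr_ge0. Qed.

Lemma sq_ge0 z : 0 <= sq z.
Proof. by rewrite addr_ge0// sqr_ge0. Qed.

Lemma normc_ge0 z : 0 <= normc z.
Proof. by case: z => a b; rewrite /= sqrtr_ge0. Qed.

Lemma sqM z w : sq (z * w) = sq z * sq w.
Proof. by case: z w => a b [c d]; rewrite /sq /=; ring. Qed.

(** The difference of the two sides is [sq (z - w)], by the parallelogram identity. *)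
Lemma sqD_le z w : sq (z + w) <= 2 * sq z + 2 * sq w.
Proof.
case: z w => a b [c d]; rewrite /sq /= -subr_ge0.
rewrite (_ : _ - _ = (a - c) ^+ 2 + (b - d) ^+ 2) ?addr_ge0 ?sqr_ge0//.
by ring.
Qed.

Lemma sqJ z : sq z^* = sq z.
Proof. by case: z => a b; rewrite /sq /= sqrrN. Qed.

Lemma sqN z : sq (- z) = sq z.
Proof. by case: z => a b; rewrite /sq /= !sqrrN. Qed.

Lemma sq0 : sq 0 = 0.
Proof. by rewrite /sq /= expr0n addr0. Qed.

Lemma sq_eq0 z : sq z = 0 -> z = 0.
Proof.
case: z => a b; rewrite /sq /= => /eqP; rewrite paddr_eq0 ?sqr_ge0//.
by rewrite !sqrf_eq0 => /andP[/eqP -> /eqP ->].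
Qed.

Lemma mulJ z : z * z^* = (sq z)%:C.
Proof. by case: z => a b; rewrite /sq /=; simpc; congr (_ +i* _); ring. Qed.

Lemma ReD z w : complex.Re (z + w) = complex.Re z + complex.Re w.
Proof. by case: z w => a b [c d]. Qed.

Lemma ImD z w : complex.Im (z + w) = complex.Im z + complex.Im w.
Proof. by case: z w => a b [c d]. Qed.

Lemma Re_le_normc z : `|complex.Re z| <= normc z.
Proof.
case: z => a b /=; rewrite -sqrtr_sqr ler_sqrt ?addr_ge0 ?sqr_ge0//.
by rewrite lerDl sqr_ge0.
Qed.

Lemma Im_le_normc z : `|complex.Im z| <= normc z.
Proof.
case: z => a b /=; rewrite -sqrtr_sqr ler_sqrt ?addr_ge0 ?sqr_ge0//.
by rewrite lerDr sqr_ge0.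
Qed.

End ComplexFacts.

(** * Unordered sums over a countable set *)

Section UnorderedSums.
Context {R : realType} {V : countType}.
Implicit Types (u v : V -> R) (f g : V -> R[i]).

(** For nonnegative [u], and meaningful under [summ u]: [fine] sends a divergent sum to [0]. *)
Definition fsum u : R := fine (\esum_(x in [set: V]) (u x)%:E).

Definition summ u := (\esum_(x in [set: V]) `|u x|%:E < +oo)%E.

Lemma summ_le u v : (forall x, `|u x| <= `|v x|) -> summ v -> summ u.
Proof. by move=> uv; apply: le_lt_trans; apply: le_esum => x _; rewrite lee_fin. Qed.

Lemma summD u v : summ u -> summ v -> summ (fun x => u x + v x).
Proof.
move=> su sv; apply: le_lt_trans (lte_add_pinfty su sv).
rewrite -esumD; try by move=> *; rewrite lee_fin.
by apply: le_esum => x _; rewrite -EFinD lee_fin ler_normD.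
Qed.

Lemma esumZ (c : R) u : 0 <= c -> (forall x, 0 <= u x) ->
  (\esum_(x in [set: V]) (c * u x)%:E =
   c%:E * \esum_(x in [set: V]) (u x)%:E)%E.
Proof.
move=> c0 u0.
(* One inequality for every positive factor is enough: with the factor [c^-1] it yields the
   converse. *)
have key : forall (d : R) v, 0 < d -> (forall x, 0 <= v x) ->
    (\esum_(x in [set: V]) (d * v x)%:E <=
     d%:E * \esum_(x in [set: V]) (v x)%:E)%E.
  move=> d v d0 v0; apply: ge_ereal_sup => _ [X [fX _] <-].
  under eq_fsbigr do rewrite EFinM.
  rewrite -ge0_mule_fsumr//.
  by rewrite lee_pmul2l// ?ltry// ereal_sup_ubound//; exists X.
move: c0; rewrite le_eqVlt => /predU1P[<-|c0].
  by rewrite mul0e esum1// => x _; rewrite mul0r.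
apply/eqP; rewrite eq_le key//=.
rewrite -lee_pdivlMl//.
have c0' : 0 < c^-1 by rewrite invr_gt0.
apply: le_trans (key c^-1 (fun x => c * u x) c0' _).
  by apply: le_esum => x _; rewrite lee_fin mulrA mulVf ?mul1r// gt_eqF.
by move=> x; rewrite mulr_ge0// ltW.
Qed.

Lemma summZ (c : R) u : summ u -> summ (fun x => c * u x).
Proof.
move=> su; rewrite /summ.
under eq_esum do rewrite normrM.
rewrite esumZ//; move: su; rewrite /summ.
have : (0 <= \esum_(x in [set: V]) `|u x|%:E)%E by apply: esum_ge0 => x _; rewrite lee_fin.
by move=> h1 h2; rewrite lte_mul_pinfty// lee_fin.
Qed.

Lemma summ_fin u : (forall x, 0 <= u x) -> summ u ->
  (\esum_(x in [set: V]) (u x)%:E = (fsum u)%:E)%E.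
Proof.
move=> u0 su; rewrite /fsum fineK// ge0_fin_numE; last first.
  by apply: esum_ge0 => x _; rewrite lee_fin.
apply: le_lt_trans su; apply: le_esum => x _.
by rewrite lee_fin ler_norm.
Qed.

Lemma fsum_ge0 u : (forall x, 0 <= u x) -> 0 <= fsum u.
Proof. by move=> u0; rewrite fine_ge0// esum_ge0// => x _; rewrite lee_fin. Qed.

(** [rsum] is defined by the positive and negative parts, which are not additive. Any other
    decomposition into nonnegative summable families gives the same value, and linearity of [rsum]
    follows from that of [fsum]. *)
Lemma rsumE u v : (forall x, 0 <= u x) -> (forall x, 0 <= v x) ->
  summ u -> summ v -> rsum (fun x => u x - v x) = fsum u - fsum v.
Proof.
move=> u0 v0 su sv.
have E w : summ w -> (\esum_(x in [set: V]) (w^\+ x)%:E \is a fin_num)%E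
    /\ (\esum_(x in [set: V]) (w^\- x)%:E \is a fin_num)%E.
  move=> sw; split; rewrite ge0_fin_numE ?esum_ge0//.
  - apply: le_lt_trans sw; apply: le_esum => x _; rewrite lee_fin.
    by rewrite /funrpos ge_max normr_ge0 ler_norm.
  - by move=> x _; rewrite lee_fin /funrpos le_max lexx orbT.
  - apply: le_lt_trans sw; apply: le_esum => x _; rewrite lee_fin.
    by rewrite /funrneg ge_max normr_ge0 -normrN ler_norm.
  - by move=> x _; rewrite lee_fin /funrneg le_max lexx orbT.
have sd : summ (fun x => u x - v x).
  apply: (@summ_le _ (fun x => u x + v x)); last exact: summD.
  move=> x; rewrite [leRHS]ger0_norm ?addr_ge0// (le_trans (ler_normB _ _))//.
  by rewrite !ger0_norm.
have [Ep En] := E _ sd.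
have EP x : ((EFin \o u) \- (EFin \o v))%E x = (u x - v x)%:E by [].
have Ef w : (forall x, 0 <= w x) -> summ w ->
    (\esum_(x in [set: V]) (w x)%:E \is a fin_num)%E.
  by move=> w0 sw; rewrite summ_fin.
have Eu := Ef _ u0 su; have Ev := Ef _ v0 sv.
rewrite /rsum /fsum -!fineB//; congr fine.
rewrite -[RHS]esumB//; try by move=> *; rewrite lee_fin.
congr (_ - _)%E; apply: eq_esum => x _.
  by rewrite funeposE EP /funrpos EFin_max.
by rewrite funenegE EP /funrneg EFin_max.
Qed.

Lemma fsumD u v : (forall x, 0 <= u x) -> (forall x, 0 <= v x) ->
  summ u -> summ v -> fsum (fun x => u x + v x) = fsum u + fsum v.
Proof.
move=> u0 v0 su sv; rewrite /fsum.
have Ef w : (forall x, 0 <= w x) -> summ w ->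
    (\esum_(x in [set: V]) (w x)%:E \is a fin_num)%E.
  by move=> w0 sw; rewrite summ_fin.
by rewrite -fineD ?Ef// -esumD// => x _; rewrite lee_fin.
Qed.

Lemma fsumZ (c : R) u : 0 <= c -> (forall x, 0 <= u x) -> summ u ->
  fsum (fun x => c * u x) = c * fsum u.
Proof. by move=> c0 u0 su; rewrite /fsum esumZ// summ_fin. Qed.

Lemma summ_pos u : summ u -> summ (fun x => Num.max (u x) 0).
Proof.
apply: summ_le => x; rewrite ger0_norm ?le_max ?lexx ?orbT//.
by rewrite ge_max normr_ge0 ler_norm.
Qed.

Lemma summN u : summ u -> summ (fun x => - u x).
Proof. by apply: summ_le => x; rewrite normrN. Qed.

Lemma pos_neg u : exists p n, [/\ forall x, 0 <= p x, forall x, 0 <= n x,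
  summ u -> summ p /\ summ n & u = (fun x => p x - n x)].
Proof.
exists (fun x => Num.max (u x) 0), (fun x => Num.max (- u x) 0); split.
- by move=> x; rewrite le_max lexx orbT.
- by move=> x; rewrite le_max lexx orbT.
- by move=> su; split; apply: summ_pos => //; apply: summN.
- apply: funext => x; have [ux|ux] := leP (u x) 0.
    by rewrite max_l ?oppr_ge0// sub0r opprK.
  by rewrite max_r ?subr0// oppr_le0 ltW.
Qed.

Lemma rsumD u v : summ u -> summ v ->
  rsum (fun x => u x + v x) = rsum u + rsum v.
Proof.
move=> su sv.
have [p [n [p0 n0 /(_ su)[sp sn] ->]]] := pos_neg u.
have [q [k [q0 k0 /(_ sv)[sq sk] ->]]] := pos_neg v.
rewrite !rsumE//.
have -> : (fun x => p x - n x + (q x - k x)) =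
    (fun x => (p x + q x) - (n x + k x)).
  by apply: funext => x; rewrite opprD addrACA.
rewrite rsumE//; try by [apply: summD | move=> x; apply: addr_ge0].
by rewrite !fsumD// opprD addrACA.
Qed.

Lemma rsumN u : summ u -> rsum (fun x => - u x) = - rsum u.
Proof.
move=> su; have [p [n [p0 n0 /(_ su)[sp sn] ->]]] := pos_neg u.
have -> : (fun x => - (p x - n x)) = (fun x => n x - p x).
  by apply: funext => x; rewrite opprB.
by rewrite !rsumE// opprB.
Qed.

Lemma rsumZ (c : R) u : summ u -> rsum (fun x => c * u x) = c * rsum u.
Proof.
wlog c0 : c / 0 <= c.
  move=> H su; have [c0|c0] := leP 0 c; first exact: H.
  rewrite -[in LHS](opprK c) (_ : (fun x => - - c * u x) = (fun x => - (- c * u x))).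
    rewrite rsumN ?H// ?oppr_ge0 ?ltW// ?mulNr ?opprK//.
    exact: summZ.
  by apply: funext => x; rewrite mulNr.
move=> su; have [p [n [p0 n0 /(_ su)[sp sn] ->]]] := pos_neg u.
have -> : (fun x => c * (p x - n x)) = (fun x => c * p x - c * n x).
  by apply: funext => x; rewrite mulrBr.
rewrite !rsumE//; try by [apply: summZ | move=> x; apply: mulr_ge0].
by rewrite !fsumZ// mulrBr.
Qed.

Lemma rsum_ge0E u : (forall x, 0 <= u x) -> summ u -> rsum u = fsum u.
Proof.
move=> u0 su; have s0 : summ (fun=> 0) by rewrite /summ esum1 ?ltry// => x _; rewrite normr0.
rewrite -[in LHS](_ : (fun x => u x - 0) = u); last by apply: funext => x; rewrite subr0.
by rewrite rsumE// /fsum [X in _ - fine X]esum1// subr0.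
Qed.

Definition csumm f := summ (fun x => normc (f x)).

Lemma csumm_Re f : csumm f -> summ (fun x => complex.Re (f x)).
Proof.
by apply: summ_le => x; rewrite [leRHS]ger0_norm ?normc_ge0// Re_le_normc.
Qed.

Lemma csumm_Im f : csumm f -> summ (fun x => complex.Im (f x)).
Proof.
by apply: summ_le => x; rewrite [leRHS]ger0_norm ?normc_ge0// Im_le_normc.
Qed.

Lemma csumD f g : csumm f -> csumm g ->
  csum (fun x => f x + g x) = csum f + csum g.
Proof.
move=> sf sg; rewrite /csum.
under [in X in X +i* _]eq_fun do rewrite ReD.
under [in X in _ +i* X]eq_fun do rewrite ImD.
by rewrite rsumD ?rsumD//; [exact: csumm_Im..|exact: csumm_Re|exact: csumm_Re].
Qed.

Lemma csumZ (c : R[i]) f : csumm f -> csum (fun x => c * f x) = c * csum f.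
Proof.
move=> sf; have sR := csumm_Re sf; have sI := csumm_Im sf.
case: c => a b; rewrite /csum.
have -> : (fun x => complex.Re ((a +i* b) * f x)) =
   (fun x => a * complex.Re (f x) + (- b) * complex.Im (f x)).
  by apply: funext => x; case: (f x) => c d /=; rewrite mulNr.
have -> : (fun x => complex.Im ((a +i* b) * f x)) =
   (fun x => a * complex.Im (f x) + b * complex.Re (f x)).
  by apply: funext => x; case: (f x) => c d /=.
rewrite !rsumD; try exact: summZ.
by rewrite !rsumZ// mulNr.
Qed.

Lemma csumJ f : csumm f -> csum (fun x => (f x)^*) = (csum f)^*.
Proof.
move=> sf; rewrite /csum /=; congr (rsum _ +i* _).
  by apply: funext => x; case: (f x).
rewrite -rsumN; last exact: csumm_Im.
by congr rsum; apply: funext => x; case: (f x).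
Qed.

Lemma csum_real u : (forall x, 0 <= u x) -> summ u ->
  csum (fun x => (u x)%:C) = (fsum u)%:C.
Proof.
move=> u0 su; rewrite /csum /= rsum_ge0E//.
rewrite (@rsum_ge0E (fun=> 0))// ?/fsum ?[X in _ +i* fine X]esum1//.
by rewrite /summ esum1 ?ltry// => x _; rewrite normr0.
Qed.

Lemma esum_fin_ge u (c : R) : (forall x, 0 <= u x) ->
  (forall F, finite_set F -> \sum_(x \in F) u x <= c) ->
  (\esum_(x in [set: V]) (u x)%:E <= c%:E)%E.
Proof.
move=> u0 H; apply: ge_ereal_sup => _ [X [fX _] <-].
by rewrite fsumEFin// lee_fin H.
Qed.

End UnorderedSums.

(** * Square-summable functions for a weight *)

Section L2facts.
Context {R : realType} {V : countType} (m : V -> R) (m0 : forall x, 0 <= m x).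
Implicit Types f g : V -> R[i].

Definition msq f x := m x * sq (f x).

Lemma msq_ge0 f x : 0 <= msq f x.
Proof. by rewrite mulr_ge0// sq_ge0. Qed.

Lemma sqnormE f : sqnorm m f = (\esum_(x in [set: V]) (msq f x)%:E)%E.
Proof. by rewrite /sqnorm; under eq_esum do rewrite normc_sq. Qed.

Lemma sqnorm_ge0 f : (0 <= sqnorm m f)%E.
Proof. by rewrite sqnormE esum_ge0// => x _; rewrite lee_fin msq_ge0. Qed.

Lemma ell2E f : ell2 m f <-> summ (msq f).
Proof.
rewrite /ell2 /= sqnormE /summ.
by under [in X in _ <-> X]eq_esum do rewrite ger0_norm ?msq_ge0//.
Qed.

Definition N2 f : R := fsum (msq f).

Lemma sqnorm_fin f : ell2 m f -> sqnorm m f = (N2 f)%:E.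
Proof. by move=> /ell2E sf; rewrite sqnormE summ_fin//; exact: msq_ge0. Qed.

Lemma ell2D f g : ell2 m f -> ell2 m g -> ell2 m (fun x => f x + g x).
Proof.
move=> /ell2E sf /ell2E sg; apply/ell2E.
apply: (@summ_le _ _ _ (fun x => 2 * msq f x + 2 * msq g x)).
  move=> x; rewrite !ger0_norm ?msq_ge0 ?addr_ge0 ?mulr_ge0 ?sq_ge0//.
  rewrite /msq; have := ler_wpM2l (m0 x) (sqD_le (f x) (g x)); nra.
by apply: summD; apply: summZ.
Qed.

Lemma ell2Z (c : R[i]) f : ell2 m f -> ell2 m (fun x => c * f x).
Proof.
move=> /ell2E sf; apply/ell2E.
apply: (@summ_le _ _ _ (fun x => sq c * msq f x)); last exact: summZ.
by move=> x; rewrite /msq sqM mulrCA.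
Qed.

Lemma ell2_0 : ell2 m (fun=> 0).
Proof. by apply/ell2E; rewrite /summ esum1 ?ltry// => x _; rewrite /msq sq0 mulr0 normr0. Qed.

(** Pointwise, the modulus of a term is at most [msq f x + msq g x], by comparison of the geometric
    and arithmetic means. *)
Lemma inner_summ f g : ell2 m f -> ell2 m g ->
  csumm (fun x => (m x)%:C * f x * (g x)^*).
Proof.
move=> /ell2E sf /ell2E sg; apply: (@summ_le _ _ _ (fun x => msq f x + msq g x)); last exact: summD.
move=> x; rewrite !ger0_norm ?normc_ge0 ?addr_ge0 ?msq_ge0//.
rewrite -[leRHS]ger0_norm ?addr_ge0 ?msq_ge0// -ler_sqr ?nnegrE ?normc_ge0//.
rewrite normc_sq real_normK ?num_real// !sqM sqJ /msq.
rewrite -mulrDr exprMn {1}/sq /= expr0n addr0 -mulrA.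
rewrite ler_wpM2l ?sqr_ge0//; have := sq_ge0 (f x); have := sq_ge0 (g x); nra.
Qed.

Lemma innerDl f g h : ell2 m f -> ell2 m g -> ell2 m h ->
  inner m (fun x => f x + g x) h = inner m f h + inner m g h.
Proof.
move=> lf lg lh; rewrite /inner -csumD; try exact: inner_summ.
by congr csum; apply: funext => x; rewrite mulrDr mulrDl.
Qed.

Lemma innerZl (c : R[i]) f h : ell2 m f -> ell2 m h ->
  inner m (fun x => c * f x) h = c * inner m f h.
Proof.
move=> lf lh; rewrite /inner -csumZ; last exact: inner_summ.
by congr csum; apply: funext => x; rewrite !mulrA [_ * c]mulrC.
Qed.

Lemma innerC f g : ell2 m f -> ell2 m g -> inner m g f = (inner m f g)^*.
Proof.
move=> lf lg; rewrite /inner -csumJ; last exact: inner_summ.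
congr csum; apply: funext => x; rewrite !rmorphM /= conjcK.
by rewrite oppr0 mulrAC.
Qed.

Lemma innerE f : ell2 m f -> inner m f f = (N2 f)%:C.
Proof.
move=> lf; transitivity (csum (fun x => (msq f x)%:C)); last first.
  rewrite /N2; apply: csum_real; first by move=> x; rewrite msq_ge0.
  by move/ell2E: lf.
congr csum; apply: funext => x; rewrite -mulrA mulJ /msq.
by rewrite rmorphM.
Qed.

Lemma msq_le_N2 f x : ell2 m f -> msq f x <= N2 f.
Proof.
move=> lf; rewrite -lee_fin -sqnorm_fin// sqnormE; apply: esum_ge.
by exists [set x]; [split|rewrite fsbig_set1].
Qed.

End L2facts.

(** * Hilbert spaces and compact self-adjoint operators *)

Lemma conjC_real (R : realType) (x : R) : (x%:C)^* = x%:C.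
Proof. by congr (_ +i* _); rewrite oppr0. Qed.

Section InnerProduct.
Context {R : realType} {H : lmodType R[i]} (ip : H -> H -> R[i]).
Implicit Types (f g h : H) (c : R[i]).

(** Semi-inner products: only nonnegativity is required, so that energy forms are covered before
    they are known to be definite. Definiteness and completeness are the separate properties
    [definiteH] and [completeH]. *)
Record is_ip : Prop := {
  ipDl : forall f g h, ip (f + g) h = ip f h + ip g h;
  ipZl : forall c f g, ip (c *: f) g = c * ip f g;
  ipC : forall f g, ip g f = (ip f g)^*;
  ip_ge0 : forall f, 0 <= complex.Re (ip f f)
}.

Definition nn f : R := complex.Re (ip f f).
Definition nrm f : R := Num.sqrt (nn f).

Definition cvgH (u : nat -> H) f := nn (u n - f) @[n --> \oo] --> (0 : R).

Definition completeH := forall u : nat -> H,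
  (forall e : R, 0 < e -> exists N : nat, forall n k, (N <= n)%N -> (N <= k)%N ->
    nn (u n - u k) < e) -> exists f, cvgH u f.

Definition definiteH := forall f, nn f = 0 -> f = 0.

Context (ipP : is_ip).

Lemma ipDr f g h : ip f (g + h) = ip f g + ip f h.
Proof. by rewrite (ipC ipP) (ipDl ipP) rmorphD /= -!(ipC ipP). Qed.

Lemma ipZr c f g : ip f (c *: g) = c^* * ip f g.
Proof. by rewrite (ipC ipP) (ipZl ipP) rmorphM /= -!(ipC ipP). Qed.

Lemma ip0l g : ip 0 g = 0.
Proof. by rewrite -(scale0r (0 : H)) (ipZl ipP) mul0r. Qed.

Lemma ip0r g : ip g 0 = 0.
Proof. by rewrite (ipC ipP) ip0l conjc0. Qed.

Lemma ipNl f g : ip (- f) g = - ip f g.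
Proof. by rewrite -scaleN1r (ipZl ipP) mulN1r. Qed.

Lemma ipNr f g : ip f (- g) = - ip f g.
Proof. by rewrite (ipC ipP) ipNl rmorphN /= -(ipC ipP). Qed.

Lemma ipBl f g h : ip (f - g) h = ip f h - ip g h.
Proof. by rewrite (ipDl ipP) ipNl. Qed.

Lemma ipBr f g h : ip f (g - h) = ip f g - ip f h.
Proof. by rewrite ipDr ipNr. Qed.

Lemma ip_suml (T : Type) (r : seq T) (P : pred T) (F : T -> H) g :
  ip (\sum_(i <- r | P i) F i) g = \sum_(i <- r | P i) ip (F i) g.
Proof.
elim/big_rec2: _ => [|i y x _ <-]; first exact: ip0l.
by rewrite (ipDl ipP).
Qed.

Lemma ip_sumr (T : Type) (r : seq T) (P : pred T) (F : T -> H) g :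
  ip g (\sum_(i <- r | P i) F i) = \sum_(i <- r | P i) ip g (F i).
Proof.
elim/big_rec2: _ => [|i y x _ <-]; first exact: ip0r.
by rewrite ipDr.
Qed.

Lemma ipnn f : ip f f = (nn f)%:C.
Proof.
rewrite /nn; have := ipC ipP f f; case: (ip f f) => a b /= [] /eqP.
by rewrite -addr_eq0 -mulr2n mulrn_eq0 /= => /eqP ->.
Qed.

Lemma nn_ge0 f : 0 <= nn f. Proof. exact: (ip_ge0 ipP). Qed.

Lemma nnD f g : nn (f + g) = nn f + 2 * complex.Re (ip f g) + nn g.
Proof.
rewrite /nn (ipDl ipP) !ipDr !ReD (ipC ipP f g).
by case: (ip f g) => a b /=; ring.
Qed.

Lemma nnZ c f : nn (c *: f) = sq c * nn f.
Proof.
rewrite /nn (ipZl ipP) ipZr mulrA mulJ ipnn.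
by rewrite -rmorphM /=.
Qed.

Lemma nnN f : nn (- f) = nn f.
Proof. by rewrite /nn ipNl ipNr opprK. Qed.

Lemma nnB f g : nn (f - g) = nn f - 2 * complex.Re (ip f g) + nn g.
Proof. by rewrite nnD nnN ipNr; case: (ip f g) => a b /=; ring. Qed.

Lemma nnBC f g : nn (f - g) = nn (g - f).
Proof. by rewrite -nnN opprB. Qed.

Lemma nn0 : nn 0 = 0.
Proof. by rewrite /nn ip0l. Qed.

Lemma cauchy_schwarz f g : sq (ip f g) <= nn f * nn g.
Proof.
(* The squared norm of [f - t <f, g> g]. Its minimum is at [t = 1 / nn g]; if [nn g = 0], which may
   happen for nonzero [g], a large [t] forces [ip f g = 0]. *)
have key (t : R) : 0 <= nn f - 2 * t * sq (ip f g) + t ^+ 2 * sq (ip f g) * nn g.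
  have := nn_ge0 (f - (t%:C * ip f g) *: g).
  rewrite nnB nnZ ipZr sqM rmorphM /=.
  case: (ip f g) => a b; rewrite /sq /= => h; apply: le_trans h _.
  by rewrite le_eqVlt; apply/orP; left; apply/eqP; ring.
have g0 := nn_ge0 g; have f0 := nn_ge0 f; have s0 := sq_ge0 (ip f g).
have [gz|gz] := eqVneq (nn g) 0.
  rewrite gz mulr0 leNgt; apply/negP => sp.
  have := key ((nn f + 1) / sq (ip f g)); rewrite gz mulr0 addr0.
  by rewrite -mulrA divfK ?gt_eqF//; lra.
have gp : 0 < nn g by rewrite lt0r gz.
have := key (nn g)^-1.
rewrite -(pmulr_rge0 _ gp) => h.
have : 0 <= nn f * nn g - sq (ip f g).
  apply: le_trans h _; rewrite le_eqVlt; apply/orP; left; apply/eqP.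
  by field.
by rewrite subr_ge0.
Qed.

Lemma nrm_ge0 f : 0 <= nrm f. Proof. exact: sqrtr_ge0. Qed.

Lemma nrm2 f : nrm f ^+ 2 = nn f.
Proof. by rewrite sqr_sqrtr// nn_ge0. Qed.

Lemma normc_ip f g : normc (ip f g) <= nrm f * nrm g.
Proof.
rewrite -ler_sqr ?nnegrE ?normc_ge0 ?mulr_ge0 ?nrm_ge0//.
by rewrite normc_sq exprMn !nrm2 cauchy_schwarz.
Qed.

Lemma nrmD f g : nrm (f + g) <= nrm f + nrm g.
Proof.
rewrite -ler_sqr ?nnegrE ?addr_ge0 ?nrm_ge0// sqrrD !nrm2 nnD.
rewrite lerD2r lerD2l mulr_natl lerMn2r /=.
by apply: le_trans (normc_ip f g); apply: le_trans (Re_le_normc _); exact: ler_norm.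
Qed.

Lemma nnD_le f g : nn (f + g) <= 2 * nn f + 2 * nn g.
Proof.
by have := nn_ge0 (f - g); rewrite nnB nnD; lra.
Qed.

Lemma cvgHP (u : nat -> H) f :
  cvgH u f <-> forall e : R, 0 < e -> exists N : nat, forall n, (N <= n)%N ->
    nn (u n - f) < e.
Proof.
split=> [/cvgr0Pnorm_lt h e e0|h].
  have [N _ hN] := h _ e0; exists N => n Nn.
  by have := hN n Nn; rewrite ger0_norm// nn_ge0.
apply/cvgr0Pnorm_lt => e e0; have [N hN] := h _ e0; exists N => // n Nn.
by rewrite ger0_norm ?nn_ge0// hN.
Qed.

Lemma cvgH_cauchy (u : nat -> H) f : cvgH u f ->
  forall e : R, 0 < e -> exists N : nat, forall n k, (N <= n)%N -> (N <= k)%N ->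
    nn (u n - u k) < e.
Proof.
move=> /cvgHP h e e0; have [N hN] := h (e / 4) ltac:(lra).
exists N => n k Nn Nk; rewrite -[u n](subrK f) -addrA.
apply: (le_lt_trans (nnD_le _ _)).
by rewrite [X in _ + 2 * X]nnBC; have := hN _ Nn; have := hN _ Nk; lra.
Qed.

Lemma cvgH_nrm (u : nat -> H) f : cvgH u f -> nrm (u n - f) @[n --> \oo] --> (0 : R).
Proof.
move=> h; rewrite -(sqrtr0 R).
by apply: (continuous_cvg _ (@sqrt_continuous R 0) h).
Qed.

Lemma cvgH_ip (u v : nat -> H) f g : cvgH u f -> cvgH v g ->
  normc (ip (u n) (v n) - ip f g) @[n --> \oo] --> (0 : R).
Proof.
move=> /cvgH_nrm uf /cvgH_nrm vg.
apply: (@squeeze_cvgr _ _ _ _ (fun=> 0)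
  (fun n => nrm (u n - f) * (nrm (v n - g) + nrm g) + nrm f * nrm (v n - g))).
- near=> n; rewrite normc_ge0 /=.
  have -> : ip (u n) (v n) - ip f g = ip (u n - f) (v n) + ip f (v n - g).
    by rewrite ipBl ipBr addrA subrK.
  apply: (le_trans (le_normcD _ _)); apply: lerD; last exact: normc_ip.
  apply: (le_trans (normc_ip _ _)); rewrite ler_wpM2l ?nrm_ge0//.
  by rewrite -[X in nrm X <= _](subrK g) nrmD.
- exact: cvg_cst.
- rewrite [X in _ --> X](_ : 0 = 0 * (0 + nrm g) + nrm f * 0); last by rewrite mul0r mulr0 addr0.
  apply: cvgD; first by apply: cvgM => //; apply: cvgD => //; exact: cvg_cst.
  by apply: cvgM => //; exact: cvg_cst.
Unshelve. all: by end_near. Qed.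

Lemma cvgH_cst f : cvgH (fun=> f) f.
Proof. by apply/cvgHP => e e0; exists 0%N => n _; rewrite subrr nn0. Qed.

Lemma normc_cvg_unique (a : nat -> R[i]) (z w : R[i]) :
  normc (a n - z) @[n --> \oo] --> (0 : R) ->
  normc (a n - w) @[n --> \oo] --> (0 : R) -> z = w.
Proof.
move=> az aw; apply/eqP; rewrite -subr_eq0; apply/eqP/Normc.eq0_normc.
apply/eqP; rewrite eq_le normc_ge0 andbT.
rewrite -[leRHS](addr0 (0 : R)).
apply: (@ler_cvg_to _ \oo _ _ (fun=> normc (z - w)) (fun n => normc (a n - z) + normc (a n - w))).
- exact: cvg_cst.
- exact: cvgD.
near=> n; rewrite -(normcN (a n - z)).
by apply: le_trans (le_normcD _ _); rewrite opprB addrA subrK.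
Unshelve. all: by end_near. Qed.

Lemma normc_cvg_Re (a : nat -> R[i]) (z : R[i]) :
  normc (a n - z) @[n --> \oo] --> (0 : R) ->
  complex.Re (a n) @[n --> \oo] --> complex.Re z.
Proof.
move=> az; apply/cvgrPdist_lt => e e0.
move/cvgr0Pnorm_lt: az => /(_ e e0); apply: filterS => n.
rewrite ger0_norm ?normc_ge0//; apply: le_lt_trans.
rewrite distrC; apply: le_trans (Re_le_normc _).
by case: (a n) z => ? ? [].
Qed.

Lemma cvgH_unique (u : nat -> H) f g : definiteH -> cvgH u f -> cvgH u g -> f = g.
Proof.
move=> def uf ug; apply/eqP; rewrite -subr_eq0; apply/eqP/def.
suff : ip (f - g) (f - g) = 0 by move=> e; rewrite /nn e.
rewrite ipBr; apply/eqP; rewrite subr_eq0; apply/eqP.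
apply: (@normc_cvg_unique (fun n => ip (f - g) (u n))).
  by apply: cvgH_ip => //; exact: cvgH_cst.
by apply: cvgH_ip => //; exact: cvgH_cst.
Qed.

End InnerProduct.

(** At [t = - b / (a + 1)] the quadratic equals [- (a + 2) * b ^ 2 / (a + 1) ^ 2]. Dividing by
    [a + 1] rather than by [a] includes the case [a = 0]. *)
Lemma quadratic_min (R : realType) (a b : R) : 0 <= a ->
  (forall t, 0 <= a * t ^+ 2 + 2 * b * t) -> b = 0.
Proof.
move=> a0 H; have := H (- b / (a + 1)).
have a1 : 0 < a + 1 by lra.
rewrite -(pmulr_rge0 _ (exprn_gt0 2 a1)).
have -> : (a + 1) ^+ 2 * (a * (- b / (a + 1)) ^+ 2 + 2 * b * (- b / (a + 1))) =
   - (a + 2) * b ^+ 2 by field; rewrite gt_eqF.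
rewrite nmulr_rge0 ?oppr_lt0; last by lra.
by rewrite exprn_even_le0//= => /eqP.
Qed.

Section Riesz.
Context {R : realType} {H : lmodType R[i]} (ip : H -> H -> R[i]).
Context (ipP : is_ip ip) (complete : completeH ip).
Context (l : H -> R[i]).
Hypothesis lD : forall f g, l (f + g) = l f + l g.
Hypothesis lZ : forall c f, l (c *: f) = c * l f.
Hypothesis lB : exists2 K : R, 0 <= K & forall f, sq (l f) <= K * nn ip f.

Let J f := nn ip f - 2 * complex.Re (l f).

(** Direct method: a minimizing sequence of [J] is Cauchy, and stationarity at the limit [w] gives
    [l f = ip f w], first for real parts, then for imaginary parts by testing with ['i *: f]. *)
Lemma riesz_representation : exists w, forall f, l f = ip f w.
Proof.
have [K K0 hK] := lB.
(* The reason is [2 Re (l f) <= 2 sqrt (K nn f) <= K + nn f]. *)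
have J_lb f : - K <= J f.
  have [nf0 nf0'] : 0 <= nn ip f /\ True by split=> //; exact: nn_ge0.
  have h : complex.Re (l f) ^+ 2 <= K * nn ip f.
    by apply: le_trans (hK f); rewrite lerDl sqr_ge0.
  rewrite /J; set a := complex.Re _ in h *; set b := nn ip f in h nf0 *.
  rewrite lerNl leNgt; apply/negP => hc; have b1 : 0 <= (b - a) ^+ 2 by rewrite sqr_ge0.
  have [bz|bp] := eqVneq b 0.
    rewrite bz mulr0 in h; have : a ^+ 2 = 0 by apply/eqP; rewrite eq_le h sqr_ge0.
    move/eqP; rewrite sqrf_eq0 => /eqP az; rewrite bz az in hc *.
    by move: hc; lra.
  have bp' : 0 < b by rewrite lt0r bp.
  have : K * b < (2 * a - b) * b by rewrite ltr_pM2r//; lra.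
  nra.
pose E := range J.
have E_inf : has_inf E.
  split; first by exists (J 0); exists 0.
  by exists (- K) => _ [f _ <-].
pose d := inf E.
have Jd f : d <= J f by apply: ge_inf; [exact: E_inf.2|exists f].
have min_seq n : exists f, J f < d + n.+1%:R^-1.
  have := @inf_adherent _ E n.+1%:R^-1 ltac:(by rewrite invr_gt0) E_inf.
  by move=> [_ [f _ <-]] hf; exists f.
have [u hu] := choice min_seq.
(* Parallelogram identity, with [J >= d] at the midpoint of [f] and [g]: near-minimizers are close
   to each other. *)
have par f g : nn ip (f - g) <= 2 * (J f - d) + 2 * (J g - d).
  have := Jd (2^-1 *: (f + g)).
  rewrite /J (nnZ ipP) lZ lD (nnB ipP) (nnD ipP).
  have -> : sq (2^-1 : R[i]) = 4^-1.
    have -> : (2^-1 : R[i]) = (2^-1 : R)%:C by rewrite fmorphV /= rmorph_nat.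
    by rewrite /sq /=; field.
  have -> : complex.Re (2^-1 * (l f + l g)) = 2^-1 * (complex.Re (l f) + complex.Re (l g)).
    have -> : (2^-1 : R[i]) = (2^-1 : R)%:C by rewrite fmorphV /= rmorph_nat.
    by case: (l f) (l g) => ? ? [? ?] /=; ring.
  by lra.
have [e e0|w uw] := complete (u := u).
  have [N hN] : exists N : nat, (N.+1%:R : R)^-1 < e / 4.
    have /cvgr0Pnorm_lt/(_ (e / 4) ltac:(lra))[N _ hN] := @cvg_harmonic R.
    by exists N; have := hN N (leqnn N); rewrite ger0_norm// invr_ge0.
  exists N => n k Nn Nk; apply: le_lt_trans (par _ _) _.
  have B p : (N <= p)%N -> J (u p) - d < e / 4.
    move=> Np; have := hu p.
    have : (p.+1%:R : R)^-1 <= N.+1%:R^-1 by rewrite lef_pV2 ?posrE// ler_nat.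
    move=> h1 h2; rewrite ltrBlDl; apply: (lt_trans h2); rewrite ltrD2l.
    exact: le_lt_trans h1 hN.
  by have := B _ Nn; have := B _ Nk; lra.
have lcv : complex.Re (l (u n)) @[n --> \oo] --> complex.Re (l w).
  apply/cvgrPdist_lt => e e0.
  have [|N hN] := (cvgHP ipP u w).1 uw (e ^+ 2 / (K + 1)).
    by rewrite divr_gt0 ?exprn_gt0//; lra.
  exists N => // n Nn; rewrite -ltr_sqr ?nnegrE ?(ltW e0)//.
  rewrite distrC real_normK ?num_real//.
  have -> : complex.Re (l (u n)) - complex.Re (l w) = complex.Re (l (u n - w)).
    by rewrite lD -scaleN1r lZ mulN1r; case: (l (u n)) (l w) => ? ? [].
  apply: (@le_lt_trans _ _ (sq (l (u n - w)))); first by rewrite lerDl sqr_ge0.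
  apply: le_lt_trans (hK _) _.
  have := hN n Nn; rewrite ltr_pdivlMr; last by lra.
  by have := nn_ge0 ipP (u n - w); nra.
have Jcv : J (u n) @[n --> \oo] --> J w.
  rewrite /J; apply: cvgB; last by apply: cvgM lcv; exact: cvg_cst.
  exact: normc_cvg_Re (cvgH_ip ipP uw uw).
have Jw g : J w <= J g.
  apply: le_trans (Jd g); rewrite -[leRHS]addr0.
  apply: (@ler_cvg_to _ \oo _ _ (fun n => J (u n)) (fun n => d + n.+1%:R^-1)) => //.
    by apply: cvgD; [exact: cvg_cst|exact: cvg_harmonic].
  by near=> n; rewrite ltW.
have key g : complex.Re (l g) = complex.Re (ip g w).
  apply/eqP; rewrite -subr_eq0; apply/eqP/oppr_inj; rewrite oppr0.
  apply: (@quadratic_min R (nn ip g)); first exact: nn_ge0.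
  move=> t; have := Jw (w + t%:C *: g); rewrite -subr_ge0; congr (0 <= _).
  rewrite /J (nnD ipP) (nnZ ipP) lD lZ (ipZr ipP) (ipC ipP g w).
  by case: (ip g w) (l w) (l g) => ? ? [? ?] [? ?]; rewrite /sq /=; ring.
exists w => f; have := key f; have := key ('i *: f).
rewrite lZ (ipZl ipP); case: (l f) (ip f w) => a b [c e] /=.
rewrite !mul0r !mul1r !sub0r => /oppr_inj -> -> //.
Unshelve. all: by end_near. Qed.

End Riesz.

Section OrthogonalSystem.
Context {R : realType} {H : lmodType R[i]} (ip : H -> H -> R[i]).
Context (ipP : is_ip ip) (complete : completeH ip) (definite : definiteH ip).
Context (e : nat -> H).

(* Zero vectors are allowed, so that finite-dimensional and countably indexed
   systems can be treated uniformly. *)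
Record orthosys : Prop := {
  ortho : forall j k, j != k -> ip (e j) (e k) = 0;
  orthon : forall k, nn ip (e k) = 1 \/ e k = 0
}.

Definition total_sys := forall f, (forall k, ip f (e k) = 0) -> f = 0.

Definition partial (a : nat -> R[i]) n := \sum_(k < n) a k *: e k.

Context (eP : orthosys).

(** The inner product with a zero vector is [0], so only such coefficients can be read off from the
    sum they define. *)
Definition admissible (a : nat -> R[i]) := forall k, e k = 0 -> a k = 0.

Lemma coef_admissible f : admissible (fun k => ip f (e k)).
Proof. by move=> k ->; rewrite (ip0r ipP). Qed.

Lemma ip_partial a n k : admissible a ->
  ip (partial a n) (e k) = if (k < n)%N then a k else 0.
Proof.
move=> aP; rewrite /partial (ip_suml ipP).
have E j : ip (a j *: e j) (e k) = if j == k then a k else 0.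
  rewrite (ipZl ipP); have [->|jk] := eqVneq j k; last by rewrite (ortho eP)// mulr0.
  by have [h|h] := orthon eP k; rewrite ?(aP k h) ?mul0r// (ipnn ipP) h mulr1.
under eq_bigr do rewrite E.
rewrite -(big_mkord xpredT (fun j => if j == k then a k else 0)).
by rewrite -big_mkcond /= big_nat1_eq /=.
Qed.

Lemma nn_partial a n : admissible a ->
  nn ip (partial a n) = \sum_(k < n) sq (a k).
Proof.
move=> aP; rewrite /nn {2}/partial (ip_sumr ipP).
have -> : \sum_(k < n) ip (partial a n) (a k *: e k) = (\sum_(k < n) sq (a k))%:C.
  rewrite rmorph_sum; apply: eq_bigr => k _.
  by rewrite (ipZr ipP) ip_partial// ltn_ord mulrC mulJ.
by [].
Qed.

Lemma bessel f n : \sum_(k < n) sq (ip f (e k)) <= nn ip f.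
Proof.
pose a k := ip f (e k).
have aP : admissible a := coef_admissible f.
have := nn_ge0 ipP (f - partial a n); rewrite (nnB ipP) nn_partial//.
have -> : complex.Re (ip f (partial a n)) = \sum_(k < n) sq (a k).
  rewrite /partial (ip_sumr ipP).
  under eq_bigr do rewrite (ipZr ipP) mulrC mulJ.
  by rewrite -rmorph_sum.
by rewrite -/a; lra.
Qed.

Lemma partialB a n m : (n <= m)%N ->
  nn ip (partial a m - partial a n) = nn ip (partial (fun k => if (k < n)%N then 0 else a k) m).
Proof.
move=> nm; congr nn; apply/eqP; rewrite subr_eq addrC; apply/eqP.
rewrite /partial (big_ord_widen_cond m xpredT (fun k => a k *: e k) nm).
rewrite [X in _ = X + _]big_mkcond -big_split /=.
by apply: eq_bigr => k _; case: ifP => _; rewrite ?scale0r ?addr0 ?add0r.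
Qed.

(** The squared norm of a block of the sum is a block of the convergent series of the [sq (a k)], so
    the partial sums are Cauchy. *)
Lemma riesz_fischer (a : nat -> R[i]) (M : R) : admissible a ->
  (forall n, \sum_(k < n) sq (a k) <= M) ->
  exists f, cvgH ip (partial a) f /\ forall k, ip f (e k) = a k.
Proof.
move=> aP aM.
have [eps eps0|f fP] := complete (u := partial a).
  have nd : nondecreasing_seq (fun n => \sum_(k < n) sq (a k)).
    by apply/nondecreasing_seqP => n; rewrite big_ord_recr lerDl sq_ge0.
  have cv := nondecreasing_is_cvgn nd (ex_intro _ M (fun x '(ex_intro2 n _ h) => eq_rect _ (fun x => x <= M) (aM n) x h)).
  have /cvgr_dist_lt := cv; set L := lim _ => /(_ (eps / 2) ltac:(lra)) [N _ hN].
  exists N.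
  have key n k : (N <= n)%N -> (n <= k)%N -> nn ip (partial a n - partial a k) < eps.
    move=> Nn nk; rewrite (nnBC ipP) partialB// nn_partial; last first.
      by move=> j ej; case: ifP => // _; exact: aP.
    have E : \sum_(j < k) sq (if (j < n)%N then 0 else a j) =
        \sum_(j < k) sq (a j) - \sum_(j < n) sq (a j).
      apply/eqP; rewrite eq_sym subr_eq addrC; apply/eqP.
      rewrite (big_ord_widen_cond k xpredT (fun j => sq (a j)) nk).
      rewrite [X in _ = X + _]big_mkcond -big_split /=.
      by apply: eq_bigr => j _; case: ifP => _; rewrite ?sq0 ?addr0 ?add0r.
    have := hN n Nn; have := hN k (leq_trans Nn nk).
    by rewrite E /= !ltr_norml => /andP[h1 h2] /andP[h3 h4]; lra.
  move=> n k Nn Nk; case: (leqP n k) => nk; first exact: key.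
  by rewrite (nnBC ipP) key// ltnW.
exists f; split=> // k.
apply: (@normc_cvg_unique _ (fun n => ip (partial a n) (e k))).
  by apply: cvgH_ip => //; exact: cvgH_cst.
apply/cvgr0Pnorm_lt => eps eps0; exists k.+1 => // n kn.
by rewrite ip_partial// kn subrr Normc.normc0 normr0.
Qed.

Context (eT : total_sys).

(** By Bessel's inequality the coefficients of [f] are those of some sum [g]; totality identifies
    [g] with [f]. *)
Lemma parseval_cvg f : cvgH ip (partial (fun k => ip f (e k))) f.
Proof.
have [g [gP gk]] := riesz_fischer (coef_admissible f) (bessel f).
suff -> : f = g by rewrite (_ : (fun k => ip g (e k)) = (fun k => ip f (e k)))//; apply: funext => k; rewrite gk.
apply/eqP; rewrite -subr_eq0; apply/eqP/eT => k.
by rewrite (ipBl ipP) gk subrr.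
Qed.

Lemma coef_inj f g : (forall k, ip f (e k) = ip g (e k)) -> f = g.
Proof.
move=> fg; apply/eqP; rewrite -subr_eq0; apply/eqP/eT => k.
by rewrite (ipBl ipP) fg subrr.
Qed.

Lemma parseval f : (fun n => \sum_(k < n) sq (ip f (e k))) @ \oo --> nn ip f.
Proof.
have h := normc_cvg_Re (cvgH_ip ipP (parseval_cvg f) (parseval_cvg f)).
apply: cvg_trans h; apply: near_eq_cvg; near=> n.
by rewrite -[LHS]/(nn ip _) nn_partial//; exact: coef_admissible.
Unshelve. all: by end_near. Qed.

Lemma parseval_ip f g : (fun n => normc
   (\sum_(k < n) ip f (e k) * (ip g (e k))^* - ip f g)) @ \oo --> (0 : R).
Proof.
have h := cvgH_ip ipP (parseval_cvg f) (parseval_cvg g).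
apply: cvg_trans h; apply: near_eq_cvg; near=> n.
congr (normc (_ - _)); rewrite {2}/partial (ip_sumr ipP); apply: eq_bigr => k _.
rewrite (ipZr ipP) ip_partial; last exact: coef_admissible.
by rewrite ltn_ord mulrC.
Unshelve. all: by end_near. Qed.

End OrthogonalSystem.

Section CompactOperator.
Context {R : realType} {H : lmodType R[i]} (ip : H -> H -> R[i]).
Context (ipP : is_ip ip) (complete : completeH ip) (definite : definiteH ip).
Context (B : H -> H).
Hypothesis BD : forall f g, B (f + g) = B f + B g.
Hypothesis BZ : forall c f, B (c *: f) = c *: B f.
Hypothesis Bsym : forall f g, ip (B f) g = ip f (B g).
Hypothesis Bpos : forall f, 0 <= complex.Re (ip (B f) f).
Hypothesis Binj : forall f, B f = 0 -> f = 0.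
Hypothesis Bbounded : exists2 K : R, 0 <= K & forall f, nn ip (B f) <= K * nn ip f.
Hypothesis Bcompact : forall (u : nat -> H) (M : R), (forall n, nn ip (u n) <= M) ->
  exists (s : nat -> nat) (g : H), {homo s : i j / (i < j)%N} /\ cvgH ip (fun n => B (u (s n))) g.

Let q f := complex.Re (ip (B f) f).

(** The form of [B] is itself a semi-inner product, which makes the Cauchy-Schwarz inequality
    available for it. *)
Let ipB : is_ip (fun f g => ip (B f) g).
Proof.
split=> //.
- by move=> f g h; rewrite BD (ipDl ipP).
- by move=> c f g; rewrite BZ (ipZl ipP).
- by move=> f g; rewrite Bsym (ipC ipP).
Qed.

Let eigen (s : seq H) := forall y, y \in s -> exists b : R, B y = b%:C *: y.
Let perp (s : seq H) f := forall y, y \in s -> ip f y = 0.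

Lemma normalize (g : H) : 0 < nn ip g -> nn ip ((Num.sqrt (nn ip g))^-1%:C *: g) = 1.
Proof.
move=> g0; rewrite (nnZ ipP) /sq /= expr0n addr0 exprVn sqr_sqrtr ?ltW//.
by rewrite mulVf// gt_eqF.
Qed.

Lemma subseq_ge (s : nat -> nat) : {homo s : i j / (i < j)%N} -> forall n, (n <= s n)%N.
Proof. by move=> h; elim=> // n ih; apply: leq_ltn_trans ih (h _ _ _). Qed.

(** The next eigenpair, by maximizing [q] over the unit ball of the orthogonal complement of the
    eigenvectors already found. By compactness the images under [B] of a maximizing sequence
    converge along a subsequence, and [B u - M u] tends to [0], so the limit is an eigenvector. If
    the complement is trivial, the zero vector with the dummy eigenvalue [1] is returned, so that
    the iteration never stops. *)
Lemma rayleigh_max (s : seq H) : eigen s -> exists xb : H * R,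
  [/\ perp s xb.1, nn ip xb.1 = 1 \/ xb.1 = 0, 0 < xb.2,
     B xb.1 = xb.2%:C *: xb.1 &
     (xb.1 = 0 -> forall f, perp s f -> f = 0) /\
     forall f, perp s f -> q f <= xb.2 * nn ip f].
Proof.
move=> es.
have perpD f g : perp s f -> perp s g -> perp s (f + g).
  by move=> pf pg y ys; rewrite (ipDl ipP) pf// pg// addr0.
have perpZ c f : perp s f -> perp s (c *: f).
  by move=> pf y ys; rewrite (ipZl ipP) pf// mulr0.
have perpB f : perp s f -> perp s (B f).
  move=> pf y ys; rewrite Bsym; have [b ->] := es y ys.
  by rewrite (ipZr ipP) pf// mulr0.
have [zero|/existsNP[f0 /not_implyP[pf0 f00]]] := pselect (forall f, perp s f -> f = 0).
  exists (0, 1); split=> //=.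
  - by move=> y _; rewrite (ip0l ipP).
  - by right.
  - by rewrite -{1}(scale0r (0 : H)) BZ scale0r scaler0.
  - by split=> // f /zero ->; rewrite /q (ip0r ipP) (nn0 ipP) mulr0.
have nn_gt0 f : f <> 0 -> 0 < nn ip f.
  by move=> fn; rewrite lt0r (nn_ge0 ipP) andbT; apply/eqP => /definite.
have csB f g : sq (ip (B f) g) <= q f * q g := cauchy_schwarz ipB f g.
have q_gt0 f : f <> 0 -> 0 < q f.
  move=> fn; rewrite lt0r Bpos andbT; apply/eqP => qf.
  apply: fn; apply: Binj; apply: definite; apply/eqP.
  have := csB f (B f); rewrite qf mul0r (ipnn ipP) /sq /= expr0n addr0 => h.
  by rewrite -sqrf_eq0 eq_le h sqr_ge0.
have [K K0 hK] := Bbounded.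
have q_le f : nn ip f <= 1 -> q f <= K + 1.
  move=> f1; have := nn_ge0 ipP (B f - f); rewrite (nnB ipP) -/(q f).
  have := hK f; have := Bpos f; rewrite -/(q f); have := nn_ge0 ipP f; nra.
pose E := [set q f | f in [set f | perp s f /\ nn ip f <= 1]].
have E_sup : has_sup E.
  split; last by exists (K + 1) => _ [f [_ f1] <-]; exact: q_le.
  by exists (q 0); exists 0 => //; split; [move=> y _; rewrite (ip0l ipP)|rewrite (nn0 ipP)].
pose M := sup E.
have qM f : perp s f -> nn ip f <= 1 -> q f <= M.
  by move=> pf f1; apply: ub_le_sup; [exact: E_sup.2|exists f].
have qZ c f : q (c *: f) = sq c * q f by exact: (nnZ ipB c f).
have qMn f : perp s f -> q f <= M * nn ip f.
  move=> pf; have [->|fn] := pselect (f = 0); first by rewrite /q (ip0r ipP) (nn0 ipP) mulr0.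
  have nf := nn_gt0 _ fn.
  have := qM _ (perpZ ((Num.sqrt (nn ip f))^-1%:C) f pf).
  rewrite normalize// => /(_ (lexx _)).
  rewrite qZ /sq /= expr0n addr0 exprVn sqr_sqrtr ?(ltW nf)// mulrC.
  by rewrite ler_pdivrMr.
have M0 : 0 < M.
  by have := qMn _ pf0; have := q_gt0 _ f00; have := nn_gt0 _ f00; nra.
(* Cauchy-Schwarz for the form of [B] between [f] and [B f], together with
   [q (B f) <= M * nn ip (B f)], as [B f] stays in the complement. *)
have BM f : perp s f -> nn ip (B f) <= M * q f.
  move=> pf; have [bz|bn] := pselect (B f = 0).
    by rewrite bz (nn0 ipP) mulr_ge0 ?(ltW M0)//; exact: Bpos.
  have bp := nn_gt0 _ bn.
  have := csB f (B f); rewrite (ipnn ipP) /sq /= expr0n addr0.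
  have := qMn _ (perpB _ pf); have := Bpos f; rewrite -/(q f) => h1 h2 h3.
  rewrite -(ler_pM2r bp) -expr2; apply: (le_trans h3); rewrite mulrAC mulrC.
  by rewrite ler_wpM2r.
have max_seq n : exists f, [/\ perp s f, nn ip f <= 1 & M - n.+1%:R^-1 < q f].
  have := @sup_adherent _ E n.+1%:R^-1 ltac:(by rewrite invr_gt0) E_sup.
  by move=> [_ [f [pf f1] <-]] hf; exists f.
have [u hu] := choice max_seq.
have [t [g [th gP]]] := Bcompact (fun n => let: And3 _ h _ := hu n in h).
pose v n := M%:C *: u (t n).
(* With [u] short for [u (t n)], the left side expands to [nn (B u) - 2 M q u + M ^ 2 nn u], hence
   is at most [M (M - q u)]. *)
have Bv n : nn ip (B (u (t n)) - v n) <= M * n.+1%:R^-1.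
  have [p1 p2 p3] := hu (t n).
  rewrite (nnB ipP) (nnZ ipP) (ipZr ipP).
  rewrite [X in complex.Re (X * _)]conjC_real.
  have -> : complex.Re (M%:C * ip (B (u (t n))) (u (t n))) = M * q (u (t n)).
    by rewrite /q; case: (ip _ _) => ? ? /=; rewrite mul0r subr0.
  have -> : sq M%:C = M ^+ 2 by rewrite /sq /= expr0n addr0.
  have : ((t n).+1%:R : R)^-1 <= n.+1%:R^-1.
    by rewrite lef_pV2 ?posrE// ler_nat ltnS subseq_ge.
  have := BM _ p1; move: p2 p3; set x := _^-1; set y := _^-1 => *.
  nra.
have vg : cvgH ip v g.
  apply/(cvgHP ipP) => eps eps0.
  have [N1 hN1] := (cvgHP ipP _ _).1 gP (eps / 4) ltac:(lra).
  have /cvgr0Pnorm_lt/(_ (eps / (4 * M)) ltac:(rewrite divr_gt0//; lra))[N2 _ hN2] := @cvg_harmonic R.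
  exists (maxn N1 N2) => n; rewrite geq_max => /andP[n1 n2].
  have -> : v n - g = (v n - B (u (t n))) + (B (u (t n)) - g) by rewrite addrA subrK.
  apply: le_lt_trans (nnD_le ipP _ _) _.
  have := hN1 n n1; have := Bv n; rewrite (nnBC ipP (v n)).
  have := hN2 n n2; rewrite ger0_norm ?invr_ge0// ltr_pdivlMr; last by lra.
  rewrite /harmonic /=; set x := _^-1 => *; nra.
have pg : perp s g.
  move=> y ys; apply: (@normc_cvg_unique _ (fun n => ip (v n) y)).
    by apply: cvgH_ip => //; exact: cvgH_cst.
  apply/cvgr0Pnorm_lt => eps eps0; exists 0%N => // n _.
  have [p1 _ _] := hu (t n).
  by rewrite (ipZl ipP) p1// mulr0 subrr Normc.normc0 normr0.
(* The limit is not zero: [nn (v n) = M ^ 2 nn u >= M q u], and [q u] tends to [M]. *)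
have gM : M ^+ 2 <= nn ip g.
  apply: (@ler_cvg_to _ \oo _ _ (fun n => M * (M - n.+1%:R^-1)) (fun n => nn ip (v n))).
  - rewrite expr2 -[X in _ --> M * X]subr0; apply: cvgM; first exact: cvg_cst.
    by apply: cvgB; [exact: cvg_cst|exact: cvg_harmonic].
  - exact: normc_cvg_Re (cvgH_ip ipP vg vg).
  near=> n; have [p1 p2 p3] := hu (t n).
  rewrite (nnZ ipP) [sq _]/sq /= expr0n addr0 expr2 -mulrA ler_pM2l//.
  have : ((t n).+1%:R : R)^-1 <= n.+1%:R^-1.
    by rewrite lef_pV2 ?posrE// ler_nat ltnS subseq_ge.
  have := qMn _ p1; move: p3; set x := _^-1; set y := _^-1; lra.
have g0 : 0 < nn ip g by apply: lt_le_trans gM; rewrite exprn_gt0.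
have Bg : B g = M%:C *: g.
  apply: (@cvgH_unique _ _ _ ipP (fun n => B (v n))) => //.
    apply/(cvgHP ipP) => eps eps0.
    have [N hN] := (cvgHP ipP _ _).1 vg (eps / (K + 1)) ltac:(rewrite divr_gt0//; lra).
    exists N => n Nn; rewrite -[- B g]scaleN1r -BZ -BD scaleN1r.
    apply: le_lt_trans (hK _) _; have := hN n Nn.
    rewrite ltr_pdivlMr; last by lra.
    by have := nn_ge0 ipP (v n - g); nra.
  apply/(cvgHP ipP) => eps eps0.
  have [N hN] := (cvgHP ipP _ _).1 gP (eps / (M ^+ 2)) ltac:(by rewrite divr_gt0// exprn_gt0).
  exists N => n Nn; rewrite BZ -scalerBr (nnZ ipP) /sq /= expr0n addr0.
  by have := hN n Nn; rewrite ltr_pdivlMr ?exprn_gt0// mulrC.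
exists ((Num.sqrt (nn ip g))^-1%:C *: g, M); split=> //=.
- exact: perpZ.
- by left; rewrite normalize.
- by rewrite BZ Bg !scalerA mulrC.
- split=> // gz; exfalso; have := normalize g0; rewrite gz (nn0 ipP) => /esym/eqP.
  by rewrite oner_eq0.
Unshelve. all: by end_near. Qed.

(** Iterate [rayleigh_max]. If some [f <> 0] were orthogonal to all [e k], every [b k] would be at
    least the Rayleigh quotient [d] of [f]; the vectors [B (e k)] would then be mutually at squared
    distance at least [2 * d ^ 2], without convergent subsequence. *)
Theorem compact_spectral : exists (e : nat -> H) (b : nat -> R),
  [/\ orthosys ip e, total_sys ip e, forall k, 0 < b k &
      forall k, B (e k) = (b k)%:C *: e k].
Proof.
have step (s : seq H) : exists xb : H * R, eigen s ->
  [/\ perp s xb.1, nn ip xb.1 = 1 \/ xb.1 = 0, 0 < xb.2,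
     B xb.1 = xb.2%:C *: xb.1 &
     (xb.1 = 0 -> forall f, perp s f -> f = 0) /\
     forall f, perp s f -> q f <= xb.2 * nn ip f].
  have [es|nes] := pselect (eigen s); last by exists (0, 0).
  by have [xb h] := rayleigh_max es; exists xb.
have [F hF] := choice step.
pose l := fix l n := if n is n'.+1 then (F (l n')).1 :: l n' else [::].
pose e n := (F (l n)).1; pose b n := (F (l n)).2.
have lS n : l n.+1 = e n :: l n by [].
have el n : eigen (l n).
  elim: n => [|n ih]; first by move=> y.
  move=> y; rewrite lS inE => /predU1P[->|]; last exact: ih.
  by exists (b n); have [] := hF _ ih.
have mem_l j n : (j < n)%N -> e j \in l n.
  elim: n => // n ih; rewrite ltnS leq_eqVlt lS inE => /predU1P[->|/ih ->].
    by rewrite eqxx.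
  by rewrite orbT.
have ej j k : (j < k)%N -> ip (e k) (e j) = 0.
  by move=> jk; have [p _ _ _ _] := hF _ (el k); exact: p (mem_l _ _ jk).
have l_mem n y : y \in l n -> exists j, y = e j.
  elim: n => // n ih; rewrite lS inE => /predU1P[->|/ih//].
  by exists n.
exists e, b; split.
- split=> [j k|k]; last by have [] := hF _ (el k).
  rewrite neq_ltn => /orP[jk|kj]; last exact: ej.
  by rewrite (ipC ipP) ej// conjc0.
- move=> f fe; apply: contrapT => fn.
  have pf n : perp (l n) f by move=> y /l_mem[j ->].
  have ek k : e k <> 0.
    by move=> ek0; apply: fn; have [_ _ _ _ [h _]] := hF _ (el k); exact: h (pf k).
  have ek1 k : nn ip (e k) = 1 by have [_ [//|/ek]] := hF _ (el k).
  have f0 : 0 < nn ip f.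
    by rewrite lt0r (nn_ge0 ipP) andbT; apply/eqP => /definite.
  have csB g h : sq (ip (B g) h) <= q g * q h := cauchy_schwarz ipB g h.
  have qf : 0 < q f.
    rewrite lt0r Bpos andbT; apply/eqP => qf.
    apply: fn; apply: Binj; apply: definite; apply/eqP.
    have := csB f (B f); rewrite qf mul0r (ipnn ipP) /sq /= expr0n addr0 => h.
    by rewrite -sqrf_eq0 eq_le h sqr_ge0.
  pose d := q f / nn ip f.
  have d0 : 0 < d by rewrite divr_gt0.
  have bd k : d <= b k.
    by have [_ _ _ _ [_ h]] := hF _ (el k); rewrite ler_pdivrMr// h//; exact: pf.
  have [t [g [th gP]]] := Bcompact (fun n => (eq_ind_r (fun x => x <= 1) (lexx 1) (ek1 n))).
  have [N hN] := cvgH_cauchy ipP gP (exprn_gt0 2 d0).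
  have := hN N N.+1 (leqnn _) (leqnSn _).
  have Be k : B (e k) = (b k)%:C *: e k by have [] := hF _ (el k).
  rewrite !Be (nnB ipP) !(nnZ ipP) !ek1 (ipZl ipP) (ipZr ipP).
  have lt := th _ _ (ltnSn N).
  have ip0 : ip (e (t N)) (e (t N.+1)) = 0 by rewrite (ipC ipP) ej// conjc0.
  rewrite ip0 !mulr0 subr0 !mulr1 /sq /= expr0n !addr0.
  by have := bd (t N); have := bd (t N.+1); nra.
- by move=> k; have [] := hF _ (el k).
- by move=> k; have [] := hF _ (el k).
Qed.

End CompactOperator.

(** * Weighted l^2 spaces *)

Section L2space.
Context {R : realType} {V : countType} (m : V -> R) (m0 : forall x, 0 <= m x).

(** The proof of [0 <= m] is an argument because closure under addition depends on it: the submodule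
    structure is attached to [ell2_pred m0]. *)
Definition ell2_pred (_ : forall x, 0 <= m x) : {pred V -> R[i]} :=
  fun f => `[< ell2 m f >].

Record L2 := MkL2 {l2fun :> V -> R[i]; _ : l2fun \in ell2_pred m0}.

HB.instance Definition _ := [isSub for l2fun].
HB.instance Definition _ := [Choice of L2 by <:].

Lemma ell2_submod : GRing.submod_closed (ell2_pred m0).
Proof.
split; first by apply/asboolP; exact: ell2_0.
move=> c f g /asboolP lf /asboolP lg; apply/asboolP.
have := ell2D m0 (ell2Z m0 c lf) lg.
by congr ell2.
Qed.

HB.instance Definition _ := GRing.isSubmodClosed.Build _ _ (ell2_pred m0) ell2_submod.
HB.instance Definition _ := [SubChoice_isSubLmodule of L2 by <:].

Lemma L2P (f : L2) : ell2 m f.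
Proof. by case: f => f /= /asboolP. Qed.

Definition toL2 (f : V -> R[i]) (lf : ell2 m f) : L2 := MkL2 (asboolT lf : f \in ell2_pred m0).

Lemma L2DE (f g : L2) x : (f + g) x = f x + g x. Proof. by []. Qed.
Lemma L2ZE c (f : L2) x : (c *: f) x = c * f x. Proof. by []. Qed.
End L2space.

(** * Pointwise limits and a compact embedding *)

Lemma subsequence_choice (P : nat -> nat -> Prop) :
  (forall k N, exists2 n, (N <= n)%N & P k n) ->
  exists s : nat -> nat, {homo s : i j / (i < j)%N} /\ forall k, P k (s k).
Proof.
move=> H.
have H' : forall kN : nat * nat, exists n, (kN.2 <= n)%N /\ P kN.1 n.
  by move=> [k N]; have [n] := H k N; exists n.
have [F hF] := choice H'.
pose s := fix s k := if k is k'.+1 then F (k, (s k').+1) else F (0%N, 0%N).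
exists s; split; last by case=> [|k]; [exact: (hF (_, _)).2|exact: (hF (_, _)).2].
apply: homo_ltn => [|k]; first by move=> ? ? ?; exact: ltn_trans.
exact: (hF (k.+1, (s k).+1)).1.
Qed.

Section PointwiseLimits.
Context {R : realType} {V : countType}.
Implicit Types (u v : nat -> V -> R[i]) (f g : V -> R[i]) (m p : V -> R).

Definition wmul m p x := m x * p x.

(** Along an arbitrary filter: completeness uses [\oo], and compactness uses an ultrafilter, which
    replaces a diagonal extraction. *)
Definition ptcvg (F : set_system nat) u f := forall x,
  (complex.Re (u n x) @[n --> F] --> complex.Re (f x)) /\
  (complex.Im (u n x) @[n --> F] --> complex.Im (f x)).

Lemma cvg_bigsum (F : set_system nat) {FF : Filter F} (T : Type) (r : seq T)
    (a : nat -> T -> R) (l : T -> R) : (forall x, a n x @[n --> F] --> l x) ->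
  \sum_(x <- r) a n x @[n --> F] --> \sum_(x <- r) l x.
Proof.
move=> al; elim: r => [|x r ih].
  rewrite big_nil (_ : (fun n => _) = fun=> 0); first exact: cvg_cst.
  by apply: funext => n; rewrite big_nil.
rewrite big_cons (_ : (fun n => _) = fun n => a n x + \sum_(x <- r) a n x).
  exact: cvgD.
by apply: funext => n; rewrite big_cons.
Qed.

Lemma ptcvg_fsum (F : set_system nat) {FF : Filter F} u f m (X : set V) : finite_set X ->
  ptcvg F u f -> \sum_(x \in X) m x * sq (u n x) @[n --> F] --> \sum_(x \in X) m x * sq (f x).
Proof.
move=> fX uf; rewrite fsbig_finite//=.
under eq_fun do rewrite fsbig_finite//=.
apply: cvg_bigsum => x; apply: cvgM; first exact: cvg_cst.
have [h1 h2] := uf x.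
by rewrite /sq; apply: cvgD; rewrite !expr2; under eq_fun do rewrite expr2; apply: cvgM.
Qed.

(** Each finite partial sum passes to the limit and keeps the bound [c]. *)
Lemma fatou (F : set_system nat) {FF : ProperFilter F} u f m (c : R) :
  (forall x, 0 <= m x) -> ptcvg F u f ->
  (\forall n \near F, (sqnorm m (u n) <= c%:E)%E) -> (sqnorm m f <= c%:E)%E.
Proof.
move=> m0 uf uc; rewrite sqnormE; apply: esum_fin_ge.
  by move=> x; rewrite mulr_ge0// sq_ge0.
move=> X fX; have h := @ptcvg_fsum F (@filter_filter _ F FF) u f m X fX uf.
apply: (@ler_cvg_to _ F _ _ (fun n => \sum_(x \in X) m x * sq (u n x)) (fun=> c)) => //.
  exact: cvg_cst.
apply: filterS uc => n; rewrite sqnormE => h1; rewrite -lee_fin; apply: le_trans h1.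
apply: esum_ge; exists X; first by split.
by rewrite fsumEFin.
Qed.

Lemma ptcvgB (F : set_system nat) {FF : Filter F} u f g : ptcvg F u f ->
  ptcvg F (fun n x => u n x - g x) (fun x => f x - g x).
Proof.
move=> uf x; have [h1 h2] := uf x; split.
  have -> : complex.Re (f x - g x) = complex.Re (f x) - complex.Re (g x).
    by case: (f x) (g x) => ? ? [].
  under eq_fun do rewrite ReD; apply: cvgD => //.
  by rewrite (_ : - complex.Re (g x) = complex.Re (- g x)); [exact: cvg_cst|case: (g x)].
have -> : complex.Im (f x - g x) = complex.Im (f x) - complex.Im (g x).
  by case: (f x) (g x) => ? ? [].
under eq_fun do rewrite ImD; apply: cvgD => //.
by rewrite (_ : - complex.Im (g x) = complex.Im (- g x)); [exact: cvg_cst|case: (g x)].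
Qed.

(** A segment is compact, hence the image filter has a cluster point, and a cluster point of an
    ultrafilter is a limit. *)
Lemma bounded_ultra_cvg (F : set_system nat) {FU : UltraFilter F} (a : nat -> R) (c : R) :
  (forall n, `|a n| <= c) -> exists l : R, a n @[n --> F] --> l.
Proof.
move=> ac; have FP : ProperFilter F by exact: ultra_proper.
have [|l [_ al]] := @segment_compact R (- c) c (a @ F) _.
  by apply: nearW => n; rewrite /= in_itv /= -ler_norml.
exists l => B lB; have [//|FB] := in_ultra_setVsetC (a @^-1` B) FU.
have [|x [+ Bx]] := al (~` B) B _ lB; first exact: FB.
by move/(_ Bx).
Qed.

Lemma bounded_ultra_ptcvg (F : set_system nat) {FU : UltraFilter F} u (b : V -> R) :
  (forall n x, sq (u n x) <= b x) -> exists f, ptcvg F u f.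
Proof.
move=> ub.
have B n x : `|complex.Re (u n x)| <= b x + 1 /\ `|complex.Im (u n x)| <= b x + 1.
  have := ub n x; rewrite /sq => h.
  have h1 := real_normK (num_real (complex.Re (u n x))).
  have h2 := real_normK (num_real (complex.Im (u n x))).
  rewrite -h1 -h2 in h.
  have := normr_ge0 (complex.Re (u n x)); have := normr_ge0 (complex.Im (u n x)).
  by split; nra.
have H x : exists z : R[i], (complex.Re (u n x) @[n --> F] --> complex.Re z) /\
    (complex.Im (u n x) @[n --> F] --> complex.Im z).
  have [l1 h1] := bounded_ultra_cvg (fun n => (B n x).1).
  have [l2 h2] := bounded_ultra_cvg (fun n => (B n x).2).
  by exists (l1 +i* l2).
by have [f hf] := choice H; exists f.
Qed.

Lemma esum_split_finite (X : set V) (a : V -> R) (b : V -> R) : finite_set X ->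
  (forall x, 0 <= a x) -> (forall x, 0 <= b x) -> (forall x, ~ X x -> a x <= b x) ->
  (\esum_(x in [set: V]) (a x)%:E <= (\sum_(x \in X) a x)%:E +
    \esum_(x in [set: V]) (b x)%:E)%E.
Proof.
move=> fX a0 b0 ab.
have -> : ((\sum_(x \in X) a x)%:E = \esum_(x in [set: V]) (if x \in X then (a x)%:E else 0))%E.
  rewrite -fsumEFin// -esum_fset//; last by move=> i _; rewrite lee_fin.
  by rewrite esum_mkcond.
rewrite -esumD//.
- apply: le_esum => x _; case: ifPn => xX; first by rewrite leeDl// lee_fin.
  by rewrite add0e lee_fin ab//; move/negP: xX; rewrite inE.
- by move=> x _; case: ifP => // _; rewrite lee_fin.
- by move=> x _; rewrite lee_fin.
Qed.

(** Where [p > c], the norm with weight [m] is small: its square is at most [1 / c] times that with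
    weight [wmul m p]. The remaining set is finite, and there pointwise convergence along an
    ultrafilter suffices. *)
Lemma compact_embedding m p u (M : R) : (forall x, 0 < m x) -> (forall x, 0 < p x) ->
  (forall c, finite_set [set x | p x <= c]) ->
  (forall n, (sqnorm (wmul m p) (u n) <= M%:E)%E) ->
  exists (s : nat -> nat) g, [/\ {homo s : i j / (i < j)%N}, ell2 m g &
    cvg_ell2 m (fun n => u (s n)) g].
Proof.
move=> m0 p0 pfin uM.
have m0' x : 0 <= m x by exact: ltW.
have mp0 x : 0 < wmul m p x by rewrite mulr_gt0.
have mp0' x : 0 <= wmul m p x by exact: ltW.
have M0 : 0 <= M by rewrite -lee_fin; apply: le_trans (uM 0%N); exact: sqnorm_ge0.
have [G [GU GF]] := ultraFilterLemma (_ : ProperFilter (\oo : set_system nat)).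
have ub n x : sq (u n x) <= M / wmul m p x.
  rewrite ler_pdivlMr// mulrC.
  have lu : ell2 (wmul m p) (u n) by rewrite /ell2 /= (le_lt_trans (uM n))// ltry.
  apply: le_trans (msq_le_N2 mp0' x lu) _.
  by rewrite -lee_fin -sqnorm_fin.
have [g ug] := bounded_ultra_ptcvg ub.
have split_bound f (c D : R) : 0 < c -> (sqnorm (wmul m p) f <= D%:E)%E ->
   (sqnorm m f <= (\sum_(x \in [set x | p x <= c]) m x * sq (f x) + D / c)%:E)%E.
  move=> c0 fD; rewrite sqnormE.
  apply: le_trans (esum_split_finite (b := fun x => c^-1 * msq (wmul m p) f x) (pfin c) _ _ _) _.
  - exact: msq_ge0.
  - by move=> x; rewrite mulr_ge0 ?invr_ge0 ?(ltW c0) ?msq_ge0.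
  - move=> x /negP; rewrite -ltNge => cp; rewrite /msq mulrA mulrCA -mulrA ler_wpM2l//.
    rewrite ler_peMl ?sq_ge0// mulrC ler_pdivlMr// mul1r ltW//.
  rewrite EFinD leeD2l// esumZ ?invr_ge0 ?(ltW c0)//; last exact: msq_ge0.
  by rewrite -sqnormE mulrC EFinM lee_wpmul2l// lee_fin invr_ge0 ltW.
have gM : (sqnorm (wmul m p) g <= M%:E)%E.
  by apply: (fatou mp0' ug); apply: nearW => n; exact: uM.
have lg : ell2 m g.
  by rewrite /ell2 /=; apply: le_lt_trans (split_bound _ 1 M ltr01 gM) _; rewrite ltry.
have near_g (e : R) : 0 < e -> \forall n \near G, (sqnorm m (fun x => u n x - g x)%R < e%:E)%E.
  (* The difference with [g] has squared weighted norm at most [4 * M], and this [c] makes the tail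
     [4 * M / c] at most [e / 4]; the finite part will be below [e / 2]. *)
  move=> e0; pose c := (4 * M + 1) * 4 / e.
  have c0 : 0 < c by rewrite divr_gt0// mulr_gt0//; lra.
  have FG : Filter G by exact: filter_filter.
  have uG := @ptcvg_fsum G FG _ _ m _ (pfin c) (@ptcvgB G FG _ _ g ug).
  have z : \sum_(x \in [set x | p x <= c]) m x * sq (g x - g x) = 0.
    by rewrite fsbig1// => x _; rewrite subrr sq0 mulr0.
  rewrite z in uG; move/cvgr0Pnorm_lt: uG => /(_ (e / 2) ltac:(lra)).
  apply: filterS => n h.
  have uD : (sqnorm (wmul m p) (fun x => u n x - g x)%R <= (4 * M)%:E)%E.
    have lu : ell2 (wmul m p) (u n) by rewrite /ell2 /= (le_lt_trans (uM n))// ltry.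
    have lg' : ell2 (wmul m p) g by rewrite /ell2 /= (le_lt_trans gM)// ltry.
    apply: (@le_trans _ _ (\esum_(x in [set: V]) ((2 * msq (wmul m p) (u n) x)%:E
       + (2 * msq (wmul m p) g x)%:E))%E).
      rewrite sqnormE; apply: le_esum => x _; rewrite -EFinD lee_fin /msq.
      by have := ler_wpM2l (mp0' x) (sqD_le (u n x) (- g x)); rewrite sqN; lra.
    rewrite esumD; try by move=> x _; rewrite lee_fin mulr_ge0// msq_ge0.
    rewrite !esumZ//; try exact: msq_ge0.
    rewrite -!sqnormE (_ : 4 * M = 2 * M + 2 * M); last by ring.
    by rewrite (EFinD (2 * M)) (EFinM 2 M) leeD// lee_wpmul2l// lee_fin.
  apply: le_lt_trans (split_bound _ c _ c0 uD) _; rewrite lte_fin.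
  move: h; rewrite ltr_norml => /andP[_ h].
  apply: (@lt_le_trans _ _ (e / 2 + 4 * M / c)); first by rewrite ltrD2r.
  have -> : 4 * M / c = e * (M / (4 * M + 1)).
    by rewrite /c; field; rewrite !gt_eqF//; lra.
  have : M / (4 * M + 1) <= 4^-1.
    by rewrite ler_pdivrMr; [lra|lra].
  by move=> h'; have := ler_wpM2l (ltW e0) h'; lra.
(* As [G] refines [\oo], each of its sets meets every tail: a genuine subsequence can be picked with
   errors below [1 / (k + 1)]. *)
have [k N|s [hs sP]] := @subsequence_choice (fun k n => (sqnorm m (fun x => u n x - g x)%R < (k.+1%:R^-1)%:E)%E).
  have h1 := near_g k.+1%:R^-1 ltac:(by rewrite invr_gt0).
  have h2 : G [set n | (N <= n)%N] by apply: GF; exists N.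
  have [n [? ?]] : ([set n | (sqnorm m (fun x => u n x - g x)%R < (k.+1%:R^-1)%:E)%E] `&` [set n | (N <= n)%N]) !=set0.
    have GP : ProperFilter G by exact: ultra_proper.
    by apply: (@filter_ex _ G GP); exact: filterI.
  by exists n.
exists s, g; split => //; rewrite /cvg_ell2.
apply: (@squeeze_cvge _ _ _ _ (fun=> 0%E) _ (fun n => (n.+1%:R^-1)%:E)).
- by apply: nearW => n; rewrite sqnorm_ge0//= ltW// sP.
- exact: cvg_cst.
- by apply: cvg_EFin; [exact: nearW|exact: cvg_harmonic].
Qed.

End PointwiseLimits.

Section L2Hilbert.
Context {R : realType} {V : countType} (m : V -> R) (m0 : forall x, 0 <= m x).
Notation H := (L2 m0).

Definition L2ip (f g : H) : R[i] := inner m f g.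

Lemma L2ipP : is_ip L2ip.
Proof.
split.
- by move=> f g h; apply: innerDl => //; exact: L2P.
- by move=> c f g; apply: innerZl => //; exact: L2P.
- by move=> f g; apply: innerC => //; exact: L2P.
- by move=> f; rewrite /L2ip innerE//; [apply: fsum_ge0 => x; rewrite msq_ge0|exact: L2P].
Qed.

Lemma L2nn (f : H) : nn L2ip f = N2 m f.
Proof. by rewrite /nn /L2ip innerE//; exact: L2P. Qed.

Lemma L2nn_sqnorm (f : H) : sqnorm m f = (nn L2ip f)%:E.
Proof. by rewrite L2nn sqnorm_fin//; exact: L2P. Qed.

Lemma L2_ext (f g : H) : (forall x, f x = g x) -> f = g.
Proof. by move=> fg; apply: val_inj; apply: funext. Qed.

Lemma cvgH_ell2 (u : nat -> H) (f : H) : cvgH L2ip u f <-> cvg_ell2 m u f.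
Proof.
rewrite /cvgH /cvg_ell2.
have -> : (fun n => sqnorm m (u n \- f)) = (fun n => (nn L2ip (u n - f))%:E).
  by apply: funext => n; rewrite -L2nn_sqnorm.
by split=> [h|/fine_cvgP[_ h]//]; apply: cvg_EFin => //; exact: nearW.
Qed.

Lemma L2_definite : (forall x, 0 < m x) -> definiteH L2ip.
Proof.
move=> mp f f0; apply: L2_ext => x; apply: sq_eq0; apply/eqP.
have := msq_le_N2 m0 x (L2P f); rewrite -L2nn f0 => h.
have : m x * sq (f x) == 0 by rewrite eq_le h mulr_ge0// sq_ge0.
by rewrite mulf_eq0 gt_eqF.
Qed.

Lemma sq_le_nn (mp : forall x, 0 < m x) (f : H) x : sq (f x) <= nn L2ip f / m x.
Proof. by rewrite ler_pdivlMr// mulrC L2nn; exact: (msq_le_N2 m0 x (L2P f)). Qed.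

(** Point evaluations are continuous, so a Cauchy sequence converges pointwise; [fatou], applied to
    the differences, turns this into convergence in norm. *)
Lemma L2_complete : (forall x, 0 < m x) -> completeH L2ip.
Proof.
move=> mp u cu.
have ptc x : exists z : R[i], (complex.Re (u n x) @[n --> \oo] --> complex.Re z) /\
    (complex.Im (u n x) @[n --> \oo] --> complex.Im z).
  have key (e : R) : 0 < e -> exists N, forall n k, (N <= n)%N -> (N <= k)%N -> sq (u n x - u k x) < e ^+ 2.
    move=> e0; have [N hN] := cu (e ^+ 2 * m x) ltac:(by rewrite mulr_gt0// exprn_gt0).
    exists N => n k Nn Nk; apply: le_lt_trans (sq_le_nn mp (u n - u k) x) _.
    by rewrite ltr_pdivrMr// hN.
  have cv (P : R[i] -> R) : (forall z w, (P z - P w) ^+ 2 <= sq (z - w)) -> exists l : R, P (u n x) @[n --> \oo] --> l.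
    move=> hP; apply/cvg_ex/cauchy_cvgP/cauchy_exP => e /= e0.
    have [N hN] := key e e0; exists (P (u N x)); exists N => // n /= Nn.
    rewrite /ball /= -ltr_sqr ?nnegrE ?(ltW e0)// real_normK ?num_real//.
    exact: le_lt_trans (hP _ _) (hN _ _ _ _).
  have [|l1 h1] := cv (@complex.Re R).
    by move=> [a b] [c d]; rewrite /sq /= lerDl sqr_ge0.
  have [|l2 h2] := cv (@complex.Im R).
    by move=> [a b] [c d]; rewrite /sq /= lerDr sqr_ge0.
  by exists (l1 +i* l2).
have [f hf] := choice ptc.
have uf : ptcvg \oo (fun n => u n : V -> R[i]) f by [].
have bound (e : R) : 0 < e -> exists N, forall n, (N <= n)%N -> (sqnorm m (fun x => u n x - f x)%R <= e%:E)%E.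
  move=> e0; have [N hN] := cu e e0; exists N => n Nn.
  have E : sqnorm m (fun x => u n x - f x) = sqnorm m (fun x => f x - u n x).
    by rewrite !sqnormE; apply: eq_esum => x _; rewrite /msq -sqN opprB.
  rewrite E; apply: (@fatou R V \oo _ _ _ m _ m0 (@ptcvgB R V \oo _ _ _ (u n) uf)).
  exists N => // k /= Nk; have := L2nn_sqnorm (u k - u n).
  by rewrite /= => ->; rewrite lee_fin ltW// hN.
have lf : ell2 m f.
  have [N hN] := bound 1 ltr01.
  have lN : ell2 m (u N \- f) by rewrite /ell2 /= (le_lt_trans (hN N (leqnn _)))// ltry.
  have := ell2D m0 (L2P (u N)) (ell2Z m0 (-1) lN).
  by congr ell2; apply: funext => x; rewrite mulN1r opprB addrC subrK.
exists (toL2 m0 lf); apply/(cvgHP L2ipP) => e e0.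
have [N hN] := bound (e / 2) ltac:(lra); exists N => n Nn.
have := hN n Nn; have := L2nn_sqnorm (u n - toL2 m0 lf).
by rewrite /= => ->; rewrite lee_fin => h; apply: le_lt_trans h _; lra.
Qed.

End L2Hilbert.

(** * Spectral measure of a diagonal operator *)

Section DiagonalOperator.
Context {R : realType} {V : countType} (m : V -> R) (m0 : forall x, 0 < m x).
Let m0' x : 0 <= m x := ltW (m0 x).
Notation H := (L2 m0').
Notation ip := (@L2ip R V m m0').
Context (e : nat -> H) (mu : nat -> R).
Context (eP : orthosys ip e) (eT : total_sys ip e) (mu0 : forall k, 0 <= mu k).
Context (T : (V -> R[i]) -> (V -> R[i]) -> Prop).
Hypothesis TP : forall f h, T f h <-> exists F G : H,
  [/\ f = F, h = G & forall k, ip G (e k) = (mu k)%:C * ip F (e k)].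

Let ipP : is_ip ip := L2ipP m0'.
Let complete : completeH ip := @L2_complete R V m m0' m0.

Let chi (A : set R) k : R := \1_A (mu k).

Let chi01 A k : chi A k = 0 \/ chi A k = 1.
Proof. by rewrite /chi indicE; case: (_ \in _); [right|left]. Qed.

Lemma spectral_proj_exists A (F : H) :
  exists G : H, forall k, ip G (e k) = (chi A k)%:C * ip F (e k).
Proof.
have [|n|G [_ hG]] := riesz_fischer ipP complete eP (a := fun k => (chi A k)%:C * ip F (e k)) (M := nn ip F).
- by move=> k ek; rewrite ek (ip0r ipP) mulr0.
- apply: le_trans (bessel ipP eP F n); apply: ler_sum => k _.
  rewrite sqM; have [->|->] := chi01 A k; last by rewrite /sq /= expr0n expr1n addr0 mul1r.
  by rewrite sq0 mul0r sq_ge0.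
- by exists G.
Qed.

Definition spectral_proj A F : H := xget 0 [set G : H | forall k, ip G (e k) = (chi A k)%:C * ip F (e k)].

Lemma spectral_projE A F k : ip (spectral_proj A F) (e k) = (chi A k)%:C * ip F (e k).
Proof.
have [G hG] := spectral_proj_exists A F.
by have := @xgetPex H 0 [set G : H | forall k, ip G (e k) = (chi A k)%:C * ip F (e k)] (ex_intro _ G hG) k.
Qed.

Lemma spectral_proj_sym A F G : ip (spectral_proj A F) G = ip F (spectral_proj A G).
Proof.
apply: (normc_cvg_unique (parseval_ip ipP complete eP eT (spectral_proj A F) G)).
have h := parseval_ip ipP complete eP eT F (spectral_proj A G).
apply: cvg_trans h; apply: near_eq_cvg; apply: nearW => n.
congr (normc (_ - _)); apply: eq_bigr => k _.
rewrite !spectral_projE rmorphM [X in _ * (X * _)]conjC_real.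
by rewrite mulrCA mulrA.
Qed.

Let coefP (F G : H) : (forall k, ip F (e k) = ip G (e k)) -> F = G.
Proof. exact: coef_inj. Qed.

Lemma spectral_projI A B F : spectral_proj (A `&` B) F = spectral_proj A (spectral_proj B F).
Proof.
apply: coefP => k; rewrite !spectral_projE mulrA -rmorphM /=; congr (_%:C * _).
by rewrite /chi indicI.
Qed.

(** Outside [ell2] the value is arbitrary, since [is_pvm] constrains only square-summable
    functions. *)
Definition spectral_fun (A : set R) (f : V -> R[i]) : V -> R[i] :=
  if pselect (ell2 m f) is left lf then spectral_proj A (toL2 m0' lf) else f.

Lemma spectral_funE A (F : H) : spectral_fun A F = spectral_proj A F.
Proof.
rewrite /spectral_fun; case: pselect => [lf|]; last by move/(_ (L2P F)).
by congr (l2fun (spectral_proj A _)); apply: L2_ext.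
Qed.

(** The point masses [sq (ip F (e k))] at [mu k], packed as a measure so that integration theory
    applies; [scalar_measure] is a mere set function, identified with it below. *)
Definition atomic (F : H) : {measure set (measurableTypeR R) -> \bar R} :=
  mseries (fun k => mscale (NngNum (sq_ge0 (ip F (e k)))) (\d_(mu k : measurableTypeR R))) 0.

Lemma nneseries_cvg (a : nat -> R) (l : R) :
  (fun n => \sum_(k < n) a k) @ \oo --> l -> (\sum_(0 <= k <oo) (a k)%:E = l%:E)%E.
Proof.
move=> al; apply: cvg_lim => //.
rewrite (_ : (fun n => _) = (fun n => (\sum_(k < n) a k)%:E)).
  by apply: cvg_EFin => //; exact: nearW.
by apply: funext => n; rewrite big_mkord sumEFin.
Qed.

Lemma scalar_measureE (F : H) : scalar_measure m spectral_fun F = atomic F.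
Proof.
apply: funext => A; rewrite /scalar_measure spectral_funE.
apply/esym; rewrite /atomic /= /mseries.
transitivity (\sum_(0 <= k <oo) (sq (ip F (e k)) * chi A k)%:E)%E.
  by apply: eq_eseriesr => k _.
apply: nneseries_cvg.
have h := normc_cvg_Re (parseval_ip ipP complete eP eT (spectral_proj A F) F).
apply: cvg_trans h; apply: near_eq_cvg; apply: nearW => n.
rewrite (@big_morph _ _ (@complex.Re R) 0 +%R) //; last exact: ReD.
apply: eq_bigr => k _; rewrite spectral_projE -mulrA mulJ -rmorphM /=.
by rewrite mulrC.
Qed.

Lemma integral_atomic F (f : measurableTypeR R -> \bar R) : (forall t, 0 <= f t)%E ->
  measurable_fun [set: measurableTypeR R] f ->
  (\int[atomic F]_(t in [set: measurableTypeR R]) f t =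
   \sum_(0 <= k <oo) ((sq (ip F (e k)))%:E * f (mu k)))%E.
Proof.
move=> f0 mf; rewrite ge0_integral_measure_series//.
apply: eq_eseriesr => k _.
by rewrite ge0_integral_mscale// integral_dirac// diracT mul1e.
Qed.

Lemma spectral_proj_add A F : nn ip (spectral_proj A F) = complex.Re (ip (spectral_proj A F) F).
Proof. by rewrite /nn -spectral_proj_sym -spectral_projI setIid. Qed.

Lemma spectral_fun_pvm : is_pvm m spectral_fun.
Proof.
split.
- move=> A mA; split.
  + move=> f lf; rewrite (_ : f = toL2 m0' lf)// spectral_funE; exact: L2P.
  + move=> c f g lf lg; rewrite (_ : (fun x => c * f x + g x) = l2fun (c *: toL2 m0' lf + toL2 m0' lg))//.
    rewrite (_ : spectral_fun A f = spectral_proj A (toL2 m0' lf)); last by rewrite -spectral_funE.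
    rewrite (_ : spectral_fun A g = spectral_proj A (toL2 m0' lg)); last by rewrite -spectral_funE.
    rewrite spectral_funE (_ : spectral_proj A _ = c *: spectral_proj A (toL2 m0' lf) + spectral_proj A (toL2 m0' lg))//.
    apply: coefP => k; rewrite spectral_projE !(ipDl ipP) !(ipZl ipP) !spectral_projE.
    by rewrite mulrDr mulrCA.
  + move=> f lf; rewrite (_ : f = toL2 m0' lf)// !spectral_funE -spectral_projI setIid//.
  + move=> f g lf lg; rewrite (_ : f = toL2 m0' lf)// (_ : g = toL2 m0' lg)// !spectral_funE.
    exact: spectral_proj_sym.
- move=> f lf; rewrite (_ : f = toL2 m0' lf)// spectral_funE; congr l2fun.
  by apply: coefP => k; rewrite spectral_projE /chi indicT mul1r.
- move=> A B f _ _ lf; rewrite (_ : f = toL2 m0' lf)// !spectral_funE.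
  by rewrite spectral_projI.
- move=> A f mA tA lf; rewrite (_ : f = toL2 m0' lf)//; set F := toL2 m0' lf.
  have -> : (fun n x => \sum_(k < n) spectral_fun (A k) F x) =
     (fun n => (\sum_(k < n) spectral_proj (A k) F : H) : V -> R[i]).
    apply: funext => n; apply: funext => x; elim: n => [|n ih]; first by rewrite !big_ord0.
    by rewrite !big_ord_recr ih [spectral_fun _ _]spectral_funE.
  rewrite spectral_funE; apply/(@cvgH_ell2 R V m m0' (fun n => \sum_(k < n) spectral_proj (A k) F))/(cvgHP ipP) => eps eps0.
  (* Strong additivity reduces to that of the scalar measure: projections of disjoint sets are
     orthogonal, so the squared distance to the partial sum is exactly
     [q U - \sum_(k < n) q (A k)]. *)
  have := @measure_semi_sigma_additive _ _ _ (atomic F) A mA tA (bigcup_measurable (fun k _ => mA k)).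
  rewrite -scalar_measureE /scalar_measure spectral_funE => /fine_cvgP[_].
  move=> /cvgrPdist_lt/(_ eps eps0) [N _ hN]; exists N => n Nn.
  set U := \bigcup_n A n; pose q X := complex.Re (ip (spectral_proj X F) F).
  have qE : fine (\sum_(0 <= k < n) (complex.Re (inner m (spectral_fun (A k) F) F))%:E)%E =
      \sum_(k < n) q (A k).
    by rewrite sumEFin big_mkord; apply: eq_bigr => k _; rewrite spectral_funE.
  have : `|q U - \sum_(k < n) q (A k)| < eps by rewrite -qE; exact: (hN n Nn).
  apply: le_lt_trans; apply: le_trans (ler_norm _).
  have proj0 : spectral_proj set0 F = 0.
    by apply: coefP => k; rewrite spectral_projE /chi indic0 mul0r (ip0l ipP).
  have ipPP X Y : ip (spectral_proj X F) (spectral_proj Y F) = ip (spectral_proj (X `&` Y) F) F.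
    by rewrite -spectral_proj_sym -spectral_projI setIC.
  have S1 : complex.Re (ip (spectral_proj U F) (\sum_(k < n) spectral_proj (A k) F)) = \sum_(k < n) q (A k).
    rewrite (ip_sumr ipP) (@big_morph _ _ (@complex.Re R) 0 +%R)//; last exact: ReD.
    by apply: eq_bigr => k _; rewrite ipPP setIC setIidl//; exact: bigcup_sup.
  have S2 : nn ip (\sum_(k < n) spectral_proj (A k) F) = \sum_(k < n) q (A k).
    rewrite {1}/nn (ip_sumr ipP) (@big_morph _ _ (@complex.Re R) 0 +%R)//; last exact: ReD.
    apply: eq_bigr => k _; rewrite (ip_suml ipP) (bigD1 k)//= big1 ?addr0 ?ipPP ?setIid//.
    move=> j jk; rewrite ipPP (_ : A j `&` A k = set0) ?proj0 ?(ip0l ipP)//.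
    apply: contrapT => /eqP/set0P h; move/eqP: jk; apply.
    by apply: val_inj; exact: (tA j k I I h).
  rewrite (nnBC ipP) (nnB ipP) S1 S2 spectral_proj_add -/(q U).
  by rewrite le_eqVlt; apply/orP; left; apply/eqP; ring.
Qed.

(** The second moment is the sum of [mu k ^ 2 * sq (ip F (e k))]. Bessel's inequality for [G] bounds
    it on the domain; conversely, if it is finite, Riesz-Fischer produces a [G] with coefficients
    [mu k * ip F (e k)]. The first moment is Parseval's formula for [ip G F], whose partial sums are
    real. *)
Lemma diagonal_spectral_measure : is_spectral_measure m T spectral_fun.
Proof.
have mX (n : nat) : measurable_fun [set: measurableTypeR R] (fun t : measurableTypeR R => ((t : R) ^+ n)%:E).
  by apply/measurable_EFinP; exact: exprn_measurable.
have sqint (F : H) : (\int[scalar_measure m spectral_fun F]_(t in [set: R]) (t ^+ 2)%:E =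
    \sum_(0 <= k <oo) (sq (ip F (e k)) * mu k ^+ 2)%:E)%E.
  rewrite scalar_measureE integral_atomic//; last by move=> t; rewrite lee_fin sqr_ge0.
split; first exact: spectral_fun_pvm.
- move=> f; split.
  + move=> [h /TP[F [G [-> _ hG]]]]; split; first exact: L2P.
    rewrite sqint; apply: le_lt_trans (ltry (nn ip G)).
    apply: lime_le; first by apply: is_cvg_nneseries => k _ _; rewrite lee_fin mulr_ge0 ?sq_ge0 ?sqr_ge0.
    apply: nearW => n; rewrite big_mkord sumEFin lee_fin.
    apply: le_trans (bessel ipP eP G n); apply: ler_sum => k _.
    by rewrite hG sqM [sq (mu k)%:C]/sq /= expr0n addr0 mulrC.
  + move=> [lf]; rewrite (_ : f = toL2 m0' lf)// sqint => fin.
    have [||G [_ hG]] := riesz_fischer ipP complete eP (a := fun k => (mu k)%:C * ip (toL2 m0' lf) (e k))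
        (M := fine (\sum_(0 <= k <oo) (sq (ip (toL2 m0' lf) (e k)) * mu k ^+ 2)%:E)%E).
    * by move=> k ek; rewrite ek (ip0r ipP) mulr0.
    * move=> n; rewrite -lee_fin fineK; last first.
        by rewrite ge0_fin_numE//; apply: nneseries_ge0 => k _ _; rewrite lee_fin mulr_ge0 ?sq_ge0 ?sqr_ge0.
      have -> : (\sum_(k < n) sq ((mu k)%:C * ip (toL2 m0' lf) (e k)))%:E =
          (\sum_(0 <= k < n) (sq (ip (toL2 m0' lf) (e k)) * mu k ^+ 2)%:E)%E.
        rewrite big_mkord sumEFin; congr (_%:E); apply: eq_bigr => k _.
        by rewrite sqM [sq (mu k)%:C]/sq /= expr0n addr0 mulrC.
      by apply: nneseries_lim_ge => k _ _; rewrite lee_fin mulr_ge0 ?sq_ge0 ?sqr_ge0.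
    * by exists G; apply/TP; exists (toL2 m0' lf), G.
- move=> f h /TP[F [G [-> -> hG]]].
  have cv := parseval_ip ipP complete eP eT G F.
  have E n : \sum_(k < n) ip G (e k) * (ip F (e k))^* = (\sum_(k < n) sq (ip F (e k)) * mu k)%:C.
    rewrite rmorph_sum; apply: eq_bigr => k _.
    by rewrite hG -mulrA mulJ -rmorphM mulrC.
  have reG : complex.Im (ip G F) = 0.
    apply/eqP; rewrite -normr_eq0; apply/eqP.
    apply/eqP; rewrite eq_le normr_ge0 andbT.
    apply: (@ler_cvg_to _ \oo _ _ (fun=> `|complex.Im (ip G F)|)
      (fun n => normc (\sum_(k < n) ip G (e k) * (ip F (e k))^* - ip G F)));
      [exact: cvg_cst|exact: cv|apply: nearW => n; rewrite E].
    apply: le_trans (Im_le_normc _); case: (ip G F) => a b /=.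
    by rewrite sub0r normrN.
  have -> : (\int[scalar_measure m spectral_fun F]_(t in [set: R]) t%:E = (complex.Re (ip G F))%:E)%E.
    rewrite scalar_measureE integralE !integral_atomic//.
    + rewrite [X in (_ - X)%E]eseries0 ?sube0; last first.
        by move=> k _ _; rewrite funenegE /= max_r ?mule0// lee_fin oppr_le0.
      rewrite -(nneseries_cvg (a := fun k => sq (ip F (e k)) * mu k)).
        by apply: eq_eseriesr => k _; rewrite funeposE /= max_l// lee_fin.
      by apply: cvg_trans (normc_cvg_Re cv); apply: near_eq_cvg; apply: nearW => n; rewrite E.
    + by apply: measurable_funeneg; exact: (mX 1%N).
    + by apply: measurable_funepos; exact: (mX 1%N).
  have -> : inner m G F = ip G F by [].
  by move: reG; case: (ip G F) => a b /= ->.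
Qed.

End DiagonalOperator.

(** * Min-max bounds for the counting function *)

Section SpectralMeasureBounds.
Context {R : realType} {V : countType} (m : V -> R) (m0 : forall x, 0 < m x).
Let m0' x : 0 <= m x := ltW (m0 x).
Notation H := (L2 m0').
Notation ip := (@L2ip R V m m0').
Notation RB := (measurableTypeR R).
Let ipP : is_ip ip := L2ipP m0'.

Import HBNNSimple.

(** The integral evaluates the set function only on preimages under measurable simple functions.
    This allows [scalar_measure], uncontrolled off the Borel sets, to be replaced by a measure. *)
Lemma eq_integral_measurable (mu nu : set RB -> \bar R) (f : RB -> \bar R) :
  (forall A, measurable A -> mu A = nu A) ->
  (\int[mu]_(t in [set: RB]) f t = \int[nu]_(t in [set: RB]) f t)%E.
Proof.
move=> mn; rewrite /integral.
congr (_ - _)%E; congr (ereal_sup _); apply/seteqP;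
  split=> _ [h hh <-]; exists h => //; rewrite /sintegral;
  apply: eq_fsbigr => y _; rewrite mn//;
  have := @measurable_funP _ _ _ _ h measurableT _ (measurable_set1 y);
  by rewrite setTI.
Qed.

Section Concentration.
Context (nu : {measure set RB -> \bar R}) (c : R) (nuT : nu [set: RB] = c%:E).

Let mX (n : nat) : measurable_fun [set: RB] (fun t : RB => ((t : R) ^+ n)%:E).
Proof. by apply/measurable_EFinP; exact: exprn_measurable. Qed.

Lemma integrable_cst_fin (r : R) : nu.-integrable [set: RB] (cst r%:E).
Proof.
apply/integrableP; split; first exact: measurable_cst.
by rewrite integral_cst// [X in (_ * X)%E](_ : _ = c%:E)// -EFinM ltry.
Qed.

(** The measure is finite and [|t| <= t ^ 2 + 1]. *)
Lemma integrable_id : (\int[nu]_(t in [set: RB]) ((t : R) ^+ 2)%:E < +oo)%E ->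
  nu.-integrable [set: RB] (fun t : RB => (t : R)%:E).
Proof.
move=> h2.
have i2 : nu.-integrable [set: RB] (fun t : RB => ((t : R) ^+ 2)%:E).
  apply/integrableP; split; first exact: mX.
  by under eq_integral do rewrite gee0_abs ?lee_fin ?sqr_ge0//.
apply: le_integrable (integrableD measurableT i2 (integrable_cst_fin 1)) => //.
  exact: (mX 1%N).
move=> t _; rewrite -[leRHS]/((`|(t : R) ^+ 2 + 1|)%:E) lee_fin.
rewrite [leRHS]ger0_norm ?addr_ge0 ?sqr_ge0//.
have := normr_ge0 (t : R); rewrite -(real_normK (num_real (t : R))).
set x := `|_|; nra.
Qed.

Lemma integral_lower (A : set RB) (a : R) : measurable A -> nu (~` A) = 0%E ->
  (forall t : R, A t -> a <= t) ->
  (\int[nu]_(t in [set: RB]) ((t : R) ^+ 2)%:E < +oo)%E ->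
  a * c <= fine (\int[nu]_(t in [set: RB]) (t : R)%:E)%E.
Proof.
move=> mA nA aA /integrable_id i1.
have nuA : nu A = c%:E.
  have := measureU nu mA (measurableC mA) (setICr A).
  by rewrite setUv [X in X = _]nuT [X in (_ + X)%E]nA adde0 => ->.
have E : (\int[nu]_(t in [set: RB]) (t : R)%:E = \int[nu]_(t in A) (t : R)%:E)%E.
  rewrite (@negligible_integral _ _ _ nu [set: RB] (~` A))//; last exact: measurableC.
  by rewrite setTD setCK.
rewrite -lee_fin fineK; last exact: integrable_fin_num.
rewrite E EFinM -nuA -integral_cst//.
apply: le_integral => //.
- by apply: integrableS (integrable_cst_fin a).
- by apply: integrableS i1.
- by move=> t /[!inE] tA; rewrite lee_fin aA.
Qed.

Lemma integral_upper (A : set RB) (b : R) : measurable A -> nu (~` A) = 0%E ->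
  (forall t : R, A t -> t <= b) ->
  (\int[nu]_(t in [set: RB]) ((t : R) ^+ 2)%:E < +oo)%E ->
  fine (\int[nu]_(t in [set: RB]) (t : R)%:E)%E <= b * c.
Proof.
move=> mA nA aA /integrable_id i1.
have nuA : nu A = c%:E.
  have := measureU nu mA (measurableC mA) (setICr A).
  by rewrite setUv [X in X = _]nuT [X in (_ + X)%E]nA adde0 => ->.
have E : (\int[nu]_(t in [set: RB]) (t : R)%:E = \int[nu]_(t in A) (t : R)%:E)%E.
  rewrite (@negligible_integral _ _ _ nu [set: RB] (~` A))//; last exact: measurableC.
  by rewrite setTD setCK.
rewrite -lee_fin fineK; last exact: integrable_fin_num.
rewrite E EFinM -nuA -integral_cst//.
apply: le_integral => //.
- by apply: integrableS i1.
- by apply: integrableS (integrable_cst_fin b).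
- by move=> t /[!inE] tA; rewrite lee_fin aA.
Qed.

Lemma integral_sqr_bounded (A : set RB) (b : R) : measurable A -> nu (~` A) = 0%E ->
  (forall t : R, A t -> `|t| <= b) ->
  (\int[nu]_(t in [set: RB]) ((t : R) ^+ 2)%:E < +oo)%E.
Proof.
move=> mA nA aA.
rewrite (@ge0_negligible_integral _ _ _ nu [set: RB] (~` A))//; last 2 first.
- exact: measurableC.
- by move=> t _; rewrite lee_fin sqr_ge0.
rewrite setTD setCK.
apply: (@le_lt_trans _ _ (\int[nu]_(t in A) (cst (b ^+ 2)%:E) t)%E).
  apply: ge0_le_integral => //.
  - by move=> t _; rewrite lee_fin sqr_ge0.
  - by apply: measurable_funS (mX 2%N).
  - move=> t tA; rewrite lee_fin -real_normK ?num_real// ler_sqr ?nnegrE ?aA//.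
    exact: le_trans (aA _ tA).
rewrite integral_cst//.
have h : (nu A <= c%:E)%E by rewrite -nuT; apply: le_measure; rewrite ?inE//; exact: measurableT.
apply: (@le_lt_trans _ _ ((b ^+ 2)%:E * c%:E)%E); last by rewrite -EFinM ltry.
by rewrite lee_wpmul2l// lee_fin sqr_ge0.
Qed.

End Concentration.

Context (T : @operator R V) (E : set R -> (V -> R[i]) -> (V -> R[i])).
Hypothesis isE : is_spectral_measure m T E.
Hypothesis Tpos : forall f h, T f h -> 0 <= complex.Re (inner m h f).

Let pvm : is_pvm m E. Proof. by have [] := isE. Qed.

Let proj (A : set RB) : measurable A -> is_orth_proj m (E A).
Proof. by have [h _ _ _] := pvm; exact: h. Qed.

Let PE_ell2 (A : set RB) (mA : measurable A) (F : H) : ell2 m (E A F).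
Proof. by have [h _ _ _] := proj mA; apply: h; exact: L2P. Qed.

Definition PE (A : set RB) (mA : measurable A) (F : H) : H := toL2 m0' (PE_ell2 mA F).

Lemma PE_lin (A : set RB) (mA : measurable A) c F G :
  PE mA (c *: F + G) = c *: PE mA F + PE mA G.
Proof.
apply: L2_ext => x; have [_ h _ _] := proj mA.
have := h c F G (L2P F) (L2P G) => /(congr1 (fun f => f x)).
by [].
Qed.

Lemma PE_I (A B : set RB) (mA : measurable A) (mB : measurable B) (mAB : measurable (A `&` B)) F :
  PE mAB F = PE mA (PE mB F).
Proof.
apply: L2_ext => x; have [_ _ h _] := pvm.
by have := h A B F mA mB (L2P F) => /(congr1 (fun f => f x)).
Qed.

Lemma PE_eq (A B : set RB) (mA : measurable A) (mB : measurable B) F : A = B -> PE mA F = PE mB F.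
Proof. by move=> AB; apply: L2_ext => x; rewrite /= AB. Qed.

Lemma PE_T F : PE measurableT F = F.
Proof.
apply: L2_ext => x; have [_ h _ _] := pvm.
by have := h F (L2P F) => /(congr1 (fun f => f x)).
Qed.

Lemma PE_idem (A : set RB) (mA : measurable A) F : PE mA (PE mA F) = PE mA F.
Proof. by rewrite -(PE_I _ _ (measurableI _ _ mA mA)); apply: PE_eq; rewrite setIid. Qed.

Lemma PE_sym (A : set RB) (mA : measurable A) F G : ip (PE mA F) G = ip F (PE mA G).
Proof. by have [_ _ _ h] := proj mA; apply: h; exact: L2P. Qed.

Lemma PE_nn (A : set RB) (mA : measurable A) F : nn ip (PE mA F) = complex.Re (ip (PE mA F) F).
Proof. by rewrite /nn -PE_sym PE_idem. Qed.

Lemma PE_cvg (A : (set RB)^nat) (mA : forall n, measurable (A n)) (mU : measurable (\bigcup_n A n)) F :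
  trivIset [set: nat] A -> cvgH ip (fun n => \sum_(k < n) PE (mA k) F) (PE mU F).
Proof.
move=> tA; have [_ _ _ h] := pvm; have := h A F mA tA (L2P F).
have Eq : (fun n => l2fun (\sum_(k < n) PE (mA k) F)) =
    (fun n x => \sum_(k < n) E (A k) F x).
  apply: funext => n; apply: funext => x; elim: n => [|n ih]; first by rewrite !big_ord0.
  by rewrite !big_ord_recr L2DE ih.
by move=> hh; apply/(@cvgH_ell2 R V m m0' (fun n => \sum_(k < n) PE (mA k) F)); rewrite Eq.
Qed.

(** Additivity along the constant sequence [set0] makes the multiples [n *: g] of the image [g] of
    [F] converge to [g]. The term of index [N.+2] is at distance at least the norm of [g] from [g],
    so [g = 0]. *)
Lemma PE_0 F : PE measurable0 F = 0.
Proof.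
have c := @PE_cvg (fun=> set0) (fun=> measurable0) (bigcup_measurable (fun k _ => measurable0)) F (@trivIset_set0 _ _ _).
rewrite (@PE_eq _ set0 _ measurable0) in c; last by rewrite bigcup0.
set g := PE _ F in c *; apply: (L2_definite m0); apply/eqP; rewrite eq_le (nn_ge0 ipP) andbT.
apply/ler_addgt0Pr => eps eps0; rewrite add0r.
have [N hN] := (cvgHP ipP _ _).1 c eps eps0.
have := hN N.+2 (leq_trans (leqnSn _) (leqnSn _)).
rewrite big_const_ord iter_addr_0 -scaler_nat -[X in _ - X]scale1r -scalerBl (nnZ ipP).
move=> h1; apply/ltW; apply: le_lt_trans h1; rewrite ler_peMl ?(nn_ge0 ipP)//.
rewrite -[X in sq (_ - X)]/(1%:R) -natrB//.
have -> : ((N.+2 - 1)%N%:R : R[i]) = ((N.+1)%:R : R)%:C by rewrite subn1 rmorph_nat.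
by rewrite /sq /= expr0n addr0 -natrX ler1n expn_gt0.
Qed.

Lemma PE_disj (A B : set RB) (mA : measurable A) (mB : measurable B) F :
  A `&` B = set0 -> PE mA (PE mB F) = 0.
Proof.
move=> AB; rewrite -(PE_I _ _ (measurableI _ _ mA mB)) -(PE_0 F); exact: PE_eq.
Qed.

(** Off the Borel sets [nu] is set to [0], because a measure has to be nonnegative on all sets, and
    nothing is known there about [scalar_measure]. *)
Lemma spectral_measure_of (F : H) : exists nu : {measure set RB -> \bar R},
  (forall (A : set RB) (mA : measurable A), nu A = (nn ip (PE mA F))%:E) /\
  forall f : RB -> \bar R, (\int[scalar_measure m E F]_(t in [set: R]) f t =
     \int[nu]_(t in [set: RB]) f t)%E.
Proof.
pose nu (A : set RB) : \bar R := if pselect (measurable A) is left mA then (nn ip (PE mA F))%:E else 0%E.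
have nuE (A : set RB) (mA : measurable A) : nu A = (nn ip (PE mA F))%:E.
  by rewrite /nu; case: pselect => [mA'|//]; rewrite (PE_eq mA' mA).
have nu0 : nu set0 = 0%E by rewrite (nuE _ measurable0) PE_0 (nn0 ipP).
have nu_ge0 A : (0 <= nu A)%E.
  by rewrite /nu; case: pselect => // mA; rewrite lee_fin (nn_ge0 ipP).
have nu_add : semi_sigma_additive nu.
  move=> A mA tA mU; rewrite (nuE _ mU).
  rewrite (_ : (fun n => _) = (fun n => (\sum_(k < n) nn ip (PE (mA k) F))%:E)).
    apply: cvg_EFin; first exact: nearW.
    rewrite PE_nn; have h := normc_cvg_Re (cvgH_ip ipP (PE_cvg mA mU F tA) (cvgH_cst ipP F)).
    apply: cvg_trans h; apply: near_eq_cvg; apply: nearW => n.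
    rewrite (ip_suml ipP) (@big_morph _ _ (@complex.Re R) 0 +%R)//; last exact: ReD.
    by apply: eq_bigr => k _; rewrite PE_nn.
  apply: funext => n; rewrite big_mkord -sumEFin; apply: eq_bigr => k _.
  exact: nuE.
pose nuM : {measure set RB -> \bar R} := HB.pack nu (isMeasure.Build _ _ _ nu nu0 nu_ge0 nu_add).
exists nuM; split=> // f; apply: eq_integral_measurable => A mA.
by rewrite [RHS]nuE PE_nn.
Qed.

Lemma spectral_lower (F : H) (l : R) h : PE (measurable_itv `]-oo, l]) F = 0 -> T F h ->
  l * nn ip F <= complex.Re (inner m h F).
Proof.
move=> PF Th; have [nu [nuE nuI]] := spectral_measure_of F.
have [_ dom val] := isE.
have [_ fin] := (dom F).1 (ex_intro _ h Th); rewrite nuI in fin.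
rewrite (val F h Th) nuI /=.
apply: (@integral_lower nu _ _ `]l, +oo[%classic); last exact: fin.
- by rewrite (nuE _ measurableT) PE_T.
- exact: measurable_itv.
- rewrite setCitvr /= (nuE _ (measurable_itv `]-oo, l])) PF (nn0 ipP)//.
- by move=> t /=; rewrite in_itv /= andbT => /ltW.
Qed.

(** A vector carried by a bounded spectral set has a finite second moment, hence lies in the domain;
    its energy is the mean of a function that is at most [b]. *)
Lemma spectral_bounded (F : H) (A : set RB) (mA : measurable A) (a b : R) :
  PE mA F = F -> (forall t : R, A t -> a <= t /\ t <= b) ->
  (exists h, T F h) /\
  forall h, T F h -> complex.Re (inner m h F) <= b * nn ip F.
Proof.
move=> PF ab; have [nu [nuE nuI]] := spectral_measure_of F.
have [_ dom val] := isE.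
have nuT : nu [set: RB] = (nn ip F)%:E by rewrite (nuE _ measurableT) PE_T.
have nuC : nu (~` A) = 0%E.
  by rewrite (nuE _ (measurableC mA)) -PF PE_disj ?(nn0 ipP)// setICl.
have fin : (\int[nu]_(t in [set: RB]) ((t : R) ^+ 2)%:E < +oo)%E.
  apply: (@integral_sqr_bounded nu _ nuT A (`|a| + `|b|)) => // t /ab[at_ tb].
  by rewrite ler_norml; have := ler_norm b; have := ler_norm (- a); rewrite normrN;
    have := normr_ge0 a; have := normr_ge0 b; lra.
split; first by apply/dom; split; [exact: L2P|rewrite nuI].
move=> h Th; rewrite (val F h Th) nuI /=.
by apply: (@integral_upper nu _ nuT A b) => // t /ab[].
Qed.

(** On the spectral subspace of the segment from [- n.+1] to [- 1 / n.+1] the energy is at most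
    [- 1 / n.+1] times the squared norm, so positivity of [T] makes it trivial. These segments
    exhaust the negative half-line. *)
Lemma spectral_negative (F : H) : PE (measurable_itv `]-oo, 0[) F = 0.
Proof.
have [nu [nuE nuI]] := spectral_measure_of F.
pose A n : set RB := `[- n.+1%:R, - n.+1%:R^-1]%classic.
have mA n : measurable (A n) by exact: measurable_itv.
have nA n : nu (A n) = 0%E.
  rewrite (nuE _ (mA n)); set G := PE (mA n) F.
  have [|[h Th] hb] := @spectral_bounded G (A n) (mA n) (- n.+1%:R) (- n.+1%:R^-1) (PE_idem _ _).
    by move=> t; rewrite /A /= in_itv /= => /andP[].
  congr (_%:E); apply/eqP; rewrite eq_le (nn_ge0 ipP) andbT.
  have := hb h Th; have := Tpos Th; have : 0 < (n.+1%:R : R)^-1 by rewrite invr_gt0.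
  set x := _^-1; set z := complex.Re _; set y := nn _ _ => x0 z0 zy.
  by rewrite leNgt; apply/negP => y0; have := mulr_gt0 x0 y0; lra.
apply: (L2_definite m0); apply: EFin_inj; rewrite -nuE.
apply/eqP; rewrite eq_le measure_ge0 andbT.
apply: (@le_trans _ _ (nu (\bigcup_n A n))).
  apply: le_measure; rewrite ?inE; [exact: measurable_itv|exact: bigcupT_measurable|].
  move=> t /=; rewrite in_itv /= => t0.
  have tn : 0 < - (t : R) by rewrite oppr_gt0.
  exists (maxn (Num.bound (- (t : R))) (Num.bound (- (t : R))^-1)) => //=.
  rewrite /A /= in_itv /=; set N := maxn _ _.
  have h1 : - (t : R) <= N.+1%:R.
    apply: le_trans (ltW (archi_boundP (ltW tn))) _.
    by rewrite ler_nat (leq_trans _ (leqnSn _))// leq_maxl.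
  have h2 : (- (t : R))^-1 <= N.+1%:R.
    apply: le_trans (ltW (archi_boundP _)) _; first by rewrite invr_ge0 ltW.
    by rewrite ler_nat (leq_trans _ (leqnSn _))// leq_maxr.
  have h3 : (N.+1%:R : R)^-1 <= - (t : R) by rewrite invf_ple// posrE.
  apply/andP; split.
    have g (a b : R) : - a <= b -> - b <= a by lra.
    exact: g h1.
  have g (a b : R) : b <= - a -> a <= - b by lra.
  exact: g h3.
apply: (@le_trans _ _ (\sum_(0 <= n <oo) nu (A n))%E).
  by apply: measure_sigma_subadditive => //; exact: bigcupT_measurable.
by rewrite eseries0.
Qed.

(** With the negative half-line discarded, [F] is carried by the bounded set [[0, l]], which puts it
    in the domain. *)
Lemma spectral_upper (F : H) (l : R) : PE (measurable_itv `]-oo, l]) F = F ->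
  exists2 h, T F h & complex.Re (inner m h F) <= l * nn ip F.
Proof.
move=> PF.
have mA : measurable (`[0, l]%classic : set RB) by exact: measurable_itv.
have PA : PE mA F = F.
  have [nu [nuE nuI]] := spectral_measure_of F.
  have h1 : nu (~` `[0, l]) = 0%E.
    apply/eqP; rewrite eq_le measure_ge0 andbT.
    have mN : measurable (`]-oo, 0[%classic : set RB) by exact: measurable_itv.
    have mC : measurable (~` `]-oo, l]%classic : set RB) by apply: measurableC; exact: measurable_itv.
    apply: (@le_trans _ _ (nu (`]-oo, 0[ `|` ~` `]-oo, l]))).
      apply: le_measure; rewrite ?inE; [exact: measurableC|exact: measurableU|].
      move=> t /= h; rewrite !in_itv /= in h *; have [t0|t0] := ltP (t : R) 0; first by left.
      by right => tl; apply: h; rewrite t0 tl.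
    apply: le_trans (measureU2 _ _ _) _ => //.
    rewrite [X in (X + _)%E](nuE _ mN) [X in (_ + X)%E](nuE _ mC) (@PE_eq _ _ mN (measurable_itv `]-oo, 0[))//.
    rewrite spectral_negative -PF PE_disj ?(nn0 ipP) ?adde0//.
    by rewrite setICl.
  have := measureU nu mA (measurableC mA) (setICr _).
  rewrite setUv [X in _ = (_ + X)%E]h1 adde0 [X in X = _](nuE _ measurableT) PE_T.
  rewrite [X in _ = X](nuE _ mA) => -[h2].
  apply/esym/eqP; rewrite -subr_eq0; apply/eqP/(L2_definite m0).
  rewrite (nnB ipP) -PE_sym -PE_nn -h2.
  by ring.
have [|[h Th] hb] := @spectral_bounded F _ mA 0 l PA.
  by move=> t /=; rewrite in_itv /= => /andP[].
by exists h => //; exact: hb.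
Qed.

Let D l : set RB := `]-oo, l]%classic.
Let mD l : measurable (D l) := measurable_itv _.

Lemma PE_sum (A : set RB) (mA : measurable A) n (c : 'I_n -> R[i]) (B : 'I_n -> H) :
  PE mA (\sum_(i < n) c i *: B i) = \sum_(i < n) c i *: PE mA (B i).
Proof.
elim/big_rec2: _ => [|i y x _ <-]; last by rewrite PE_lin.
have := PE_lin mA (-1) 0 0; rewrite scaler0 addr0 scaleN1r => h.
by rewrite h addNr.
Qed.

Lemma L2_sumE n (c : 'I_n -> R[i]) (B : 'I_n -> H) x :
  (\sum_(i < n) c i *: B i) x = \sum_(i < n) c i * B i x.
Proof. by elim/big_rec2: _ => // i y z _ <-. Qed.

(** A combination killed by the projection on []-oo, l]] has energy at least [l] times its squared
    norm, and at most [l - 1] times it by assumption, so it is zero: the projections of the [b i]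
    stay independent. The margin [1] turns two non-strict bounds into a contradiction. *)
Lemma dimension_lower (n : nat) (b : 'I_n -> V -> R[i]) (l : R) :
  (forall i, ell2 m (b i)) -> lin_indep b ->
  (forall c : 'I_n -> R[i], exists2 h, T (fun x => \sum_(i < n) c i * b i x) h &
    complex.Re (inner m h (fun x => \sum_(i < n) c i * b i x)) <=
      (l - 1) * N2 m (fun x => \sum_(i < n) c i * b i x)) ->
  ((n%:R)%:E <= dimension [set E (D l) f | f in ell2 m])%E.
Proof.
move=> lb ib Tb; apply: ereal_sup_ubound; exists n => //.
exists (fun i => PE (mD l) (toL2 m0' (lb i))).
  by move=> i; exists (b i).
move=> c hc; pose F : H := \sum_(i < n) c i *: toL2 m0' (lb i).
have FE : (F : V -> R[i]) = (fun x => \sum_(i < n) c i * b i x).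
  by apply: funext => x; rewrite L2_sumE.
have PF : PE (measurable_itv `]-oo, l]) F = 0.
  apply: L2_ext => x; rewrite /F PE_sum L2_sumE -[RHS](hc x).
  by apply: eq_bigr.
have [h Th hb] := Tb c; rewrite -FE in Th hb.
have := spectral_lower PF Th; rewrite -L2nn in hb => h1.
have F0 : F = 0.
  apply: (L2_definite m0); apply/eqP; rewrite eq_le (nn_ge0 ipP) andbT.
  by move: h1 hb; set z := complex.Re _; set w := nn _ _; lra.
apply: ib => x; rewrite -[LHS](congr1 (fun f => f x) FE).
by rewrite F0.
Qed.

Lemma kernel_row (N n : nat) (M : 'M[R[i]]_(n, N)) : (N < n)%N ->
  exists2 c : 'rV[R[i]]_n, c != 0 & c *m M = 0.
Proof.
move=> Nn; have : kermx M != 0.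
  rewrite -mxrank_eq0 mxrank_ker subn_eq0 -ltnNge.
  exact: leq_ltn_trans (rank_leq_col M) Nn.
move=> /rowV0Pn[c /sub_kermxP cM c0]; by exists c.
Qed.

(** Among more than [N] independent vectors of the spectral subspace, some nontrivial combination is
    annihilated by the [N] functionals; its energy is then at least [l + 1] and at most [l] times
    its squared norm. *)
Lemma dimension_upper (N : nat) (phi : 'I_N -> (V -> R[i]) -> R[i]) (l : R) :
  (forall i n (c : 'I_n -> R[i]) (b : 'I_n -> V -> R[i]),
    phi i (fun x => \sum_(j < n) c j * b j x) = \sum_(j < n) c j * phi i (b j)) ->
  (forall f h, T f h -> (forall i, phi i f = 0) -> (l + 1) * N2 m f <= complex.Re (inner m h f)) ->
  (dimension [set E (D l) f | f in ell2 m] <= (N%:R)%:E)%E.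
Proof.
move=> philin Tphi; apply: ge_ereal_sup => _ [n [b bD ib] <-].
rewrite lee_fin ler_nat leqNgt; apply/negP => Nn.
pose M : 'M[R[i]]_(n, N) := \matrix_(j, i) phi i (b j).
have [c c0 cM] := kernel_row M Nn.
pose f x := \sum_(j < n) c 0 j * b j x.
have bH j : exists B : H, PE (measurable_itv `]-oo, l]) B = B /\ b j = B.
  have [g lg gb] := bD j; exists (PE (measurable_itv `]-oo, l]) (toL2 m0' lg)).
  by rewrite PE_idem.
have [B hB] := choice bH.
pose F : H := \sum_(j < n) c 0 j *: B j.
have FE : (F : V -> R[i]) = f.
  by apply: funext => x; rewrite L2_sumE; apply: eq_bigr => j _; rewrite (hB j).2.
have PF : PE (measurable_itv `]-oo, l]) F = F.
  by rewrite /F PE_sum; apply: eq_bigr => j _; rewrite (hB j).1.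
have [h Th hb] := spectral_upper PF.
have phi0 i : phi i F = 0.
  rewrite FE /f philin; have := congr1 (fun A : 'rV_N => A 0 i) cM.
  by rewrite !mxE => {2}<-; apply: eq_bigr => j _; rewrite mxE.
have := Tphi F h Th phi0; rewrite -L2nn => h1.
have F0 : F = 0.
  apply: (L2_definite m0); apply/eqP; rewrite eq_le (nn_ge0 ipP) andbT.
  by move: h1 hb; set z := complex.Re _; set w := nn _ _; lra.
move/eqP: c0; apply; apply/rowP => j; rewrite mxE.
apply: (ib (c 0)) => x; rewrite -[LHS]/(f x) -FE F0.
by [].
Qed.

End SpectralMeasureBounds.

(** Existence of one spectral measure ensures that the chosen one is genuine, and the bounds hold
    for any. The upper bound also makes the dimension finite, so that [fine] loses nothing. *)
Theorem counting_function_bounds (R : realType) (V : countType) (m : V -> R)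
    (m0 : forall x, 0 < m x) (T : @operator R V) (l : R) (n N : nat)
    (b : 'I_n -> V -> R[i]) (phi : 'I_N -> (V -> R[i]) -> R[i]) :
  (exists E, is_spectral_measure m T E) ->
  (forall f h, T f h -> 0 <= complex.Re (inner m h f)) ->
  (forall i, ell2 m (b i)) -> lin_indep b ->
  (forall c : 'I_n -> R[i], exists2 h, T (fun x => \sum_(i < n) c i * b i x) h &
    complex.Re (inner m h (fun x => \sum_(i < n) c i * b i x)) <=
      (l - 1) * N2 m (fun x => \sum_(i < n) c i * b i x)) ->
  (forall i n (c : 'I_n -> R[i]) (b : 'I_n -> V -> R[i]),
    phi i (fun x => \sum_(j < n) c j * b j x) = \sum_(j < n) c j * phi i (b j)) ->
  (forall f h, T f h -> (forall i, phi i f = 0) -> (l + 1) * N2 m f <= complex.Re (inner m h f)) ->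
  n%:R <= fine (counting_function m T l) <= N%:R.
Proof.
move=> [E0 E0P] Tpos lb ib Tb phil Tphi.
have isE : is_spectral_measure m T (spectral_measure m T) by apply: xgetPex; exists E0.
have lo := dimension_lower m0 isE lb ib Tb.
have up := dimension_upper m0 isE Tpos phil Tphi.
rewrite /counting_function; have fin : dimension [set spectral_measure m T [set` `]-oo, l]] f | f in ell2 m] \is a fin_num.
  rewrite fin_numE; apply/andP; split; apply/eqP => e; rewrite e in lo up.
    by move: lo; rewrite leeNy_eq.
  by move: up; rewrite leye_eq.
by rewrite -!lee_fin fineK// lo up.
Qed.

(** * Finite sums, delta functions and multiplication operators *)

Section FiniteSums.
Context {R : realType} {V : countType}.

Lemma esum_fin (X : set V) (w : V -> R) : finite_set X -> (forall x, 0 <= w x) ->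
  (forall x, ~ X x -> w x = 0) ->
  (\esum_(x in [set: V]) (w x)%:E = (\sum_(x \in X) w x)%:E)%E.
Proof.
move=> fX w0 wX; rewrite -fsumEFin// -esum_fset//; last by move=> i _; rewrite lee_fin.
rewrite [RHS]esum_mkcond; apply: eq_esum => x _; case: ifPn => // /negP.
by rewrite inE => /wX ->.
Qed.

Lemma rsum_fin (X : set V) (u : V -> R) : finite_set X -> (forall x, ~ X x -> u x = 0) ->
  rsum u = \sum_(x \in X) u x.
Proof.
move=> fX u0; rewrite /rsum.
have mp x : 0 <= Num.max (u x) 0 by rewrite le_max lexx orbT.
have mn x : 0 <= Num.max (- u x) 0 by rewrite le_max lexx orbT.
rewrite (@esum_fin X (u^\+))//; last by move=> x /u0 h; rewrite /funrpos h maxxx.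
rewrite (@esum_fin X (u^\-))//; last by move=> x /u0 h; rewrite /funrneg h oppr0 maxxx.
rewrite /=.
rewrite !fsbig_finite//= -sumrB; apply: eq_bigr => x _.
rewrite /funrpos /funrneg; have [h|h] := leP 0 (u x).
  have h' : - u x <= 0 by rewrite oppr_le0.
  by rewrite (max_idPr h') subr0.
have h' : 0 <= - u x by rewrite oppr_ge0 ltW.
by rewrite (max_idPl h') sub0r opprK.
Qed.

Lemma csum_fin (X : set V) (u : V -> R[i]) : finite_set X -> (forall x, ~ X x -> u x = 0) ->
  csum u = \sum_(x \in X) u x.
Proof.
move=> fX u0; rewrite /csum !(@rsum_fin X)//; last 2 first.
- by move=> x /u0 ->.
- by move=> x /u0 ->.
rewrite !fsbig_finite//=; elim: (finmap.enum_fset _) => [|x r ih]; first by rewrite !big_nil.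
by rewrite !big_cons -ih; case: (u x).
Qed.

Definition delta (v : V) (c : R[i]) : V -> R[i] := fun x => if x == v then c else 0.

Lemma inner_deltar (m : V -> R) (f : V -> R[i]) v c : inner m f (delta v c) = (m v)%:C * f v * c^*.
Proof.
rewrite /inner (@csum_fin [set v])//; last first.
  move=> x /= xv; rewrite /delta; case: eqP => // _.
  by rewrite [X in _ * X]conjc0 mulr0.
by rewrite fsbig_set1 /delta eqxx.
Qed.

Lemma ell2_fin (m : V -> R) (f : V -> R[i]) : (forall x, 0 <= m x) -> finite_set [set x | f x != 0] -> ell2 m f.
Proof.
move=> m0 fX; rewrite /ell2 /= sqnormE (@esum_fin [set x | f x != 0])//; first by rewrite ltry.
- exact: msq_ge0.
- by move=> x /negP; rewrite negbK => /eqP h; rewrite /msq h sq0 mulr0.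
Qed.

Lemma delta_fin v c : finite_set [set x | delta v c x != 0].
Proof.
apply: sub_finite_set (finite_set1 v) => x /=; rewrite /delta.
by case: (eqVneq x v) => // _; rewrite eqxx.
Qed.

End FiniteSums.

Section DeltaBasis.
Context {R : realType} {V : countType} (m : V -> R) (m0 : forall x, 0 < m x).
Let m0' x : 0 <= m x := ltW (m0 x).
Notation H := (L2 m0').
Notation ip := (@L2ip R V m m0').
Let ipP : is_ip ip := L2ipP m0'.

Definition deltaL2 v c : H := toL2 m0' (ell2_fin m0' (@delta_fin R V v c)).

(** Indexed by the codes of [pickle]; a code that names no vertex gets the zero vector, which
    [orthosys] permits. *)
Definition delta_basis (k : nat) : H :=
  if @pickle_inv V k is Some v then deltaL2 v ((Num.sqrt (m v))^-1)%:C else 0.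

Lemma ip_delta_basis (F : H) k : ip F (delta_basis k) =
  if @pickle_inv V k is Some v then (Num.sqrt (m v))%:C * F v else 0.
Proof.
rewrite /delta_basis; case: (@pickle_inv V k) => [v|]; last exact: (ip0r ipP).
rewrite /L2ip inner_deltar [X in _ * X]conjC_real mulrAC -rmorphM /=; congr (_%:C * _).
by rewrite -{1}(sqr_sqrtr (m0' v)) expr2 mulfK// gt_eqF// sqrtr_gt0.
Qed.

Lemma delta_basis_orthosys : orthosys ip delta_basis.
Proof.
split=> [j k jk|k].
  rewrite ip_delta_basis; case kE: (@pickle_inv V k) => [v|//].
  rewrite /delta_basis; case jE: (@pickle_inv V j) => [w|]; last by rewrite mulr0.
  rewrite /deltaL2 /= /delta; case: eqP => [vw|]; last by rewrite mulr0.
  have := @pickle_invK V k; have := @pickle_invK V j; rewrite kE jE /= -vw => hj hk.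
  by rewrite -hj -hk eqxx in jk.
rewrite /nn ip_delta_basis; case kE: (@pickle_inv V k) => [v|]; last by right; rewrite /delta_basis kE.
left; rewrite /delta_basis kE /= /delta eqxx /= mul0r subr0 mulfV//.
by rewrite gt_eqF// sqrtr_gt0.
Qed.

Lemma delta_basis_total : total_sys ip delta_basis.
Proof.
move=> F hF; apply: L2_ext => v; have := hF (pickle v).
rewrite ip_delta_basis pickleK_inv => /eqP; rewrite mulf_eq0 => /orP[|/eqP ->//].
by rewrite eq_complex /= eqxx andbT gt_eqF// sqrtr_gt0.
Qed.

Lemma partial_delta_fin (a : nat -> R[i]) n :
  finite_set [set x | partial delta_basis a n x != 0].
Proof.
elim: n => [|n ih].
  by rewrite (_ : [set _ | _] = set0)//; apply/seteqP; split=> // x /=; rewrite /partial big_ord0 eqxx.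
have : finite_set [set x | delta_basis n x != 0].
  rewrite /delta_basis; case: (@pickle_inv V _) => [v|]; first exact: delta_fin.
  by rewrite (_ : [set _ | _] = set0)//; apply/seteqP; split=> // x /=; rewrite eqxx.
move=> h; have : finite_set ([set x | partial delta_basis a n x != 0] `|` [set x | delta_basis n x != 0]) by rewrite finite_setU.
apply: sub_finite_set => x /=; rewrite /partial big_ord_recr L2DE L2ZE => hx.
have [h0|h0] := eqVneq (delta_basis n x) 0; last by right.
by left; move: hx; rewrite h0 mulr0 addr0.
Qed.

(** Diagonal in [delta_basis]: the eigenvalue at the code of [v] is [q v], and [0] at the codes that
    name no vertex. *)
Lemma mult_op_spectral_measure (q : V -> R) : (forall x, 0 <= q x) ->
  exists E, is_spectral_measure m (mult_op m q) E.
Proof.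
move=> q0; pose mu k := if @pickle_inv V k is Some v then q v else 0.
eexists; apply: (@diagonal_spectral_measure R V m m0 delta_basis mu delta_basis_orthosys
  delta_basis_total).
  by rewrite /mu => k; case: (@pickle_inv V _).
move=> f h; split.
  move=> [lf lh hE]; exists (toL2 m0' lf), (toL2 m0' lh); split=> // k.
  rewrite !ip_delta_basis /mu; case: (@pickle_inv V _) => [v|]; last by rewrite mulr0.
  by rewrite /= hE mulrCA.
move=> [F [G [-> -> hG]]]; split; [exact: L2P|exact: L2P|].
apply: funext => v; have := hG (pickle v).
rewrite !ip_delta_basis /mu pickleK_inv mulrCA => /mulfI; apply.
by rewrite eq_complex /= eqxx andbT gt_eqF// sqrtr_gt0.
Qed.

End DeltaBasis.

(** * The form operator of a coercive magnetic form *)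

Section FormOperator.
Context {R : realType} {V : countType} (G : @wgraph R V) (theta : V -> V -> R).
Context (graphG : is_graph G) (p : V -> R) (c0 C0 : R).
Let m := mass G.
Hypothesis p1 : forall x, 1 <= p x.
Hypothesis pfin : forall c, finite_set [set x | p x <= c].
Hypothesis c0_gt0 : 0 < c0.

(** Halved because both orientations of an edge are summed: the quadratic form is then the [sqnorm]
    of [nabla f] over ordered pairs. *)
Definition edge_mass (e : V * V) : R := weight G e.1 e.2 / 2.
Definition nabla (f : V -> R[i]) (e : V * V) : R[i] := mgrad theta f e.1 e.2.

(** The two bounds make the form norm equivalent to the norm of weight [wmul m p]. The closure of
    the form on [Cc] then lives on the whole of [HP], and no abstract completion is required. *)
Hypothesis Q_lower : forall f, (c0%:E * sqnorm (wmul m p) f <= sqnorm edge_mass (nabla f))%E.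
Hypothesis Q_upper : forall f, (sqnorm edge_mass (nabla f) <= C0%:E * sqnorm (wmul m p) f)%E.

Let m0 x : 0 < m x. Proof. by have [_ h _ _ _] := graphG; exact: h. Qed.
Let m0' x : 0 <= m x. Proof. exact: ltW. Qed.
Let p0 x : 0 < p x. Proof. exact: lt_le_trans (p1 x). Qed.
Let mp0 x : 0 < wmul m p x. Proof. by rewrite /wmul mulr_gt0. Qed.
Let mp0' x : 0 <= wmul m p x. Proof. exact: ltW. Qed.
Let w0 x y : 0 <= weight G x y. Proof. by have [[h _] _ _ _ _] := graphG; exact: h. Qed.
Let wC x y : weight G x y = weight G y x. Proof. by have [[_ h] _ _ _ _] := graphG; exact: h. Qed.
Let E0 e : 0 <= edge_mass e. Proof. by rewrite divr_ge0. Qed.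

Notation H := (L2 (fun x => ltW (m0 x))).
Notation HP := (L2 (fun x => ltW (mp0 x))).
Notation ip := (@L2ip R V m (fun x => ltW (m0 x))).
Notation ipp := (@L2ip R V (wmul m p) (fun x => ltW (mp0 x))).
Let ipP : is_ip ip := L2ipP _.
Let ippP : is_ip ipp := L2ipP _.

Lemma sqnorm_le_plus f : (sqnorm m f <= sqnorm (wmul m p) f)%E.
Proof.
rewrite !sqnormE; apply: le_esum => x _; rewrite lee_fin /msq /wmul.
by rewrite ler_wpM2r ?sq_ge0// ler_peMr.
Qed.

Lemma ell2_plus f : ell2 (wmul m p) f -> ell2 m f.
Proof. by rewrite /ell2 /=; apply: le_lt_trans; exact: sqnorm_le_plus. Qed.

Definition J (F : HP) : H := toL2 _ (ell2_plus (L2P F)).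

Lemma nabla_ell2 (F : HP) : ell2 edge_mass (nabla F).
Proof.
rewrite /ell2 /=; apply: le_lt_trans (Q_upper F) _.
by rewrite L2nn_sqnorm -EFinM ltry.
Qed.

Definition Qip (F K : HP) : R[i] := inner edge_mass (nabla F) (nabla K).

Lemma nablaD f g : nabla (fun x => f x + g x) = (fun e => nabla f e + nabla g e).
Proof. by apply: funext => e; rewrite /nabla /mgrad mulrDr opprD addrACA. Qed.

Lemma nablaZ c f : nabla (fun x => c * f x) = (fun e => c * nabla f e).
Proof. by apply: funext => e; rewrite /nabla /mgrad mulrBr mulrCA. Qed.

Lemma QipP : is_ip Qip.
Proof.
split.
- move=> f g h; rewrite /Qip (_ : nabla (f + g) = fun e => nabla f e + nabla g e).
    by apply: (innerDl E0); exact: nabla_ell2.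
  exact: nablaD.
- move=> c f g; rewrite /Qip (_ : nabla (c *: f) = fun e => c * nabla f e).
    by apply: (innerZl E0); exact: nabla_ell2.
  exact: nablaZ.
- by move=> f g; apply: (innerC E0); exact: nabla_ell2.
- move=> f; rewrite /Qip (innerE E0); last exact: nabla_ell2.
  by rewrite /= /N2 fsum_ge0// => x; rewrite msq_ge0.
Qed.

Lemma nnQ F : nn Qip F = N2 edge_mass (nabla F).
Proof. by rewrite /nn /Qip (innerE E0)//; exact: nabla_ell2. Qed.

Lemma Q_ge F : c0 * nn ipp F <= nn Qip F.
Proof.
have := Q_lower F; rewrite L2nn_sqnorm (sqnorm_fin E0); last exact: nabla_ell2.
by rewrite -EFinM lee_fin nnQ.
Qed.

Lemma Q_le F : nn Qip F <= C0 * nn ipp F.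
Proof.
have := Q_upper F; rewrite L2nn_sqnorm (sqnorm_fin E0); last exact: nabla_ell2.
by rewrite -EFinM lee_fin nnQ.
Qed.

Lemma nnJ F : nn ip (J F) <= nn ipp F.
Proof. by rewrite -lee_fin -!L2nn_sqnorm; exact: sqnorm_le_plus. Qed.

Lemma Q_definite : definiteH Qip.
Proof.
move=> F F0; apply: (L2_definite mp0); apply/eqP.
rewrite eq_le (nn_ge0 ippP) andbT.
by have := Q_ge F; rewrite F0 pmulr_rle0.
Qed.

Lemma cvg_Q_plus (u : nat -> HP) F : cvgH Qip u F <-> cvgH ipp u F.
Proof.
split.
  move=> /(cvgHP QipP) h; apply/(cvgHP ippP) => e e0.
  have [N hN] := h (c0 * e) ltac:(by rewrite mulr_gt0).
  exists N => n Nn; have := hN n Nn; have := Q_ge (u n - F) => h1 h2.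
  by rewrite -(ltr_pM2l c0_gt0); exact: le_lt_trans h1 h2.
move=> /(cvgHP ippP) h; apply/(cvgHP QipP) => e e0.
have C1 : 0 < `|C0| + 1 by rewrite ltr_pwDr.
have [N hN] := h (e / (`|C0| + 1)) ltac:(by rewrite divr_gt0).
exists N => n Nn; have := hN n Nn; rewrite ltr_pdivlMr// mulrC => h2.
apply: le_lt_trans (Q_le _) _; apply: le_lt_trans h2.
by rewrite ler_wpM2r ?(nn_ge0 ippP)// (le_trans (ler_norm _))// lerDl.
Qed.

Lemma Q_complete : completeH Qip.
Proof.
move=> u cu; have [e e0|F uF] := L2_complete mp0 (u := u); last by exists F; apply/cvg_Q_plus.
have [N hN] := cu (c0 * e) ltac:(by rewrite mulr_gt0).
exists N => n k Nn Nk; rewrite -(ltr_pM2l c0_gt0).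
exact: le_lt_trans (Q_ge _) (hN n k Nn Nk).
Qed.

Lemma Cc_plus f : Cc f -> ell2 (wmul m p) f.
Proof. exact: ell2_fin. Qed.

(** By local finiteness only finitely many edges meet the support of [f]. *)
Lemma edge_support f : Cc f -> exists S : set (V * V), finite_set S /\
  forall e, ~ S e -> weight G e.1 e.2 = 0 \/ nabla f e = 0.
Proof.
move=> fF.
pose S : set (V * V) := [set e | 0 < weight G e.1 e.2 /\ f e.1 != 0]
  `|` [set e | 0 < weight G e.1 e.2 /\ f e.2 != 0].
have locfin : forall x, finite_set [set y | adj G x y] by have [_ _ _ h _] := graphG.
have fS : finite_set S.
  rewrite finite_setU; split.
    pose X := \bigcup_(x in [set x | f x != 0]) [set (x, y) | y in [set y | adj G x y]].
    have fX : finite_set X by apply: bigcup_finite => // x _; exact: finite_image.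
    by apply: sub_finite_set fX => -[x y] /= [h1 h2]; exists x => //; exists y.
  pose X := \bigcup_(y in [set x | f x != 0]) [set (x, y) | x in [set x | adj G y x]].
  have fX : finite_set X by apply: bigcup_finite => // x _; exact: finite_image.
  by apply: sub_finite_set fX => -[x y] /= [h1 h2]; exists y => //; exists x => //=; rewrite /adj wC.
exists S; split=> // e nS; have [w|w] := ltP 0 (weight G e.1 e.2); last first.
    by left; apply/eqP; rewrite eq_le w w0.
  have f1 : f e.1 = 0 by apply/eqP; rewrite -[_ == _]negbK; apply/negP => h; apply: nS; left.
  have f2 : f e.2 = 0 by apply/eqP; rewrite -[_ == _]negbK; apply/negP => h; apply: nS; right.
  by right; rewrite /nabla /mgrad f1 f2 mulr0 subrr.
Qed.

Lemma mform_Qip (F K : HP) : Cc F -> Cc K -> mform G theta F K = Qip F K.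
Proof.
move=> fF fK.
have [S [fS outS]] := edge_support fF.
rewrite /mform /Qip /inner (@csum_fin _ _ S)//; last first.
  by move=> e /outS[h|h]; rewrite ?/edge_mass h ?mul0r ?mulr0 ?mul0r.
rewrite -(@fsbig_widen _ _ _ _ S)//; last first.
  by move=> e /= [_ /outS[h|h]]; rewrite -?/(nabla F e) h ?mul0r ?mulr0 ?mul0r.
rewrite !fsbig_finite//= mulr_sumr; apply: eq_bigr => e _.
rewrite /edge_mass rmorphM /= !mulrA; congr (_ * _ * _).
by rewrite mulrC fmorphV rmorph_nat.
Qed.

Lemma CcB (F K : HP) : Cc F -> Cc K -> Cc (F - K).
Proof.
move=> fF fK; have : finite_set ([set x | F x != 0] `|` [set x | K x != 0]) by rewrite finite_setU.
apply: sub_finite_set => x /= h.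
have [h0|h0] := eqVneq (F x) 0; last by left.
right; apply: contraNN h => /eqP h1; apply/eqP.
by rewrite -[LHS]/(F x - K x) h0 h1 subrr.
Qed.

(** A sequence that is Cauchy for the form converges in the complete space [HP]. The norm of [HP]
    dominates that of [H], so the limit there is the given limit in [H]. *)
Lemma form_approx_lift (u : nat -> V -> R[i]) f : ell2 m f -> form_approx G theta u f ->
  exists (U : nat -> HP) (F : HP), [/\ forall n, u n = U n, f = F & cvgH Qip U F].
Proof.
move=> lf [uC uf cu].
pose U n : HP := toL2 _ (Cc_plus (uC n)).
have UC n k : Cc (U n - U k) by apply: CcB; exact: uC.
have [|F UF] := Q_complete (u := U).
  move=> e e0; have [N hN] := cu e e0; exists N => n k Nn Nk.
  have := hN n k Nn Nk; have := mform_Qip (UC n k) (UC n k).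
  rewrite [X in X = _ -> _](_ : _ = mform G theta (u n \- u k) (u n \- u k))// => ->.
  by apply: le_lt_trans; apply: le_trans (Re_le_normc _); exact: ler_norm.
exists U, F; split=> //.
have UFp : cvgH ip (fun n => J (U n)) (J F).
  have /(cvgHP ippP) h := (cvg_Q_plus U F).1 UF.
  apply/(cvgHP ipP) => e e0; have [N hN] := h e e0; exists N => n Nn.
  apply: le_lt_trans (hN n Nn).
  have -> : J (U n) - J F = J (U n - F) by apply: L2_ext.
  exact: nnJ.
have Uf : cvgH ip (fun n => J (U n)) (toL2 _ lf) by apply/cvgH_ell2.
have := cvgH_unique ipP (L2_definite m0) UFp Uf => /(congr1 (@l2fun _ _ _ _)).
by move=> /= ->.
Qed.

(** Truncated expansions in [delta_basis] are finitely supported and converge in [HP], hence for the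
    form and in [H]. *)
Lemma form_approx_exists (F : HP) : exists (U : nat -> HP),
  form_approx G theta (fun n => U n) F /\ cvgH Qip U F.
Proof.
pose U := partial (delta_basis mp0) (fun k => ipp F (delta_basis mp0 k)).
have UF : cvgH ipp U F.
  exact: (parseval_cvg ippP (L2_complete mp0) (delta_basis_orthosys mp0) (delta_basis_total (m0 := mp0))).
have UFQ : cvgH Qip U F by apply/cvg_Q_plus.
exists U; split=> //; split.
- by move=> n; exact: partial_delta_fin.
- apply/(@cvgH_ell2 _ _ _ _ (fun n => J (U n)) (J F))/(cvgHP ipP) => e e0.
  have [N hN] := (cvgHP ippP _ _).1 UF e e0; exists N => n Nn.
  apply: le_lt_trans (hN n Nn).
  have -> : J (U n) - J F = J (U n - F) by apply: L2_ext.
  exact: nnJ.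
- move=> e e0; have [N hN] := cvgH_cauchy QipP UFQ e0.
  exists N => n k Nn Nk; have := hN n k Nn Nk.
  have UC : Cc (U n - U k) by apply: CcB; exact: partial_delta_fin.
  have := mform_Qip UC UC.
  rewrite [X in X = _ -> _](_ : _ = mform G theta (U n \- U k) (U n \- U k))// => ->.
  rewrite (ipnn QipP) /= expr0n addr0 sqrtr_sqr ger0_norm//.
  exact: nn_ge0 QipP _.
Qed.

Lemma form_domainE f : form_domain G theta f <-> exists F : HP, f = F.
Proof.
split; first by move=> [lf [u /(form_approx_lift lf)[U [F [_ -> _]]]]]; exists F.
move=> [F ->]; split; first exact: L2P (J F).
by have [U [UF _]] := form_approx_exists F; exists (fun n => U n).
Qed.

Lemma closed_formE (F K : HP) w : closed_form G theta F K w <-> w = Qip F K.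
Proof.
split=> [h|-> u v au av].
  have [U [aU UF]] := form_approx_exists F; have [W [aW WK]] := form_approx_exists K.
  have h1 := h _ _ aU aW.
  apply: (normc_cvg_unique h1).
  apply: cvg_trans (cvgH_ip QipP UF WK); apply: near_eq_cvg; apply: nearW => n.
  by rewrite mform_Qip//; [case: aU => + _ _; exact|case: aW => + _ _; exact].
have [U [F' [uU FF' UF]]] := form_approx_lift (L2P (J F)) au.
have [W [K' [vW KK' WK]]] := form_approx_lift (L2P (J K)) av.
have eF : F = F' by apply: L2_ext => x; rewrite -FF'.
have eK : K = K' by apply: L2_ext => x; rewrite -KK'.
rewrite eF eK.
apply: cvg_trans (cvgH_ip QipP UF WK); apply: near_eq_cvg; apply: nearW => n.
rewrite uU vW mform_Qip//.
  by rewrite -uU; case: au => + _ _; exact.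
by rewrite -vW; case: av => + _ _; exact.
Qed.

Notation T := (magnetic_laplacian G theta).

Lemma laplacianP f h : T f h <-> exists (F : HP) (K : H),
  [/\ f = F, h = K & forall L : HP, ip K (J L) = Qip F L].
Proof.
split.
  move=> [/form_domainE[F ->] lh hh]; exists F, (toL2 _ lh); split=> // L.
  by apply/closed_formE; apply: hh; apply/form_domainE; exists L.
move=> [F [K [-> -> hK]]]; split; [by apply/form_domainE; exists F|exact: L2P|].
by move=> g /form_domainE[L ->]; apply/closed_formE; rewrite -hK.
Qed.

(** The weak solution of [T F = K]: pairing with [K] is a bounded functional for the energy norm,
    since [c0 * nn ip (J L) <= nn Qip L], and Riesz representation applies to [Qip]. *)
Lemma solve_exists (K : H) : exists F : HP, forall L : HP, ip (J L) K = Qip L F.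
Proof.
apply: (riesz_representation QipP Q_complete).
- by move=> f g; rewrite -(ipDl ipP); congr ip; apply: L2_ext.
- by move=> c f; rewrite -(ipZl ipP); congr ip; apply: L2_ext.
- exists (nn ip K / c0); first by rewrite divr_ge0 ?(ltW c0_gt0)// (nn_ge0 ipP).
  move=> f; apply: le_trans (cauchy_schwarz ipP _ _) _.
  rewrite mulrC -mulrA ler_wpM2l ?(nn_ge0 ipP)//.
  rewrite ler_pdivlMl//; apply: le_trans (Q_ge f).
  by rewrite ler_pM2l// nnJ.
Qed.

Definition solve (K : H) : HP := xget 0 [set F : HP | forall L : HP, ip (J L) K = Qip L F].

Lemma solveE K L : ip (J L) K = Qip L (solve K).
Proof.
have [F hF] := solve_exists K.
exact: (@xgetPex HP 0 [set F : HP | forall L : HP, ip (J L) K = Qip L F] (ex_intro _ F hF) L).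
Qed.

Lemma solve_unique K F : (forall L : HP, ip (J L) K = Qip L F) -> solve K = F.
Proof.
move=> hF; apply/eqP; rewrite -subr_eq0; apply/eqP/Q_definite.
suff -> : nn Qip (solve K - F) = complex.Re 0 by [].
by rewrite /nn (ipBr QipP) -solveE hF subrr.
Qed.

Definition inv (K : H) : H := J (solve K).

Lemma invD f g : inv (f + g) = inv f + inv g.
Proof.
rewrite /inv (@solve_unique _ (solve f + solve g)); first exact: L2_ext.
by move=> L; rewrite (ipDr ipP) (ipDr QipP) !solveE.
Qed.

Lemma invZ c f : inv (c *: f) = c *: inv f.
Proof.
rewrite /inv (@solve_unique _ (c *: solve f)); first exact: L2_ext.
by move=> L; rewrite (ipZr ipP) (ipZr QipP) !solveE.
Qed.

Lemma inv_sym f g : ip (inv f) g = ip f (inv g).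
Proof. by rewrite solveE (ipC ipP) solveE -(ipC QipP). Qed.

Lemma nn_solve f : nn Qip (solve f) = complex.Re (ip (inv f) f).
Proof. by rewrite /nn -solveE. Qed.

Lemma inv_pos f : 0 <= complex.Re (ip (inv f) f).
Proof. by rewrite -nn_solve (nn_ge0 QipP). Qed.

(** The energy of the solution is [ip (inv f) f]. Cauchy-Schwarz and coercivity bound its square by
    the energy itself times [nn ip f / c0], and one factor cancels. *)
Lemma nn_solve_le f : nn Qip (solve f) <= nn ip f / c0.
Proof.
have [z|z] := eqVneq (nn Qip (solve f)) 0.
  by rewrite z divr_ge0 ?(ltW c0_gt0)// (nn_ge0 ipP).
have zp : 0 < nn Qip (solve f) by rewrite lt0r z (nn_ge0 QipP).
rewrite -(ler_pM2l zp).
have h : nn Qip (solve f) ^+ 2 <= nn ip (inv f) * nn ip f.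
  apply: le_trans (cauchy_schwarz ipP _ _); rewrite solveE (ipnn QipP) /sq /= expr0n addr0//.
rewrite -expr2; apply: (le_trans h); rewrite [leRHS]mulrCA mulrC ler_wpM2l ?(nn_ge0 ipP)//.
by rewrite ler_pdivlMr// mulrC; apply: le_trans (Q_ge _); rewrite ler_pM2l// nnJ.
Qed.

Lemma nn_plus_solve_le f : nn ipp (solve f) <= nn ip f / c0 ^+ 2.
Proof.
rewrite expr2 invfM mulrA ler_pdivlMr// mulrC.
exact: le_trans (Q_ge _) (nn_solve_le f).
Qed.

(** If the weak solution vanishes, [f] is orthogonal to every [J L], in particular to the delta
    functions. *)
Lemma inv_inj f : inv f = 0 -> f = 0.
Proof.
move=> f0; apply: (L2_ext) => x.
have h : solve f = 0 by apply: L2_ext => y; rewrite -[LHS]/(inv f y) f0.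
have : ip f (J (deltaL2 mp0 x 1)) = 0 by rewrite (ipC ipP) solveE h (ip0r QipP) conjc0.
rewrite /L2ip /= inner_deltar [X in _ * X]conjc1 mulr1 => /eqP.
rewrite mulf_eq0 => /orP[|/eqP//].
by rewrite eq_complex /= eqxx andbT gt_eqF// m0.
Qed.

Lemma inv_compact (u : nat -> H) (M : R) : (forall n, nn ip (u n) <= M) ->
  exists (s : nat -> nat) (g : H), {homo s : i j / (i < j)%N} /\
    cvgH ip (fun n => inv (u (s n))) g.
Proof.
move=> uM; have [|s [g [hs lg sg]]] := @compact_embedding R V m p (fun n => solve (u n)) (M / c0 ^+ 2) m0 p0 pfin.
  move=> n; rewrite L2nn_sqnorm lee_fin; apply: le_trans (nn_plus_solve_le _) _.
  by rewrite ler_wpM2r// invr_ge0 sqr_ge0.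
exists s, (toL2 _ lg); split=> //.
by apply/(@cvgH_ell2 _ _ _ _ (fun n => inv (u (s n))) (toL2 _ lg)).
Qed.

Lemma laplacian_inv f h : T f h <-> exists K : H, f = inv K /\ h = K.
Proof.
rewrite laplacianP; split.
  move=> [F [K [-> -> hK]]]; exists K; split=> //.
  rewrite /inv (@solve_unique K F)// => L.
  by rewrite (ipC ipP) hK -(ipC QipP).
move=> [K [-> ->]]; exists (solve K), K; split=> // L.
by rewrite (ipC ipP) solveE -(ipC QipP).
Qed.

Lemma laplacian_compact_resolvent : compact_resolvent m T.
Proof.
pose B (f : V -> R[i]) : V -> R[i] :=
  if pselect (ell2 m f) is left lf then inv (toL2 _ lf) else f.
have BE (K : H) : B K = inv K.
  rewrite /B; case: pselect => [lf|]; last by move/(_ (L2P K)).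
  by congr (l2fun (inv _)); apply: L2_ext.
(* Coercivity keeps [0] out of the spectrum, so the inverse itself serves as the resolvent. *)
exists 0, B; split; first split.
- move=> f lf; rewrite (_ : f = toL2 (fun x => ltW (m0 x)) lf)// BE.
  split; first exact: L2P.
  apply/laplacian_inv; exists (toL2 _ lf); split=> //.
  by apply: funext => x; rewrite mul0r addr0.
- move=> f h /laplacian_inv[K [-> ->]].
  rewrite -BE; congr B; apply: funext => x.
  by rewrite mul0r subr0.
- move=> u M uM.
  have lu n : ell2 m (u n) by rewrite /ell2 /= (le_lt_trans (uM n))// ltry.
  have [|s [g [hs sg]]] := @inv_compact (fun n => toL2 _ (lu n)) M.
    by move=> n; rewrite -lee_fin -L2nn_sqnorm; exact: uM.
  exists s, g; split=> //; first exact: L2P.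
  have -> : (fun n => B (u (s n))) = (fun n => inv (toL2 _ (lu (s n))) : V -> R[i]).
    by apply: funext => n; rewrite -BE.
  by move/cvgH_ell2: sg.
Qed.

Lemma inv_bounded : exists2 K : R, 0 <= K & forall f, nn ip (inv f) <= K * nn ip f.
Proof.
exists (c0 ^- 2); first by rewrite invr_ge0 sqr_ge0.
by move=> f; rewrite mulrC; apply: le_trans (nnJ _) (nn_plus_solve_le f).
Qed.

(** The eigenvectors of the compact inverse diagonalize [T], with reciprocal eigenvalues. *)
Lemma laplacian_spectral_measure : exists E, is_spectral_measure m T E.
Proof.
have [e [b [eo et b0 Be]]] := compact_spectral ipP (L2_definite m0)
  invD invZ inv_sym inv_pos inv_inj inv_bounded inv_compact.
eexists; apply: (@diagonal_spectral_measure R V m m0 e (fun k => (b k)^-1) eo et).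
  by move=> k; rewrite invr_ge0 ltW.
move=> f h; rewrite laplacian_inv; split.
  move=> [K [-> ->]]; exists (inv K), K; split=> // k.
  rewrite inv_sym Be (ipZr ipP) [X in _ * (X * _)]conjC_real mulrA -rmorphM /=.
  by rewrite mulVf ?mul1r// gt_eqF.
move=> [F [K [-> -> hk]]]; exists K; split=> //; congr l2fun.
apply: (coef_inj ipP et) => k; rewrite inv_sym Be (ipZr ipP) hk.
by rewrite [X in X * _]conjC_real mulrA -rmorphM /= mulfV ?mul1r// gt_eqF.
Qed.

Lemma laplacian_energy f h : T f h ->
  (complex.Re (inner m h f))%:E = sqnorm edge_mass (nabla f).
Proof.
move=> /laplacianP[F [K [-> -> hK]]].
rewrite -[inner m K F]/(ip K (J F)) hK (sqnorm_fin E0); last exact: nabla_ell2.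
by rewrite -nnQ.
Qed.

(* The terms of the finite sum [Qip L F] are evaluations of [L], hence inner
   products with delta functions. *)
Lemma laplacian_Cc f : Cc f -> exists h, T f h.
Proof.
move=> fC; pose F : HP := toL2 _ (Cc_plus fC).
suff [K hK] : exists K : H, forall L : HP, ip (J L) K = Qip L F.
  exists K; apply/laplacianP; exists F, K; split=> // L.
  by rewrite (ipC ipP) hK -(ipC QipP).
have [S [fS outS]] := edge_support fC.
pose d x : H := deltaL2 m0 x ((m x)^-1)%:C.
have dE (L : HP) x : ip (J L) (d x) = L x.
  rewrite /L2ip inner_deltar [X in _ * X]conjC_real mulrAC -rmorphM /=.
  by rewrite mulfV ?mul1r// gt_eqF.
pose c e : R[i] := (edge_mass e)%:C * (nabla F e)^*.
exists (\sum_(e <- finmap.enum_fset (fset_set S))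
   ((c e)^* *: d e.1 - ((c e) * expi (theta e.1 e.2))^* *: d e.2)).
move=> L; rewrite (ip_sumr ipP) /Qip /inner (@csum_fin _ _ S)//; last first.
  move=> e /outS[h|h]; first by rewrite /edge_mass h ?mul0r.
  by rewrite [nabla F e]h [X in _ * X]conjc0 mulr0.
rewrite fsbig_finite//=; apply: eq_bigr => e _.
have JK (z : R[i]) : (z^*)^* = z by case: z => a b; rewrite /= opprK.
rewrite (ipBr ipP) !(ipZr ipP) [X in X * _ - _]JK [X in _ - X * _]JK !dE /c /nabla /mgrad.
by ring.
Qed.

End FormOperator.

(** * The magnetic spectrum of a finite graph *)

Section Conjugation.
Context {R : realType}.
Implicit Types z w : R[i].

(* In [ring_scope] and [complex_scope], [z^*] may stand for either operation. *)
Lemma num_conjE z : Num.conj z = conjc z. Proof. by []. Qed.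
Lemma conjM z w : conjc (z * w) = conjc z * conjc w. Proof. exact: rmorphM. Qed.
Lemma conjB z w : conjc (z - w) = conjc z - conjc w. Proof. exact: rmorphB. Qed.
Lemma conjR (a : R) : conjc (a%:C) = a%:C. Proof. by rewrite /= oppr0. Qed.

End Conjugation.

(** The eigenvector for [la k] is the conjugated row [i |-> conjc (U k i)]. *)
Lemma hermitian_diagonalization (R : realType) n (A : 'M[R[i]]_n) :
  (forall i j, A j i = conjc (A i j)) ->
  exists (la : 'I_n -> R) (U : 'M[R[i]]_n), [/\
    forall i j, A i j = \sum_k conjc (U k i) * (la k)%:C * U k j,
    forall k l, \sum_i U k i * conjc (U l i) = (k == l)%:R &
    forall i j, \sum_k conjc (U k i) * U k j = (i == j)%:R].
Proof.
move=> Aherm.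
have AH : A \is hermsymmx.
  apply/is_hermitianmxP; rewrite expr0 scale1r; apply/matrixP => i j.
  by rewrite !mxE Aherm.
have /orthomx_spectralP := hermitian_normalmx AH.
have /mxOverP dr := hermitian_spectral_diag_real AH.
have := spectral_unitarymx A.
move: (spectralmx A) (spectral_diag A) dr => U D dr Uu.
rewrite (invmx_unitary Uu) => AE.
have UV := unitarymxP Uu.
have VU := mulmx1C UV.
exists (fun k => complex.Re (D 0 k)), U; split.
- move=> i j; rewrite AE mxE; apply: eq_bigr => k _; rewrite mul_mx_diag !mxE.
  congr (_ * _ * _).
  have /complex_realP[r ->] : D 0 k \is Num.real by exact: dr.
  by [].
- move=> k l; have /matrixP/(_ k l) := UV; rewrite !mxE => <-.
  by apply: eq_bigr => i _; rewrite !mxE.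
- move=> i j; have /matrixP/(_ i j) := VU; rewrite !mxE => <-.
  by apply: eq_bigr => k _; rewrite !mxE.
Qed.

Section UnitCircle.
Context {R : realType}.
Implicit Types s t : R.

Lemma expiD s t : expi (s + t) = expi s * expi t.
Proof. by rewrite /expi cosD sinD; simpc; congr (_ +i* _); ring. Qed.

Lemma expiN t : expi (- t) = (expi t)^*.
Proof. by rewrite /expi cosN sinN. Qed.

Lemma expi0 : expi 0 = 1 :> R[i].
Proof. by rewrite /expi cos0 sin0. Qed.

Lemma sq_expi t : sq (expi t) = 1.
Proof. by rewrite /sq /expi /= cos2Dsin2. Qed.

Lemma expi_2pi (k : int) : expi (2 * pi * k%:~R) = 1 :> R[i].
Proof.
have nat_case (n : nat) : expi (2 * pi * n%:R) = 1 :> R[i].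
  elim: n => [|n IH]; first by rewrite mulr0 expi0.
  rewrite (_ : 2 * pi * n.+1%:R = 2 * pi * n%:R + pi *+ 2); last by ring.
  by rewrite expiD IH mul1r /expi cos2pi sin2pi.
case: k => n; first exact: nat_case.
by rewrite NegzE mulrNz mulrN expiN nat_case conjc1.
Qed.

Lemma expi_eq2pi s t : eq2pi s t -> expi s = expi t :> R[i].
Proof.
by move=> [k e]; rewrite (_ : s = t + 2 * pi * k%:~R) ?expiD ?expi_2pi ?mulr1// -e addrC subrK.
Qed.

(** Reduce [t] to [r] in [[0, 2 pi[]. Injectivity of [cos] on [[0, pi]] applies to [r] or to
    [2 * pi - r]; in the second case it would give [r = 2 * pi]. *)
Lemma expi_eq1 t : expi t = 1 :> R[i] -> eq2pi t 0.
Proof.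
move=> t1; have pi0 := @pi_gt0 R.
have p2 : 0 < 2 * pi :> R by rewrite mulr_gt0.
pose k := Num.floor (t / (2 * pi)); pose r := t - 2 * pi * k%:~R.
have tE : t = r + 2 * pi * k%:~R by rewrite subrK.
have r0 : 0 <= r.
  by rewrite subr_ge0 mulrC -ler_pdivlMr// floor_le_tmp.
have r2 : r < 2 * pi.
  rewrite ltrBlDl -{2}[2 * pi]mulr1 -mulrDr mulrC -ltr_pdivrMr//.
  by rewrite -[1]/(1%:~R) -intrD floorD1_gt.
have r1 : expi r = 1 :> R[i] by rewrite -t1 tE expiD expi_2pi mulr1.
have cr : cos r = 1 by case: r1.
suff -> : t = 2 * pi * k%:~R by exists k; rewrite subr0.
rewrite tE (_ : r = 0) ?add0r//.
have [rpi|pir] := lerP r pi.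
  by apply: (@cos_inj R); rewrite ?in_itv /= ?lexx ?r0 ?rpi ?cos0 ?(ltW pi0).
have : 2 * pi - r = 0.
  apply: (@cos_inj R); rewrite ?in_itv /= ?lexx ?(ltW pi0)//.
    by apply/andP; split; lra.
  by rewrite cos0 cosB [2 * pi]mulrC mulr_natr cos2pi sin2pi cr; ring.
lra.
Qed.

End UnitCircle.

Section FiniteMagneticSpectrum.
Context {R : realType} {V : countType} (G : @wgraph R V) (theta : V -> V -> R).
Context (graphG : is_graph G) (potential : is_potential G theta).
Context (finV : finite_set [set: V]) (d : R) (degd : forall y, deg G y = d).
Hypothesis hol : ~ Hol_zero G theta.
Let m := mass G.
Let m0 x : 0 < m x. Proof. by have [_ h _ _ _] := graphG; exact: h. Qed.
Let m0' x : 0 <= m x. Proof. exact: ltW. Qed.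
Let w0 x y : 0 <= weight G x y. Proof. by have [[h _] _ _ _ _] := graphG; exact: h. Qed.
Let wC x y : weight G x y = weight G y x. Proof. by have [[_ h] _ _ _ _] := graphG; exact: h. Qed.
Let wxx x : weight G x x = 0. Proof. by have [_ _ h _ _] := graphG; exact: h. Qed.

Lemma parallel_path (g : V -> R[i]) x p :
  (forall x y, adj G x y -> g x = expi (theta x y) * g y) -> path (adj G) x p ->
  g x = expi (holonomy theta x p) * g (last x p).
Proof.
move=> gE; elim: p x => [|y p IH] x /=; first by rewrite /holonomy big_nil expi0 mul1r.
move=> /andP[xy yp]; rewrite /holonomy /= big_cons expiD -mulrA -[X in _ * X]IH//.
exact: gE.
Qed.

(* A parallel section would trivialize the holonomy. *)
Lemma no_parallel_section (g : V -> R[i]) :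
  (forall x y, adj G x y -> g x = expi (theta x y) * g y) -> forall x, g x = 0.
Proof.
move=> gE x; apply: contrapT => /eqP gx; apply: hol => y p yp lp.
apply: expi_eq1; have gy : g y != 0.
  have [_ _ _ _ /(_ x y)[q xq lq]] := graphG.
  by apply: contra gx => /eqP gy; rewrite (parallel_path gE xq) lq gy mulr0.
have := parallel_path gE yp; rewrite lp => e.
by apply: (mulIf gy); rewrite -e mul1r.
Qed.

Definition vertices : seq V := finmap.enum_fset (fset_set [set: V]).
Definition vertex (i : 'I_(size vertices)) : V := tnth (in_tuple vertices) i.

Let mem_vertices x : x \in vertices.
Proof. by rewrite /vertices in_fset_set// inE. Qed.

Let vertices_uniq : uniq vertices. Proof. exact: finmap.fset_uniq. Qed.

Lemma vertexP x : exists i, x = vertex i.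
Proof. by have /(tnthP (in_tuple vertices))[i ->] := mem_vertices x; exists i. Qed.

Lemma vertex_inj : injective vertex.
Proof. by have /(tuple_uniqP (in_tuple vertices)) h := vertices_uniq; exact: h. Qed.

Lemma sum_vertices (W : nmodType) (F : V -> W) : \sum_(x \in [set: V]) F x = \sum_i F (vertex i).
Proof. by rewrite fsbig_finite// big_tnth. Qed.

Lemma esum_vertices (F : V -> R) : (forall x, 0 <= F x) ->
  (\esum_(x in [set: V]) (F x)%:E)%E = (\sum_i F (vertex i))%:E.
Proof.
by move=> F0; rewrite (@esum_fin R V [set: V])// ?sum_vertices// => x /(_ Logic.I).
Qed.

Lemma sum_vertices2 (F : V * V -> R) : (forall e, 0 <= F e) ->
  (\esum_(e in [set: V * V]) (F e)%:E)%E = (\sum_i \sum_j F (vertex i, vertex j))%:E.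
Proof.
move=> F0; transitivity (\esum_(x in [set: V]) \esum_(y in [set: V]) (F (x, y))%:E)%E.
  rewrite esum_esum => [|x y _ _]; last by rewrite lee_fin.
  have -> : [set: V] `*`` (fun=> [set: V]) = [set: V * V] by apply/seteqP; split.
  by apply: eq_esum => -[].
rewrite (eq_esum (b := fun x => (\sum_j F (x, vertex j))%:E)); last first.
  by move=> x _; rewrite esum_vertices.
by rewrite esum_vertices// => x; exact: sumr_ge0.
Qed.

Let n := size vertices.
Let mu (i : 'I_n) : R := Num.sqrt (m (vertex i)).
Let mu0 i : 0 < mu i. Proof. by rewrite sqrtr_gt0. Qed.
Let mu2 i : mu i * mu i = m (vertex i). Proof. by rewrite -expr2 sqr_sqrtr. Qed.
Let E (i j : 'I_n) : R := weight G (vertex i) (vertex j).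
Let w (i j : 'I_n) : R[i] := expi (theta (vertex i) (vertex j)).

Let sumE i : \sum_j E i j = d * m (vertex i).
Proof.
have := degd (vertex i); rewrite /deg sum_vertices => <-.
by rewrite mulrAC mulVf ?mul1r// gt_eqF.
Qed.

(** The magnetic Laplacian conjugated by the square root of the mass, which makes it Hermitian for
    the unweighted inner product. *)
Let A : 'M[R[i]]_n := \matrix_(i, j)
  (((mu i)^-1 * (mu j)^-1)%:C * (((i == j)%:R * (d * m (vertex i)))%:C - (E i j)%:C * w i j)).

Let wJ i j : w j i = conjc (w i j).
Proof. by rewrite /w (expi_eq2pi (potential.1 _ _)) expiN. Qed.

Let A_herm i j : A j i = conjc (A i j).
Proof.
rewrite !mxE ?num_conjE !(conjM, conjB, conjR) -wJ /E wC [_ * (mu j)^-1]mulrC eq_sym.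
by case: eqP => [->|_] //; rewrite !mul0r.
Qed.

(** Expanding the square gives two diagonal sums, equal by symmetry of the weights and evaluated by
    [sumE], minus a cross term that comes from the off-diagonal part of [A]. *)
Let energyA (g : V -> R[i]) (u : 'I_n -> R[i]) :
  (forall i, u i = (mu i)%:C * g (vertex i)) ->
  sqnorm (edge_mass G) (nabla theta g) =
  (complex.Re (\sum_i \sum_j conjc (u i) * A i j * u j))%:E.
Proof.
move=> uE.
rewrite /sqnorm sum_vertices2 => [|e]; last by rewrite mulr_ge0 ?sqr_ge0 ?divr_ge0.
congr (_%:E).
pose S i := sq (g (vertex i)).
pose X i j := conjc (g (vertex i)) * (E i j)%:C * w i j * g (vertex j).
have e1 i j : edge_mass G (vertex i, vertex j) * normc (nabla theta g (vertex i, vertex j)) ^+ 2 =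
  (E i j * S i + E i j * S j) / 2 - complex.Re (X i j).
  have : sq (w i j) = 1 by exact: sq_expi.
  rewrite normc_sq /edge_mass /nabla /mgrad /= -/(E i j) -/(w i j) /S /X /sq.
  case: (w i j) => a b; case: (g (vertex i)) => p q; case: (g (vertex j)) => r s /= ab.
  transitivity (E i j / 2 * (p ^+ 2 + q ^+ 2 + (a ^+ 2 + b ^+ 2) * (r ^+ 2 + s ^+ 2)
    - 2 * ((p * a + q * b) * r + (q * a - p * b) * s))); first by ring.
  by rewrite ab; field.
under eq_bigr => i _ do under eq_bigr => j _ do rewrite e1.
have e2 i j : conjc (u i) * A i j * u j =
   ((i == j)%:R * (d * m (vertex i)) * S i)%:C - X i j.
  rewrite mxE !uE ?num_conjE conjM conjR /X ?num_conjE.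
  have mi : (mu i)%:C * ((mu i)^-1)%:C = 1 :> R[i] by rewrite -rmorphM /= mulfV// gt_eqF.
  have mj : (mu j)%:C * ((mu j)^-1)%:C = 1 :> R[i] by rewrite -rmorphM /= mulfV// gt_eqF.
  transitivity (((mu i)%:C * ((mu i)^-1)%:C) * ((mu j)%:C * ((mu j)^-1)%:C) *
    (((i == j)%:R * (d * m (vertex i)))%:C * (conjc (g (vertex i)) * g (vertex j)) -
      conjc (g (vertex i)) * (E i j)%:C * w i j * g (vertex j))).
    by rewrite [((mu i)^-1 * _)%:C]rmorphM /=; ring.
  rewrite mi mj !mul1r; congr (_ - _); case: eqP => [<-|_]; last by rewrite !mul0r.
  by rewrite [conjc _ * _]mulrC mulJ -rmorphM.
under [in RHS]eq_bigr => i _ do under eq_bigr => j _ do rewrite e2.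
have ReS (F : 'I_n -> R[i]) : complex.Re (\sum_i F i) = \sum_i complex.Re (F i).
  by rewrite (big_morph _ (@ReD R) (erefl _)).
rewrite ReS; under [RHS]eq_bigr => i _ do rewrite ReS.
under [RHS]eq_bigr => i _ do under eq_bigr => j _ do rewrite ReD /= raddfN /=.
under eq_bigr => i _ do rewrite big_split /=.
under [RHS]eq_bigr => i _ do rewrite big_split /=.
rewrite !big_split /=; congr (_ + _).
under eq_bigr => i _ do rewrite -mulr_suml big_split /=.
rewrite -mulr_suml big_split /=.
rewrite [X in _ + X]exchange_big /=.
have -> : \sum_(j < n) \sum_(i < n) E i j * S j = \sum_(i < n) \sum_(j < n) E i j * S i.
  by apply: eq_bigr => i _; apply: eq_bigr => j _; rewrite /E wC.
have half (x : R) : (x + x) / 2 = x by field.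
rewrite [LHS]half.
apply: eq_bigr => i _; rewrite -mulr_suml sumE (bigD1 i)//= eqxx mul1r big1 ?addr0//.
by move=> j; rewrite eq_sym => /negPf ->; rewrite !mul0r.
Qed.

Lemma unitary_quad_form (U : 'M[R[i]]_n) (la : 'I_n -> R) (u : 'I_n -> R[i]) :
  (\sum_k la k * sq (\sum_i U k i * u i))%:C =
  \sum_i \sum_j conjc (u i) * (\sum_k conjc (U k i) * (la k)%:C * U k j) * u j.
Proof.
rewrite rmorph_sum /=.
have e k : (la k * sq (\sum_i U k i * u i))%:C =
    \sum_i \sum_j conjc (u i) * (conjc (U k i) * (la k)%:C * U k j) * u j.
  rewrite rmorphM /= -mulJ ?num_conjE (_ : conjc _ = \sum_i conjc (U k i) * conjc (u i)); last first.
    by rewrite [LHS]rmorph_sum; apply: eq_bigr => i _; exact: conjM.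
  rewrite [X in _ * X]mulrC mulr_suml mulr_sumr; apply: eq_bigr => i _.
  by rewrite !mulr_sumr; apply: eq_bigr => j _; ring.
under eq_bigr => k _ do rewrite e.
rewrite exchange_big /=; apply: eq_bigr => i _; rewrite exchange_big /=.
by apply: eq_bigr => j _; rewrite mulr_sumr mulr_suml.
Qed.

Lemma finite_magnetic_spectrum : exists N (la : 'I_N -> R) (psi : 'I_N -> V -> R[i]), [/\
  forall j k, inner m (psi j) (psi k) = (j == k)%:R,
  forall g, sqnorm m g = (\sum_j sq (inner m g (psi j)))%:E,
  forall g, sqnorm (edge_mass G) (nabla theta g) = (\sum_j la j * sq (inner m g (psi j)))%:E,
  forall j, 0 < la j &
  [/\ N = size vertices, \sum_j la j = N%:R * d & exists j, la j < d]].
Proof.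
have [la [U [AE UV VU]]] := hermitian_diagonalization A_herm.
(* Eigenvectors of [A], divided by [mu] to undo the conjugation; the sum over [i] selects the index
   of [x]. *)
pose psi k x : R[i] := \sum_i (x == vertex i)%:R * conjc (U k i) * ((mu i)^-1)%:C.
have psiE k i : psi k (vertex i) = conjc (U k i) * ((mu i)^-1)%:C.
  rewrite /psi (bigD1 i)//= eqxx mul1r big1 ?addr0// => j ji.
  by rewrite (inj_eq vertex_inj) eq_sym (negPf ji) !mul0r.
pose u (g : V -> R[i]) i := (mu i)%:C * g (vertex i).
have muV i : (mu i)%:C * ((mu i)^-1)%:C = 1 :> R[i] by rewrite -rmorphM /= mulfV// gt_eqF.
have innerU g k : inner m g (psi k) = \sum_i U k i * u g i.
  rewrite /inner (@csum_fin _ _ [set: V])//; last by move=> x /(_ Logic.I).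
  rewrite sum_vertices; apply: eq_bigr => i _; rewrite psiE ?num_conjE conjM conjR.
  have -> : conjc (conjc (U k i)) = U k i by case: (U k i) => a b; rewrite /= opprK.
  rewrite -mu2 rmorphM /= /u.
  transitivity ((mu i)%:C * ((mu i)^-1)%:C * (U k i * ((mu i)%:C * g (vertex i)))); first by ring.
  by rewrite muV mul1r.
have upsi k i : u (psi k) i = conjc (U k i).
  by rewrite /u psiE mulrCA muV mulr1.
have ortho j k : inner m (psi j) (psi k) = (j == k)%:R.
  rewrite innerU eq_sym -UV; apply: eq_bigr => i _; by rewrite upsi.
have energy g : sqnorm (edge_mass G) (nabla theta g) = (\sum_j la j * sq (inner m g (psi j)))%:E.
  rewrite (@energyA g (u g))//; congr (_%:E).
  under eq_bigr => i _ do under eq_bigr => j _ do rewrite AE.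
  by rewrite -unitary_quad_form /=; apply: eq_bigr => k _; rewrite innerU.
have energy_psi k : sqnorm (edge_mass G) (nabla theta (psi k)) = (la k)%:E.
  rewrite energy (bigD1 k)//= ortho eqxx big1 ?addr0 => [|j jk].
    by rewrite /sq /= expr0n addr0 expr1n mulr1.
  by rewrite ortho eq_sym (negPf jk) sq0 mulr0.
(* Every diagonal entry of [A] is [d], as there are no loops, and for each [k] the [sq (U k i)] sum
   to [1]. *)
have trace : \sum_j la j = n%:R * d.
  have e i : d = \sum_k la k * sq (U k i).
    have /(congr1 (@complex.Re R)) := AE i i.
    rewrite mxE eqxx mul1r /E wxx mul0r subr0 -rmorphM /= -mu2.
    have -> : (mu i)^-1 / mu i * (d * (mu i * mu i)) = d by field; rewrite gt_eqF.
    move=> ->; rewrite (big_morph _ (@ReD R) (erefl _)); apply: eq_bigr => k _.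
    by rewrite mulrAC [conjc _ * _]mulrC mulJ -rmorphM /= mulrC.
  transitivity (\sum_(i < n) d); last by rewrite sumr_const card_ord mulr_natl.
  rewrite (eq_bigr (fun i => \sum_k la k * sq (U k i)) (fun i _ => e i)).
  rewrite exchange_big /=; apply: eq_bigr => k _; rewrite -mulr_sumr.
  have /(congr1 (@complex.Re R)) := UV k k.
  rewrite eqxx (big_morph _ (@ReD R) (erefl _)) => h.
  rewrite (_ : \sum_i sq (U k i) = 1) ?mulr1// -[RHS]h.
  by apply: eq_bigr => i _; rewrite mulJ.
have ortho1 k : inner m (psi k) (psi k) = 1 by rewrite ortho eqxx.
(* If [la k = 0], the gradient of [psi k] vanishes along every edge; [psi k] is then a parallel
   section, hence zero, although its norm is one. *)
have la0 k : 0 < la k.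
  have lak : 0 <= la k by rewrite -lee_fin -energy_psi; apply: sqnorm_ge0 => e; rewrite divr_ge0.
  rewrite lt_neqAle lak andbT eq_sym; apply/eqP => lak0.
  have := energy_psi k; rewrite lak0 => e0.
  have z0 x : psi k x = 0.
    apply: no_parallel_section => {x} x y xy.
    have nonneg e : 0 <= msq (edge_mass G) (nabla theta (psi k)) e.
      by apply: msq_ge0 => e'; rewrite divr_ge0.
    have el : ell2 (edge_mass G) (nabla theta (psi k)) by rewrite /ell2 /= e0 ltry.
    have e0' e : 0 <= edge_mass G e by rewrite divr_ge0.
    have : msq (edge_mass G) (nabla theta (psi k)) (x, y) <= 0.
      by apply: le_trans (msq_le_N2 e0' _ el) _; rewrite -lee_fin -sqnorm_fin// e0.
    move=> h; apply/eqP; rewrite -subr_eq0; apply/eqP; apply: sq_eq0.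
    have := conj h (nonneg (x, y)); rewrite /msq /edge_mass /= -/(mgrad _ _ _ _).
    have := xy; rewrite /adj /nabla /= => w1 [h1 h2]; apply/eqP.
    have /eqP : weight G x y / 2 * sq (mgrad theta (psi k) x y) = 0 by apply/eqP; rewrite eq_le h1 h2.
    by rewrite mulf_eq0 gt_eqF ?divr_gt0.
  have := ortho1 k; rewrite innerU big1 => [/esym/eqP|i _]; first by rewrite oner_eq0.
  by rewrite /u z0 !mulr0.
exists n, la, psi; split=> //.
- move=> g; rewrite /sqnorm esum_vertices; last by move=> x; rewrite mulr_ge0 ?sqr_ge0.
  congr (_%:E); have := unitary_quad_form U (fun=> 1) (u g).
  under [X in X%:C]eq_bigr => k _ do rewrite mul1r -innerU.
  move=> /(congr1 (@complex.Re R)) /= ->.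
  transitivity (complex.Re (\sum_i (sq (u g i))%:C)).
    rewrite (big_morph _ (@ReD R) (erefl _)); apply: eq_bigr => i _.
    by rewrite normc_sq /u sqM -mu2 /= {2}/sq /= expr0n addr0 expr2.
  congr (complex.Re _); apply: eq_bigr => i _.
  have VU1 i' j : \sum_k conjc (U k i') * 1%:C * U k j = (i' == j)%:R.
    by rewrite -VU; apply: eq_bigr => k _; rewrite [_ * 1%:C]mulr1.
  under eq_bigr => j _ do rewrite VU1.
  rewrite (bigD1 i)//= big1 ?addr0 => [|j ji].
    by rewrite eqxx mulr1 mulrC mulJ.
  by rewrite eq_sym (negPf ji) mulr0 mul0r.
(* Otherwise all [la k] are at least their mean [d], hence equal to it, and [A] is [d] times the
   identity. The graph then has no edge, its only closed walks are empty, and the holonomy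
   vanishes. *)
- split=> //; apply: contrapT => /forallNP nl; apply: hol.
  have lad k : la k = d.
    have ge j : 0 <= la j - d by rewrite subr_ge0 leNgt; apply/negP; exact: nl.
    have s0 : \sum_j (la j - d) = 0.
      by rewrite sumrB trace sumr_const card_ord mulr_natl subrr.
    have := @psumr_eq0P _ _ _ _ (fun j _ => ge j) s0 k isT.
    by move/eqP; rewrite subr_eq0 => /eqP.
  have noedge x y : ~~ adj G x y.
    have [-> | xy] := eqVneq x y; first by rewrite /adj wxx ltxx.
    have [[i xi] [j yj]] := (vertexP x, vertexP y).
    have ij : (i == j) = false by apply/negP => /eqP ij; move: xy; rewrite xi yj ij eqxx.
    have := AE i j; under eq_bigr => k _ do rewrite lad mulrAC.
    rewrite -mulr_suml VU ij mul0r mxE ij !mul0r sub0r => /(congr1 (@sq R)).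
    rewrite sq0 sqM sqN sqM sq_expi mulr1 => /eqP.
    rewrite mulf_eq0 => /orP[]/eqP/sq_eq0.
      move=> /(congr1 (@complex.Re R)) /= /eqP; by rewrite mulf_eq0 !invr_eq0 !gt_eqF.
    by move=> /(congr1 (@complex.Re R)) /= ; rewrite /adj xi yj /E => ->; rewrite ltxx.
  move=> x [|y p] /=; last by rewrite (negPf (noedge x y)).
  by move=> _ _; rewrite /holonomy big_nil; exists 0; rewrite subrr mulr0.
Qed.

End FiniteMagneticSpectrum.

(** * Coefficients and products of graphs *)

Section CountingCoefficients.
Context {R : realType} {V W : countType} (m : V -> R) (m0 : forall x, 0 < m x).
Context (T : @operator R V) (phi : W -> (V -> R[i]) -> R[i]) (b : W -> V -> R[i]) (q mu : W -> R).
Context (C : R).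
Hypothesis T_spectral : exists E, is_spectral_measure m T E.
Hypothesis T_ell2 : forall f h, T f h -> ell2 m f.
Hypothesis T_b : forall n (c : 'I_n -> R[i]) (w : 'I_n -> W),
  exists h, T (fun x => \sum_(i < n) c i * b (w i) x) h.
Hypothesis b_ell2 : forall w, ell2 m (b w).
Hypothesis phi_linear : forall w n (c : 'I_n -> R[i]) (f : 'I_n -> V -> R[i]),
  phi w (fun x => \sum_(j < n) c j * f j x) = \sum_(j < n) c j * phi w (f j).
Hypothesis phi_b : forall w w', phi w (b w') = (w == w')%:R.
Hypothesis mu0 : forall w, 0 <= mu w.
Hypothesis q0 : forall w, 0 <= q w.
Hypothesis phi_norm : forall f, sqnorm m f = (\esum_(w in [set: W]) (mu w * sq (phi w f))%:E)%E.
Hypothesis phi_lower : forall f h, T f h ->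
  (\esum_(w in [set: W]) (q w * (mu w * sq (phi w f)))%:E <= (complex.Re (inner m h f))%:E)%E.
Hypothesis phi_upper : forall f h, T f h ->
  ((complex.Re (inner m h f))%:E <=
   \esum_(w in [set: W]) (q w * (mu w * sq (phi w f)))%:E + (C * N2 m f)%:E)%E.
Hypothesis q_finite : forall t, finite_set [set w | q w <= t].

Definition sublevel (t : R) : seq W := finmap.enum_fset (fset_set [set w | q w <= t]).

Let m0' x : 0 <= m x := ltW (m0 x).

Let mem_sublevel t w : (w \in sublevel t) = (q w <= t).
Proof.
rewrite /sublevel in_fset_set//.
by apply/idP/idP => [/set_mem|h] //; exact/mem_set.
Qed.

Let sublevel_uniq t : uniq (sublevel t). Proof. exact: finmap.fset_uniq. Qed.

Let item t (i : 'I_(size (sublevel t))) : W := tnth (in_tuple (sublevel t)) i.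

Let item_inj t : injective (@item t).
Proof. by have /(tuple_uniqP (in_tuple (sublevel t))) h := sublevel_uniq t; exact: h. Qed.

Let itemP t w : q w <= t -> exists i, w = @item t i.
Proof. by rewrite -mem_sublevel => /(tnthP (in_tuple (sublevel t)))[i ->]; exists i. Qed.

Let phi0 w : phi w (fun=> 0) = 0.
Proof.
have := @phi_linear w 0%N (fun=> 0) (fun _ _ => 0); rewrite [RHS]big_ord0 => e; rewrite -[RHS]e.
by congr phi; apply: funext => x; rewrite big_ord0.
Qed.

Let term0 f w : 0 <= mu w * sq (phi w f). Proof. by rewrite mulr_ge0 ?sq_ge0. Qed.

Let esum_norm (K : R) f : 0 <= K -> ell2 m f ->
  (\esum_(w in [set: W]) (K * (mu w * sq (phi w f)))%:E = (K * N2 m f)%:E)%E.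
Proof. by move=> K0 f2; rewrite esumZ// -phi_norm (sqnorm_fin m0')// EFinM. Qed.

(** In the coordinates [phi] the operator is diagonal with entries [q], up to a perturbation between
    [0] and [C]. The functions [b w] with [q w <= l - 1 - C] are trial functions for the lower
    bound; the functionals [phi w] with [q w <= l + 1] give the upper one. It serves both the
    Laplacian and the degree. *)
Lemma counting_coefficients (l : R) : 1 + C <= l -> 0 <= C ->
  (size (sublevel (l - 1 - C)))%:R <= fine (counting_function m T l) <= (size (sublevel (l + 1)))%:R.
Proof.
move=> lC C0.
apply: (@counting_function_bounds R V m m0 T l _ _ (fun i => b (item i)) (fun i => phi (item i))) => //.
- move=> f h /phi_lower; rewrite -lee_fin; apply: le_trans.
  by apply: esum_ge0 => w _; rewrite lee_fin mulr_ge0.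
- move=> c c0 k; have := phi_linear (item k) c (fun i => b (item i)).
  rewrite (_ : (fun x => _) = fun=> 0); last exact: funext.
  rewrite phi0 (bigD1 k)//= phi_b eqxx mulr1 big1 ?addr0// => j jk.
  by rewrite phi_b (inj_eq (@item_inj _)) eq_sym (negPf jk) mulr0.
- move=> c; have [h Th] := T_b c (@item (l - 1 - C)); exists h => //.
  set g := (fun x => \sum_(i < _) _) in Th *; have g2 := T_ell2 Th.
  rewrite -lee_fin; apply: (le_trans (phi_upper Th)).
  rewrite (_ : l - 1 = (l - 1 - C) + C); last by rewrite subrK.
  rewrite mulrDl EFinD; apply: leeD2r.
  rewrite -esum_norm//; last by lra.
  apply: le_esum => w _; rewrite lee_fin.
  have [qw|qw] := leP (q w) (l - 1 - C); first by rewrite ler_wpM2r.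
  rewrite (_ : phi w g = 0) ?sq0 ?mulr0// /g phi_linear big1// => i _.
  rewrite phi_b; case: eqP => [wi|_]; last by rewrite mulr0.
  by have := mem_tnth i (in_tuple (sublevel (l - 1 - C))); rewrite -/(item i) -wi mem_sublevel leNgt qw.
- move=> f h Th f0; rewrite -lee_fin; apply: le_trans (phi_lower Th).
  have l1 : 0 <= l + 1 by lra.
  rewrite -(esum_norm l1 (T_ell2 Th)).
  apply: le_esum => w _; rewrite lee_fin.
  have [qw|qw] := leP (q w) (l + 1); last by rewrite ler_wpM2r// ltW.
  by have [i ->] := itemP qw; rewrite f0 sq0 !mulr0.
Qed.

End CountingCoefficients.

Section IteratedSums.
Context {R : realType}.

Lemma esum_pair (A B : countType) (F : A * B -> \bar R) : (forall e, (0 <= F e)%E) ->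
  (\esum_(e in [set: A * B]) F e =
   \esum_(x in [set: A]) \esum_(y in [set: B]) F (x, y))%E.
Proof.
move=> F0; rewrite esum_esum//.
have -> : [set: A] `*`` (fun=> [set: B]) = [set: A * B] by apply/seteqP; split.
by apply: eq_esum => -[].
Qed.

Lemma esum_flip (A B : countType) (F : A * B -> \bar R) : (forall e, (0 <= F e)%E) ->
  (\esum_(e in [set: A * B]) F e = \esum_(e in [set: B * A]) F (e.2, e.1))%E.
Proof.
move=> F0; apply: (@reindex_esum _ _ _ [set: B * A] [set: A * B] (fun e => (e.2, e.1))).
by split=> // [[? ?] [? ?] _ _ [-> ->]|[x y] _] //; exists (y, x).
Qed.

Lemma esum_swap (A B : countType) (F : A -> B -> \bar R) : (forall x y, (0 <= F x y)%E) ->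
  (\esum_(x in [set: A]) \esum_(y in [set: B]) F x y =
   \esum_(y in [set: B]) \esum_(x in [set: A]) F x y)%E.
Proof.
move=> F0; rewrite -(@esum_pair A B (fun e => F e.1 e.2))// esum_flip//.
exact: (@esum_pair B A (fun e => F e.2 e.1)).
Qed.

Lemma esum_delta (A : countType) (F : A -> R) x : (forall y, 0 <= F y) ->
  (\esum_(y in [set: A]) ((x == y)%:R * F y)%:E = (F x)%:E)%E.
Proof.
move=> F0; rewrite (@esum_fin _ _ [set x]) ?fsbig_set1 ?eqxx ?mul1r//.
  by move=> y; rewrite mulr_ge0.
by move=> y /= /eqP; rewrite eq_sym => /negPf ->; rewrite mul0r.
Qed.

End IteratedSums.

(** * Energy and degree of a product through [I] *)

Section ProductGraph.
Context {R : realType} {V1 V2 : countType} (G1 : @wgraph R V1) (G2 : @wgraph R V2).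
Context (I : set V2) (theta1 : V1 -> V1 -> R) (theta2 : V2 -> V2 -> R).
Context (graph1 : is_graph G1) (graph2 : is_graph G2) (I0 : I !=set0).
Context (fin2 : finite_set [set: V2]).
Let G := gprod G1 G2 I.
Let theta := theta_prod G1 G2 I theta1 theta2.

Let E1_ge0 x y : 0 <= weight G1 x y. Proof. by have [[h _] _ _ _ _] := graph1; exact: h. Qed.
Let E2_ge0 x y : 0 <= weight G2 x y. Proof. by have [[h _] _ _ _ _] := graph2; exact: h. Qed.
Let E1C x y : weight G1 x y = weight G1 y x. Proof. by have [[_ h] _ _ _ _] := graph1; exact: h. Qed.
Let E2C x y : weight G2 x y = weight G2 y x. Proof. by have [[_ h] _ _ _ _] := graph2; exact: h. Qed.
Let E1xx x : weight G1 x x = 0. Proof. by have [_ _ h _ _] := graph1; exact: h. Qed.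
Let E2xx x : weight G2 x x = 0. Proof. by have [_ _ h _ _] := graph2; exact: h. Qed.
Let m1_gt0 x : 0 < mass G1 x. Proof. by have [_ h _ _ _] := graph1; exact: h. Qed.
Let m2_gt0 x : 0 < mass G2 x. Proof. by have [_ h _ _ _] := graph2; exact: h. Qed.

Lemma indic01 y : 0 <= (\1_I y : R) <= 1.
Proof. by rewrite indicE; case: (_ \in _); rewrite lexx ler01. Qed.

(** For connectedness: horizontal steps exist only over [I], so a path goes vertically to a level
    [y0] of [I], horizontally at that level, then vertically again. *)
Lemma gprod_graph : is_graph G.
Proof.
split=> /=.
- split=> [p q|p q].
    have /andP[i0 _] := indic01 p.2.
    by rewrite addr_ge0// ?mulr_ge0.
  rewrite E1C E2C [q.2 == p.2]eq_sym [q.1 == p.1]eq_sym; congr (_ + _).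
  by case: eqP => [->//|_]; rewrite !mulr0 !mul0r.
- by move=> p; rewrite mulr_gt0.
- by move=> p; rewrite E1xx E2xx !mul0r mulr0 addr0.
- move=> p; have [_ _ _ /(_ p.1) f1 _] := graph1.
  apply: (@sub_finite_set _ _ (([set x | adj G1 p.1 x] `|` [set p.1]) `*` [set: V2])).
    move=> q; rewrite /adj /= => pq; split=> //.
    have [->|ne] := eqVneq q.1 p.1; [by right|left].
    move: pq; rewrite [p.1 == _]eq_sym (negPf ne) mul0r addr0 => pq.
    rewrite /adj /= lt_neqAle E1_ge0 andbT eq_sym; apply: contraTneq pq => ->.
    by rewrite !mul0r ltxx.
  by apply: finite_setX => //; rewrite finite_setU; split.
- have [y0 Iy0] := I0.
  have [_ _ _ _ c1] := graph1; have [_ _ _ _ c2] := graph2.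
  have h1 : {homo (fun x => (x, y0)) : x x' / adj G1 x x' >-> adj G x x'}.
    move=> x x' xx'; rewrite /adj /= eqxx mulr1 indicE mem_set// mulr1.
    by rewrite ltr_pwDl// mulr_ge0.
  have h2 x : {homo (fun y => (x, y)) : y y' / adj G2 y y' >-> adj G y y'}.
    move=> y y' yy'; rewrite /adj /= eqxx mul1r ltr_wpDl// !mulr_ge0//.
  move=> [x y] [x' y'].
  have [p2 pp2 lp2] := c2 y y0; have [p1 pp1 lp1] := c1 x x'; have [p3 pp3 lp3] := c2 y0 y'.
  exists (map (fun y => (x, y)) p2 ++ (map (fun x => (x, y0)) p1 ++ map (fun y => (x', y)) p3)).
    rewrite !cat_path (homo_path (h2 x) pp2)/=.
    rewrite (last_map (fun y => (x, y))) lp2 (homo_path h1 pp1)/=.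
    by rewrite (last_map (fun x => (x, y0))) lp1 (homo_path (h2 x') pp3).
  by rewrite !last_cat (last_map (fun y => (x, y))) lp2 (last_map (fun x => (x, y0))) lp1 last_map lp3.
Qed.

Definition slice (f : V1 * V2 -> R[i]) (x : V1) (y : V2) : R[i] := f (x, y).

Let horizontal (f : V1 * V2 -> R[i]) (e : (V1 * V2) * (V1 * V2)) : R :=
  weight G1 e.1.1 e.2.1 * (e.1.2 == e.2.2)%:R * \1_I e.1.2 / 2 *
    sq (mgrad (fun p q => theta1 p.1 q.1) f e.1 e.2).

Let vertical (f : V1 * V2 -> R[i]) (e : (V1 * V2) * (V1 * V2)) : R :=
  (e.1.1 == e.2.1)%:R * (weight G2 e.1.2 e.2.2 / 2 *
    sq (mgrad (fun p q => theta2 p.2 q.2) f e.1 e.2)).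

Let horizontal_ge0 f e : 0 <= horizontal f e.
Proof.
have /andP[i0 _] := indic01 e.1.2.
by rewrite /horizontal !mulr_ge0 ?sq_ge0.
Qed.

Let vertical_ge0 f e : 0 <= vertical f e.
Proof. by rewrite /vertical !mulr_ge0 ?sq_ge0. Qed.

(** Without loops, an edge of the product changes exactly one coordinate, and there the product
    potential is [theta1] or [theta2]. Elsewhere both weights vanish, so the values of the
    potentials are immaterial. *)
Lemma gprod_energy f : sqnorm (edge_mass G) (nabla theta f) =
  (\esum_(e in [set: (V1 * V2) * (V1 * V2)]) (horizontal f e)%:E +
   \esum_(e in [set: (V1 * V2) * (V1 * V2)]) (vertical f e)%:E)%E.
Proof.
rewrite -esumD; try by move=> e _; rewrite lee_fin.
rewrite sqnormE; apply: eq_esum => -[[x y] [x' y']] _.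
rewrite -EFinD; congr (_%:E).
rewrite /msq /edge_mass /nabla /horizontal /vertical /mgrad /theta /theta_prod /=.
have [<-|xx] := eqVneq x x'; have [<-|yy] := eqVneq y y'.
- by rewrite E1xx E2xx !(mul0r, mulr0, addr0).
- rewrite !(mul0r, mulr0, mul1r, add0r).
  by case: eqP => [->|_] //; rewrite !mul0r.
- rewrite !(mul0r, mulr0, mulr1, addr0).
  by case: eqP => [->|_] //; rewrite !mul0r.
- by rewrite !(mul0r, mulr0, mulr1, addr0).
Qed.

Lemma vertical_energy f : (\esum_(e in [set: (V1 * V2) * (V1 * V2)]) (vertical f e)%:E =
  \esum_(x in [set: V1]) sqnorm (edge_mass G2) (nabla theta2 (slice f x)))%E.
Proof.
rewrite esum_pair => [|e]; last by rewrite lee_fin.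
rewrite esum_pair => [|p]; last by apply: esum_ge0 => q _; rewrite lee_fin.
apply: eq_esum => x _; rewrite sqnormE esum_pair => [|e]; last first.
  by rewrite lee_fin msq_ge0// => e'; rewrite divr_ge0.
apply: eq_esum => y _; rewrite esum_pair => [|e]; last by rewrite lee_fin.
rewrite esum_swap => [|x' y']; last by rewrite lee_fin.
apply: eq_esum => y' _.
rewrite (@esum_delta R V1 (fun x' => weight G2 y y' / 2 *
  sq (mgrad (fun p q => theta2 p.2 q.2) f (x, y) (x', y'))))// => x'.
by rewrite mulr_ge0 ?sq_ge0// divr_ge0.
Qed.

Lemma esum_deg (V : countType) (H : @wgraph R V) x : is_graph H ->
  (\esum_(y in [set: V]) (weight H x y)%:E = (mass H x * deg H x)%:E)%E.
Proof.
move=> [[w0 _] m0 _ lf _]; rewrite (@esum_fin _ _ [set y | adj H x y])//; last first.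
  by move=> y /negP; rewrite /adj -leNgt => h; apply/eqP; rewrite eq_le h w0.
rewrite /deg mulrA mulfV ?gt_eqF// mul1r; congr (_%:E).
apply: fsbig_widen => // y [_ /= /negP]; rewrite /adj -leNgt => h.
by apply/eqP; rewrite eq_le h w0.
Qed.

(** Each term is at most the weight times [sq (f p) + sq (f q)] for the ends [p] and [q]. Summing
    the weights at one end [(x, y)] gives [mass G1 x * deg G1 x], at most [K] times the product
    mass; the two ends account for [2 * K]. *)
Lemma horizontal_energy f (K : R) : 0 <= K ->
  (forall x y, deg G1 x <= K * mass G2 y) ->
  (\esum_(e in [set: (V1 * V2) * (V1 * V2)]) (horizontal f e)%:E <=
   (2 * K)%:E * sqnorm (mass G) f)%E.
Proof.
move=> K0 degK.
pose F (e : (V1 * V2) * (V1 * V2)) : R :=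
  (e.1.2 == e.2.2)%:R * (weight G1 e.1.1 e.2.1 * sq (f e.1)).
have F0 e : 0 <= F e by rewrite !mulr_ge0 ?sq_ge0.
have Fsum : (\esum_(e in [set: (V1 * V2) * (V1 * V2)]) (F e)%:E <= K%:E * sqnorm (mass G) f)%E.
  rewrite sqnormE -esumZ//; last by move=> p; rewrite mulr_ge0 ?sq_ge0// mulr_ge0 ?ltW.
  rewrite esum_pair => [|e]; last by rewrite lee_fin.
  apply: le_esum => -[x y] _; rewrite esum_pair => [|e]; last by rewrite lee_fin.
  rewrite (eq_esum (b := fun x' => (sq (f (x, y)) * weight G1 x x')%:E)); last first.
    move=> x' _; rewrite (@esum_delta R V2 (fun y' => weight G1 x x' * sq (f (x, y)))) 1?mulrC// => _.
    by rewrite mulr_ge0 ?sq_ge0.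
  rewrite esumZ ?sq_ge0// esum_deg// -EFinM lee_fin /msq /= mulrC mulrA.
  apply: ler_wpM2r; first exact: sq_ge0.
  by rewrite [leRHS]mulrCA; apply: ler_wpM2l; [exact: ltW|exact: degK].
have -> : ((2 * K)%:E * sqnorm (mass G) f = K%:E * sqnorm (mass G) f + K%:E * sqnorm (mass G) f)%E.
  rewrite -[2]/(1 + 1) mulrDl mul1r EFinD ge0_muleDl ?lee_fin//.
apply: (@le_trans _ _ (\esum_(e in [set: (V1 * V2) * (V1 * V2)]) ((F e)%:E + (F (e.2, e.1))%:E))%E).
  apply: le_esum => -[[x y] [x' y']] _; rewrite -EFinD lee_fin /horizontal /F /=.
  rewrite [y' == y]eq_sym [weight G1 x' x]E1C; case: eqP => [<-|_]; last first.
    by rewrite !(mulr0, mul0r) addr0.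
  rewrite !mul1r mulr1 -mulrDr /mgrad /=.
  have /andP[i0 i1] := indic01 y.
  set w := expi _; have h := sqD_le (f (x, y)) (- (w * f (x', y))).
  rewrite sqN sqM sq_expi mul1r in h.
  have s0 := sq_ge0 (f (x, y) - w * f (x', y)).
  rewrite -!mulrA; apply: ler_wpM2l => //.
  apply: (@le_trans _ _ (2^-1 * sq (f (x, y) - w * f (x', y)))).
    by rewrite ler_piMl// mulr_ge0.
  by rewrite mulrC ler_pdivrMr//; lra.
rewrite esumD; try by move=> e _; rewrite lee_fin.
apply: leeD => //; rewrite -(@esum_flip R _ _ (fun e => (F e)%:E)); last first.
  by move=> e; rewrite lee_fin.
exact: Fsum.
Qed.

Lemma gprod_deg d x y : deg G2 y = d ->
  deg G (x, y) = deg G1 x * \1_I y / mass G2 y + d / mass G1 x.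
Proof.
move=> dy; have gG := gprod_graph.
have mG : 0 < mass G (x, y) by rewrite mulr_gt0.
apply: (mulfI (lt0r_neq0 mG)); apply: EFin_inj; rewrite -esum_deg//.
have /andP[i0 _] := indic01 y.
rewrite (eq_esum (b := fun q => ((y == q.2)%:R * (\1_I y * weight G1 x q.1))%:E +
   ((x == q.1)%:R * weight G2 y q.2)%:E)%E); last first.
  move=> q _; rewrite -EFinD /=; congr (_ + _)%:E.
  by rewrite -mulrA mulrC -mulrA.
rewrite esumD; try by move=> q _; rewrite lee_fin !mulr_ge0.
have -> : (mass G (x, y) * (deg G1 x * \1_I y / mass G2 y + d / mass G1 x))%:E =
   ((\1_I y * (mass G1 x * deg G1 x))%:E + (mass G2 y * d)%:E)%E.
  rewrite -EFinD; congr (_%:E) => /=.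
  have := m1_gt0 x; have := m2_gt0 y => /lt0r_neq0 h2 /lt0r_neq0 h1.
  by field; rewrite h1 h2.
congr (_ + _)%E.
  rewrite esum_pair => [|q]; last by rewrite lee_fin !mulr_ge0.
  rewrite EFinM -esum_deg// -esumZ//; apply: eq_esum => x' _.
  by rewrite (@esum_delta R V2 (fun=> \1_I y * weight G1 x x'))// => _; rewrite mulr_ge0.
rewrite esum_pair => [|q]; last by rewrite lee_fin !mulr_ge0.
rewrite esum_swap => [|x' y']; last by rewrite lee_fin !mulr_ge0.
rewrite -dy -esum_deg//; apply: eq_esum => y' _.
exact: (@esum_delta R V1 (fun=> weight G2 y y')).
Qed.

End ProductGraph.

(** * Counting functions on a product *)

Lemma big_fset_ord (T : Type) (idx : T) (op : Monoid.com_law idx) N (F : 'I_N -> T) :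
  \big[op/idx]_(k <- finmap.enum_fset (fset_set [set: 'I_N])) F k = \big[op/idx]_(k < N) F k.
Proof.
apply: perm_big; apply: uniq_perm; rewrite ?index_enum_uniq ?finmap.fset_uniq// => k.
by rewrite mem_index_enum in_fset_set ?in_setT//; exact: finite_finset.
Qed.

Lemma esum_ord (R : realType) N (F : 'I_N -> R) : (forall k, 0 <= F k) ->
  (\esum_(k in [set: 'I_N]) (F k)%:E)%E = (\sum_k F k)%:E.
Proof.
have fin : finite_set [set: 'I_N] by exact: finite_finset.
move=> F0; rewrite (@esum_fin R _ [set: 'I_N])//; last by move=> k /(_ Logic.I).
by congr (_%:E); rewrite fsbig_finite//; exact: big_fset_ord.
Qed.

Section ProductSublevels.
Context {R : realType} {A B : countType} (p : A -> R) (la : B -> R).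
Hypothesis finB : finite_set [set: B].
Hypothesis la0 : forall b, 0 < la b.
Hypothesis p_finite : forall t, finite_set [set x | p x <= t].

Lemma product_sublevel_finite t : finite_set [set w : A * B | la w.2 * p w.1 <= t].
Proof.
apply: (@sub_finite_set _ _ (\bigcup_(b in [set: B]) ([set x | p x <= t / la b] `*` [set: B]))).
  by move=> [x b] /= xb; exists b => //; split=> //=; rewrite ler_pdivlMr// mulrC.
by apply: bigcup_finite => // b _; exact: finite_setX.
Qed.

Lemma size_product_sublevel t : size (sublevel (fun w : A * B => la w.2 * p w.1) t) =
  (\sum_(b <- finmap.enum_fset (fset_set [set: B])) size (sublevel p (t / la b)))%N.
Proof.
pose s := [seq (x, b) | b <- finmap.enum_fset (fset_set [set: B]), x <- sublevel p (t / la b)].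
have -> : size (sublevel (fun w : A * B => la w.2 * p w.1) t) = size s.
  apply: perm_size; apply: uniq_perm; first exact: finmap.fset_uniq.
    apply: allpairs_uniq_dep => [|b _|]; try exact: finmap.fset_uniq.
    by move=> [b x] [b' x'] _ _ /= [-> ->].
  move=> [x b]; rewrite /sublevel in_fset_set; last exact: product_sublevel_finite.
  apply/idP/idP => [/set_mem /= h|].
    apply/allpairsPdep; exists b, x; split=> //; first by rewrite in_fset_set// inE.
    by rewrite in_fset_set//; apply/mem_set => /=; rewrite ler_pdivlMr// mulrC.
  move=> /allpairsPdep[b' [x' [_ + [-> ->]]]]; rewrite in_fset_set// => /set_mem /=.
  by rewrite ler_pdivlMr// mulrC => h; exact/mem_set.
by rewrite size_allpairs_dep sumnE big_map.
Qed.

End ProductSublevels.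

Section ProductCounting.
Context {R : realType} {V1 V2 : countType} (G1 : @wgraph R V1) (G2 : @wgraph R V2).
Context (I : set V2) (theta1 : V1 -> V1 -> R) (theta2 : V2 -> V2 -> R).
Context (graph1 : is_graph G1) (graph2 : is_graph G2) (I0 : I !=set0).
Context (fin2 : finite_set [set: V2]).
Context (K d : R) (K0 : 0 <= K) (degK : forall x y, deg G1 x <= K * mass G2 y).
Context (mass1_le1 : forall x, mass G1 x <= 1).
Context (mass1_finite : forall t, finite_set [set x | (mass G1 x)^-1 <= t]).
Context (d0 : 0 <= d) (deg2 : forall y, deg G2 y = d).
Context (N : nat) (la : 'I_N -> R) (psi : 'I_N -> V2 -> R[i]).
Context (psi_ortho : forall j k, inner (mass G2) (psi j) (psi k) = (j == k)%:R).
Context (psi_parseval : forall g, sqnorm (mass G2) g = (\sum_j sq (inner (mass G2) g (psi j)))%:E).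
Context (psi_energy : forall g, sqnorm (edge_mass G2) (nabla theta2 g) =
  (\sum_j la j * sq (inner (mass G2) g (psi j)))%:E).
Context (la0 : forall j, 0 < la j).

Let G := gprod G1 G2 I.
Let theta := theta_prod G1 G2 I theta1 theta2.
Let m := mass G.
(** With this weight, [wmul m p] is just [mass G2] on every slice: the mass of [G1], which tends to
    zero, cancels, and each slice counts equally, as in the vertical energy. *)
Let p (v : V1 * V2) : R := (mass G1 v.1)^-1.
Let phi (w : V1 * 'I_N) (f : V1 * V2 -> R[i]) : R[i] := inner (mass G2) (slice f w.1) (psi w.2).
Let b (w : V1 * 'I_N) (v : V1 * V2) : R[i] := (v.1 == w.1)%:R * psi w.2 v.2.

Let m1_gt0 x : 0 < mass G1 x. Proof. by have [_ h _ _ _] := graph1; exact: h. Qed.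
Let m2_gt0 x : 0 < mass G2 x. Proof. by have [_ h _ _ _] := graph2; exact: h. Qed.
Let graphG : is_graph G. Proof. exact: gprod_graph. Qed.
Let m_gt0 v : 0 < m v. Proof. by have [_ h _ _ _] := graphG; exact: h. Qed.
Let m_ge0 v : 0 <= m v. Proof. exact: ltW. Qed.
Let p_ge1 v : 1 <= p v. Proof. by rewrite invf_ge1. Qed.

Let p_finite t : finite_set [set v | p v <= t].
Proof.
by apply: (@sub_finite_set _ _ ([set x | (mass G1 x)^-1 <= t] `*` [set: V2])) => //; exact: finite_setX.
Qed.

Let sum_la_ge0 (F : 'I_N -> R[i]) : 0 <= \sum_j la j * sq (F j).
Proof. by apply: sumr_ge0 => j _; rewrite mulr_ge0 ?sq_ge0// ltW. Qed.

Let sum_sq_ge0 (F : 'I_N -> R[i]) : 0 <= \sum_j sq (F j).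
Proof. by apply: sumr_ge0 => j _; exact: sq_ge0. Qed.

(** Parseval in the fibre, slice by slice. The factor [c] is [mass G1] for the norm of the product
    and [1] for the norm with weight [p]. *)
Lemma sqnorm_slices (c : V1 -> R) f : (forall x, 0 <= c x) ->
  sqnorm (fun v => c v.1 * mass G2 v.2) f =
  (\esum_(x in [set: V1]) (c x * \sum_k sq (phi (x, k) f))%:E)%E.
Proof.
move=> c0; rewrite sqnormE esum_pair => [|v]; last first.
  by rewrite lee_fin msq_ge0// => v'; rewrite mulr_ge0// ltW.
apply: eq_esum => x _; rewrite EFinM.
have -> : (\sum_k sq (phi (x, k) f))%:E = sqnorm (mass G2) (slice f x) by rewrite psi_parseval.
rewrite sqnormE -esumZ//; last first.
  by move=> y; rewrite msq_ge0// => y'; exact: ltW.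
by apply: eq_esum => y _; rewrite /msq /= mulrA.
Qed.

Lemma sqnorm_coefficients f :
  sqnorm m f = (\esum_(w in [set: V1 * 'I_N]) (mass G1 w.1 * sq (phi w f))%:E)%E.
Proof.
rewrite [LHS](sqnorm_slices f (fun x => ltW (m1_gt0 x))) esum_pair => [|w]; last first.
  by rewrite lee_fin mulr_ge0 ?sq_ge0// ltW.
apply: eq_esum => x _; rewrite esum_ord => [|k]; last by rewrite mulr_ge0 ?sq_ge0// ltW.
by rewrite mulr_sumr.
Qed.

Lemma sqnorm_plus f : sqnorm (wmul m p) f =
  (\esum_(x in [set: V1]) (\sum_k sq (phi (x, k) f))%:E)%E.
Proof.
have -> : wmul m p = (fun v => 1 * mass G2 v.2).
  apply: funext => v; rewrite /wmul /m /p /= mul1r mulrAC mulfV ?mul1r// gt_eqF//.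
rewrite [LHS](sqnorm_slices (c := fun=> 1) f (fun=> ler01)).
by apply: eq_esum => x _; rewrite mul1r.
Qed.

Let vertical_sum f : (\esum_(x in [set: V1]) sqnorm (edge_mass G2) (nabla theta2 (slice f x)) =
  \esum_(x in [set: V1]) (\sum_k la k * sq (phi (x, k) f))%:E)%E.
Proof. by apply: eq_esum => x _; rewrite psi_energy. Qed.

Lemma energy_lower f :
  (\esum_(x in [set: V1]) (\sum_k la k * sq (phi (x, k) f))%:E <=
   sqnorm (edge_mass G) (nabla theta f))%E.
Proof.
rewrite gprod_energy// vertical_energy// vertical_sum leeDr//.
apply: esum_ge0 => e _; rewrite lee_fin.
by have /andP[i0 _] := @indic01 R V2 I e.1.2; have [[w0 _] _ _ _ _] := graph1; rewrite !mulr_ge0 ?sq_ge0.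
Qed.

Lemma energy_upper f :
  (sqnorm (edge_mass G) (nabla theta f) <=
   \esum_(x in [set: V1]) (\sum_k la k * sq (phi (x, k) f))%:E + (2 * K)%:E * sqnorm m f)%E.
Proof.
rewrite gprod_energy// vertical_energy// vertical_sum addeC leeD2l//.
exact: horizontal_energy.
Qed.

Let bounds : exists c0 c1 : R, [/\ 0 < c0, 0 <= c1, forall k, c0 <= la k & forall k, la k <= c1].
Proof.
exists (\big[Num.min/1]_k la k), (\sum_k la k); split.
- by elim/big_ind: _ => // x y x0 y0; rewrite lt_min x0 y0.
- by apply: sumr_ge0 => k _; exact: ltW.
- by move=> k; rewrite (bigD1 k)//= ge_min lexx.
- move=> k; rewrite (bigD1 k)//= lerDl; apply: sumr_ge0 => j _; exact: ltW.
Qed.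

(** Coercivity is a lower bound on the [la k], that is, an effect of the nontrivial holonomy. In the
    upper bound the horizontal part is absorbed because [mass G1 <= 1] makes the weighted norm
    dominate the norm of the product. *)
Let form_bounds : exists c0 C0 : R, [/\ 0 < c0,
  forall f, (c0%:E * sqnorm (wmul m p) f <= sqnorm (edge_mass G) (nabla theta f))%E &
  forall f, (sqnorm (edge_mass G) (nabla theta f) <= C0%:E * sqnorm (wmul m p) f)%E].
Proof.
have [c0 [c1 [c00 c10 c0la lac1]]] := bounds.
exists c0, (c1 + 2 * K); split=> // f.
  apply: le_trans (energy_lower f); rewrite sqnorm_plus -esumZ ?(ltW c00)//.
  apply: le_esum => x _; rewrite lee_fin mulr_sumr; apply: ler_sum => k _.
  by rewrite ler_wpM2r ?sq_ge0.
apply: (le_trans (energy_upper f)); rewrite EFinD ge0_muleDl ?lee_fin ?mulr_ge0//.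
apply: leeD.
  rewrite sqnorm_plus -esumZ//.
  apply: le_esum => x _; rewrite lee_fin mulr_sumr; apply: ler_sum => k _.
  by rewrite ler_wpM2r ?sq_ge0.
by rewrite lee_wpmul2l ?lee_fin ?mulr_ge0// sqnorm_le_plus.
Qed.

Lemma product_compact_resolvent : compact_resolvent m (magnetic_laplacian G theta).
Proof.
have [c0 [C0 [c00 lo up]]] := form_bounds.
exact: (laplacian_compact_resolvent graphG p_ge1 p_finite c00 lo up).
Qed.

Let inner_fin (f g : V2 -> R[i]) : inner (mass G2) f g =
  \sum_(y <- finmap.enum_fset (fset_set [set: V2])) (mass G2 y)%:C * f y * conjc (g y).
Proof.
by rewrite /inner (@csum_fin R V2 [set: V2]) ?fsbig_finite// => y /(_ Logic.I).
Qed.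

Let phi_linear w n (c : 'I_n -> R[i]) (f : 'I_n -> V1 * V2 -> R[i]) :
  phi w (fun v => \sum_(j < n) c j * f j v) = \sum_(j < n) c j * phi w (f j).
Proof.
rewrite /phi inner_fin; under [RHS]eq_bigr => j _ do rewrite inner_fin mulr_sumr.
rewrite exchange_big /=; apply: eq_bigr => y _; rewrite /slice mulr_sumr mulr_suml.
by apply: eq_bigr => j _; ring.
Qed.

Let phi_b w w' : phi w (b w') = (w == w')%:R.
Proof.
case: w w' => x k [x' k']; rewrite /phi /= xpair_eqE.
have -> : slice (b (x', k')) x = (fun y => (x == x')%:R * psi k' y) by [].
case: eqP => /= _.
  rewrite (_ : (fun y => _) = psi k') ?psi_ortho 1?eq_sym//.
  by apply: funext => y; rewrite mul1r.
by rewrite inner_fin big1// => y _; rewrite mul0r mulr0 mul0r.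
Qed.

Let combo_Cc n (c : 'I_n -> R[i]) (w : 'I_n -> V1 * 'I_N) :
  Cc (fun v => \sum_(i < n) c i * b (w i) v).
Proof.
apply: (@sub_finite_set _ _ (((fun i => (w i).1) @` [set: 'I_n]) `*` [set: V2])).
  move=> v /= nz; split=> //=; apply: contrapT => h; move/eqP: nz; apply.
  rewrite big1// => i _; rewrite /b; case: eqP => [vi|_]; last by rewrite mul0r mulr0.
  by exfalso; apply: h; exists i.
by apply: finite_setX => //; exact: finite_image.
Qed.

Let b_ell2 w : ell2 m (b w).
Proof.
apply: (ell2_fin m_ge0); have := @combo_Cc 1 (fun=> 1) (fun=> w).
by rewrite (_ : (fun v => _) = b w)//; apply: funext => v; rewrite big_ord1 mul1r.
Qed.

Let q (w : V1 * 'I_N) : R := la w.2 * (mass G1 w.1)^-1.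

Let q_sum f : (\esum_(w in [set: V1 * 'I_N]) (q w * (mass G1 w.1 * sq (phi w f)))%:E =
  \esum_(x in [set: V1]) (\sum_k la k * sq (phi (x, k) f))%:E)%E.
Proof.
have e w : q w * (mass G1 w.1 * sq (phi w f)) = la w.2 * sq (phi w f).
  by rewrite /q -mulrA mulKf// gt_eqF.
rewrite esum_pair => [|w]; last by rewrite lee_fin e mulr_ge0 ?sq_ge0// ltW.
apply: eq_esum => x _; rewrite esum_ord => [|k]; last by rewrite e mulr_ge0 ?sq_ge0// ltW.
by congr (_%:E); apply: eq_bigr => k _; rewrite e.
Qed.

(** The diagonal model acts on the coefficients of the slices along [psi], with entries
    [la k / mass G1 x]. The horizontal energy is the perturbation, with [C = 2 * K]. *)
Lemma laplacian_counting (l : R) : 1 + 2 * K <= l ->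
  (\sum_k size (sublevel (fun x => (mass G1 x)^-1) ((l - 1 - 2 * K) / la k)))%:R <=
    fine (counting_function m (magnetic_laplacian G theta) l) <=
  (\sum_k size (sublevel (fun x => (mass G1 x)^-1) ((l + 1) / la k)))%:R.
Proof.
move=> lK; have [c0 [C0 [c00 lo up]]] := form_bounds.
have sumN t : (\sum_k size (sublevel (fun x => (mass G1 x)^-1) (t / la k)) = size (sublevel q t))%N.
  rewrite -[LHS]big_fset_ord; apply/esym.
  apply: (@size_product_sublevel R V1 'I_N (fun x => (mass G1 x)^-1) la) => //.
  exact: finite_finset.
rewrite !sumN; apply: (@counting_coefficients R _ _ m m_gt0 (magnetic_laplacian G theta) phi b q
  (fun w => mass G1 w.1) (2 * K)) => //.
- exact: (laplacian_spectral_measure graphG p_ge1 p_finite c00 lo up).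
- by move=> f h [[]].
- by move=> n c w; exact: (laplacian_Cc graphG p_ge1 c00 lo up (combo_Cc c w)).
- by move=> w; exact: ltW.
- by move=> w; rewrite mulr_ge0 ?invr_ge0 ?ltW.
- exact: sqnorm_coefficients.
- move=> f h Th; rewrite (laplacian_energy graphG p_ge1 c00 lo up Th) q_sum; exact: energy_lower.
- move=> f h Th; rewrite (laplacian_energy graphG p_ge1 c00 lo up Th) q_sum EFinM.
  rewrite -sqnorm_fin//; first exact: energy_upper.
  by case: Th => [[]].
- apply: (@product_sublevel_finite R V1 'I_N (fun x => (mass G1 x)^-1) la) => //.
  exact: finite_finset.
- by rewrite mulr_ge0.
Qed.

Let qd_ge0 x : 0 <= d * (mass G1 x)^-1.
Proof. by apply: mulr_ge0 => //; rewrite invr_ge0 ltW. Qed.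

(** The slack [2 * K], where [K] would do, gives the degree the same shifts as the Laplacian. *)
Let deg_bounds v : d * (mass G1 v.1)^-1 <= deg G v <= d * (mass G1 v.1)^-1 + 2 * K.
Proof.
case: v => x y; rewrite (gprod_deg graph1 graph2 I0 fin2 x (deg2 y)) /=.
have /andP[i0 i1] := @indic01 R V2 I y.
have dx : 0 <= deg G1 x.
  rewrite -(pmulr_rge0 _ (m1_gt0 x)) -lee_fin -esum_deg//; apply: esum_ge0 => x' _.
  by have [[w0 _] _ _ _ _] := graph1; rewrite lee_fin.
apply/andP; split.
  by rewrite lerDr divr_ge0 ?(ltW (m2_gt0 _))// mulr_ge0.
rewrite addrC lerD2l ler_pdivrMr//.
apply: (@le_trans _ _ (deg G1 x)); first by rewrite ler_piMr.
apply: (le_trans (degK x y)); rewrite ler_wpM2r ?(ltW (m2_gt0 y))//.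
by rewrite mulr2n mulrDl mul1r lerDl.
Qed.

Let deg_energy f h : deg_op G f h -> (complex.Re (inner m h f))%:E =
  (\esum_(v in [set: V1 * V2]) (deg G v * msq m f v)%:E)%E.
Proof.
move=> [f2 h2 hE].
have deg0 v : 0 <= deg G v.
  by have /andP[h0 _] := deg_bounds v; apply: le_trans h0.
have e v : (m v)%:C * h v * conjc (f v) = (deg G v * msq m f v)%:C.
  rewrite hE mulrCA -mulrA -[X in _ = X%:C]mulrCA /msq !rmorphM /= -mulJ; ring.
have u0 v : 0 <= deg G v * msq m f v by rewrite mulr_ge0 ?msq_ge0.
have su : summ (fun v => deg G v * msq m f v).
  have := csumm_Re (inner_summ m_ge0 h2 f2).
  by rewrite (_ : (fun v => complex.Re _) = (fun v => deg G v * msq m f v))//;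
    apply: funext => v; rewrite ?num_conjE e.
rewrite /inner (_ : (fun x => _) = (fun v => (deg G v * msq m f v)%:C)).
  by rewrite csum_real// summ_fin.
by apply: funext => v; rewrite ?num_conjE e.
Qed.

(** The same scheme with point evaluations as coordinates and entries [d / mass G1 x], repeated over
    every vertex of the fibre. *)
Lemma degree_counting (l : R) : 0 < d -> 1 + 2 * K <= l ->
  (size (@vertices V2) * size (sublevel (fun x => (mass G1 x)^-1) ((l - 1 - 2 * K) / d)))%:R <=
    fine (counting_function m (deg_op G) l) <=
  (size (@vertices V2) * size (sublevel (fun x => (mass G1 x)^-1) ((l + 1) / d)))%:R.
Proof.
move=> d_gt0 lK.
pose qd (v : V1 * V2) : R := d * (mass G1 v.1)^-1.
have sumN t : (size (@vertices V2) * size (sublevel (fun x => (mass G1 x)^-1) (t / d)) =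
    size (sublevel qd t))%N.
  have := @size_product_sublevel R V1 V2 (fun x => (mass G1 x)^-1) (fun=> d) fin2 (fun=> d_gt0) mass1_finite t.
  by rewrite -[in X in X = _]/qd => ->; rewrite big_const_seq count_predT iter_addn_0 mulnC.
have norm f v : msq m f v = m v * sq (f v) by [].
have fin_norm f (c : R) : 0 <= c -> ell2 m f -> ((c * N2 m f)%:E = \esum_(v in [set: V1 * V2]) (c * msq m f v)%:E)%E.
  by move=> c0' f2; rewrite esumZ ?EFinM -?sqnormE ?(sqnorm_fin m_ge0)// => v; exact: msq_ge0.
rewrite !sumN; apply: (@counting_coefficients R _ _ m m_gt0 (deg_op G) (fun v f => f v)
  (fun v => delta v 1) qd m (2 * K)) => //.
- apply: mult_op_spectral_measure => // v.
  by have /andP[h0 _] := deg_bounds v; apply: le_trans h0.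
- by move=> f h [].
- move=> n c w; set g := (fun x => \sum_(i < n) _).
  have gC : Cc g.
    apply: (@sub_finite_set _ _ (w @` [set: 'I_n])); last exact: finite_image.
    move=> v /= nz; apply: contrapT => h; move/eqP: nz; apply.
    rewrite /g big1// => i _; rewrite /delta; case: eqP => [vi|_]; last by rewrite mulr0.
    by exfalso; apply: h; exists i.
  exists (fun v => (deg G v)%:C * g v); split=> //; apply: (ell2_fin m_ge0) => //.
  apply: sub_finite_set gC => v /=; apply: contra => /eqP ->; by rewrite mulr0.
- by move=> v; apply: (ell2_fin m_ge0); exact: delta_fin.
- by move=> v v'; rewrite /delta; case: eqP.
- by move=> v; exact: qd_ge0.
- by move=> f; rewrite sqnormE.
- move=> f h Th; rewrite (deg_energy Th); apply: le_esum => v _.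
  by rewrite lee_fin ler_wpM2r ?msq_ge0//; have /andP[] := deg_bounds v.
- move=> f h Th; rewrite (deg_energy Th) fin_norm ?mulr_ge0//; last by case: Th.
  rewrite -esumD.
  + apply: le_esum => v _; rewrite -EFinD lee_fin -mulrDl ler_wpM2r ?msq_ge0//.
    by have /andP[] := deg_bounds v.
  + by move=> v _; rewrite lee_fin mulr_ge0 ?qd_ge0// mulr_ge0 ?sq_ge0.
  + by move=> v _; rewrite lee_fin mulr_ge0 ?msq_ge0 ?mulr_ge0.
- by apply: (@product_sublevel_finite R V1 V2 (fun x => (mass G1 x)^-1) (fun=> d)).
- by rewrite mulr_ge0.
Qed.

End ProductCounting.

(** * Asymptotics *)

Section Asymptotics.
Context {R : realType}.

Lemma cvg_inv_pinfty (f : R -> R) : f l @[l --> +oo] --> +oo -> (f l)^-1 @[l --> +oo] --> (0 : R).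
Proof.
move=> fy; apply/cvgrVy.
  by near=> l; rewrite invr_gt0; near: l; exact: cvgry_gt.
apply: cvg_trans fy; apply: near_eq_cvg; near=> l.
by rewrite /= invrK.
Unshelve. all: by end_near. Qed.

Lemma cvg_ln_pinfty : ln l @[l --> +oo] --> (+oo : set_system R).
Proof.
apply/cvgryPge => A; near=> l.
have lA : expR A <= l by near: l; exact: nbhs_pinfty_ge.
by rewrite -[A]expRK ler_ln ?posrE ?expR_gt0// (lt_le_trans _ lA) ?expR_gt0.
Unshelve. all: by end_near. Qed.

(** For large [l] the expression is [ln (1 + a / l) - ln b]. *)
Lemma cvg_ln_shift (a b : R) : 0 < b -> (ln ((l + a) / b) - ln l) @[l --> +oo] --> - ln b.
Proof.
move=> b0.
have h : (ln (1 + a * l^-1) - ln b) @[l --> +oo] --> - ln b.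
  rewrite -[X in _ --> X]add0r; apply: cvgB; last exact: cvg_cst.
  have h1 : 1 + a * l^-1 @[l --> +oo] --> (1 : R).
    rewrite -[X in _ --> X]addr0; apply: cvgD; first exact: cvg_cst.
    rewrite -(mulr0 a); apply: cvgM; first exact: cvg_cst.
    exact/cvg_inv_pinfty.
  rewrite -(@ln1 R); apply: (@cvg_comp _ _ _ (fun l : R => 1 + a * l^-1) (@ln R) _ (nbhs (1 : R))) => //.
  exact: continuous_ln.
apply: cvg_trans h; apply: near_eq_cvg; near=> l.
have l0 : 0 < l by near: l; exact: nbhs_pinfty_gt.
have la : 0 < l + a by rewrite -ltrBlDr sub0r; near: l; apply: nbhs_pinfty_gt; exact: num_real.
rewrite ln_div ?posrE// addrAC; congr (_ - _).
rewrite -ln_div ?posrE//; congr ln.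
by rewrite mulrDl mulfV ?gt_eqF.
Unshelve. all: by end_near. Qed.

(* For [s > 0], [gr l = l ^ s]; for [s = 0] the growth is logarithmic. *)
Lemma growth_function (s : R) : 0 <= s -> exists (Phi : nat -> R) (gr : R -> R), [/\
  forall k, 1 <= Phi k,
  forall k t, 1 <= t -> (Phi k <= t) = (k.+1%:R <= gr t),
  forall t, 1 <= t -> 0 <= gr t,
  gr l @[l --> +oo] --> +oo &
  forall a b, 0 < b -> gr ((l + a) / b) / gr l @[l --> +oo] --> expR (- s * ln b)].
Proof.
rewrite le_eqVlt => /orP[/eqP <-|s0].
  have gy : 1 + ln l @[l --> +oo] --> (+oo : set_system R).
    apply/cvgryPge => A; near=> l; rewrite -lerBlDl.
    by near: l; move/cvgryPge: cvg_ln_pinfty; apply.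
  (* The [1 +] matches the index shift: [exp k <= t] if and only if [k + 1 <= 1 + ln t]. Logarithmic
     growth makes the ratios tend to [1], which is [b ^ (- s)] at [s = 0]. *)
  exists (fun k => expR k%:R), (fun t => 1 + ln t); split=> //.
  - by move=> k; rewrite -expR0 ler_expR.
  - move=> k t t1; have t0 : 0 < t by exact: lt_le_trans t1.
    rewrite -natr1 addrC lerD2l -[k%:R in RHS]expRK ler_ln ?posrE// expR_gt0//.
  - by move=> t t1; rewrite addr_ge0// ln_ge0.
  - move=> a b b0; rewrite oppr0 mul0r expR0.
    have h : 1 + (ln ((l + a) / b) - ln l) * (1 + ln l)^-1 @[l --> +oo] --> (1 : R).
      rewrite -[X in _ --> X]addr0; apply: cvgD; first exact: cvg_cst.
      rewrite -(mulr0 (- ln b)); apply: cvgM; first exact: cvg_ln_shift.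
      exact: cvg_inv_pinfty.
    apply: cvg_trans h; apply: near_eq_cvg; near=> l.
    have g0 : 0 < 1 + ln l by near: l; move/cvgryPgt: gy; apply.
    by field; rewrite gt_eqF.
have gy : expR (s * ln l) @[l --> +oo] --> (+oo : set_system R).
  apply/cvgryPge => A; near=> l; apply: le_trans (expR_ge1Dx _).
  apply: (@le_trans _ _ (s * ln l)); last by rewrite lerDr.
  rewrite mulrC -ler_pdivrMr//.
  by near: l; move/cvgryPge: cvg_ln_pinfty; apply.
(* [Phi k] is [(k + 1) ^ (1 / s)], written with [expR] and [ln]; [gr] inverts it up to the index
   shift. *)
exists (fun k => expR (ln k.+1%:R / s)), (fun t => expR (s * ln t)); split=> //.
- move=> k; rewrite -[leLHS]expR0 ler_expR; apply: divr_ge0; last exact: ltW.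
  by apply: ln_ge0; rewrite ler1n.
- move=> k t t1; have t0 : 0 < t by exact: lt_le_trans t1.
  have k0 : (k.+1%:R : R) \is Num.pos by rewrite posrE ltr0n.
  rewrite -[t in LHS]lnK ?posrE// ler_expR ler_pdivrMr//.
  by rewrite -[k.+1%:R in RHS]lnK// ler_expR mulrC.
- move=> a b b0.
  have h : expR (s * (ln ((l + a) / b) - ln l)) @[l --> +oo] --> expR (- s * ln b).
    rewrite mulNr -mulrN.
    apply: (@cvg_comp _ _ _ (fun l : R => s * (ln ((l + a) / b) - ln l)) (@expR R) _ (nbhs (s * - ln b))).
      by apply: cvgM; [exact: cvg_cst|exact: cvg_ln_shift].
    exact: continuous_expR.
  apply: cvg_trans h; apply: near_eq_cvg; near=> l.
  by rewrite mulrBr expRD expRN.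
Unshelve. all: by end_near. Qed.

(** The count [c] is within [1] of [gr], so replacing it in the [N] terms costs at most [N / gr l],
    which vanishes. The shifts [a1] and [a2] disappear in the limit of the ratios, so both bounds
    have the same limit. *)
Lemma cvg_counting_over_growth (gr : R -> R) (c : R -> nat) (s : R) (N : nat)
    (mu : 'I_N -> R) (a1 a2 : R) (A : R -> R) :
  gr l @[l --> +oo] --> +oo ->
  (forall a b, 0 < b -> gr ((l + a) / b) / gr l @[l --> +oo] --> expR (- s * ln b)) ->
  (forall t, 1 <= t -> gr t - 1 <= (c t)%:R <= gr t) -> (forall k, 0 < mu k) ->
  (\forall l \near +oo, (\sum_k c ((l + a1) / mu k))%:R <= A l <= (\sum_k c ((l + a2) / mu k))%:R) ->
  A l / gr l @[l --> +oo] --> \sum_k expR (- s * ln (mu k)).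
Proof.
move=> gy grr cE mu0 cA.
have big1 a k : \forall l \near +oo, 1 <= (l + a) / mu k.
  near=> t; rewrite ler_pdivlMr// mul1r -lerBlDr.
  by near: t; apply: nbhs_pinfty_ge; exact: num_real.
have lim a : \sum_k gr ((l + a) / mu k) / gr l @[l --> +oo] --> \sum_k expR (- s * ln (mu k)).
  by apply: cvg_big => [|k _]; [exact: add_continuous|exact: grr].
apply: (@squeeze_cvgr _ _ _ _ (fun l => \sum_k gr ((l + a1) / mu k) / gr l - N%:R * (gr l)^-1)
  (fun l => \sum_k gr ((l + a2) / mu k) / gr l)); last exact: lim.
  near=> l.
  have g0 : 0 < gr l by near: l; move/cvgryPgt: gy; apply.
  have h1 : forall k, 1 <= (l + a1) / mu k.
    by near: l; apply: filter_forall => k; exact: big1.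
  have h2 : forall k, 1 <= (l + a2) / mu k.
    by near: l; apply: filter_forall => k; exact: big1.
  have /andP[lo up] : (\sum_k c ((l + a1) / mu k))%:R <= A l <= (\sum_k c ((l + a2) / mu k))%:R.
    by near: l.
  rewrite -!mulr_suml -mulrBl !ler_pM2r ?invr_gt0//; apply/andP; split.
    apply: le_trans lo; rewrite natr_sum -[N%:R]mulr1 -[N in N%:R]card_ord.
    rewrite mulr_natl -sumr_const -sumrB; apply: ler_sum => k _.
    by have /andP[] := cE _ (h1 k).
  apply: (le_trans up); rewrite natr_sum; apply: ler_sum => k _.
  by have /andP[] := cE _ (h2 k).
rewrite -[X in _ --> X]subr0; apply: cvgB; first exact: lim.
rewrite -(mulr0 N%:R); apply: cvgM; [exact: cvg_cst|exact: cvg_inv_pinfty].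
Unshelve. all: by end_near. Qed.

Lemma exponent_exists (N : nat) (d a : R) (la : 'I_N -> R) : 0 < d -> (forall k, 0 < la k) ->
  (exists k, la k < d) -> 1 <= a ->
  exists2 s, 0 <= s & (\sum_k expR (- s * ln (la k))) / (N%:R * expR (- s * ln d)) = a.
Proof.
move=> d0 la0 [k0 lk0] a1.
have N0 : 0 < N%:R :> R by rewrite ltr0n (leq_ltn_trans _ (ltn_ord k0)).
pose L k := ln d - ln (la k).
have L0 : 0 < L k0 by rewrite subr_gt0 ltr_ln ?posrE.
pose g s := \sum_k expR (s * L k).
have aN0 : 0 <= a * N%:R by rewrite mulr_ge0// (le_trans ler01).
have b0 : 0 <= a * N%:R / L k0 by rewrite divr_ge0// ltW.
have gc : continuous g.
  move=> s; apply: cvg_big => [|k _]; first exact: add_continuous.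
  apply: (@cvg_comp _ _ _ (fun s : R => s * L k) (@expR R) _ (nbhs (s * L k))).
    by apply: cvgM; [exact: cvg_id|exact: cvg_cst].
  exact: continuous_expR.
have g0 : g 0 = N%:R.
  by rewrite /g (eq_bigr (fun=> 1)) => [|k _]; rewrite ?mul0r ?expR0// sumr_const card_ord.
(* The function [g s] is the sum of the [(d / la k) ^ s]. At this end of the interval the term of
   index [k0] alone is [exp (a * N)], already above [a * N]; at [0] the sum is [N]. *)
have gb : a * N%:R <= g (a * N%:R / L k0).
  rewrite /g (bigD1 k0)//= mulfVK ?gt_eqF//; apply: (@le_trans _ _ (expR (a * N%:R))).
    by apply: le_trans (expR_ge1Dx _); rewrite lerDr.
  by rewrite lerDl; apply: sumr_ge0 => k _; exact: expR_ge0.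
have gN : g 0 <= a * N%:R by rewrite g0 ler_peMl// ltW.
have [|s] := @IVT R g 0 (a * N%:R / L k0) (a * N%:R) b0 (continuous_subspaceT gc).
  by rewrite ge_min gN/= le_max gb orbT.
rewrite in_itv /= => /andP[s0 _] gs; exists s => //.
have e : g s = (\sum_k expR (- s * ln (la k))) / expR (- s * ln d).
  rewrite mulr_suml; apply: eq_bigr => k _.
  by rewrite -expRN -expRD; congr expR; rewrite /L; ring.
have de : expR (- s * ln d) != 0 by rewrite gt_eqF ?expR_gt0.
apply: (mulIf (lt0r_neq0 N0)); rewrite -gs e; field.
by rewrite de lt0r_neq0.
Qed.

End Asymptotics.

(** * Reweighting *)

Lemma infinite_countable_bij (V : countType) : infinite_set [set: V] ->
  exists rho : V -> nat, bijective rho.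
Proof.
move=> /infiniteP Vinf; have Vc : countable [set: V] by exact: countableP.
have /card_set_bijP[rho rhoP] : ([set: V] #= [set: nat])%card by apply/card_eqPle.
by exists rho; rewrite -setTT_bijective.
Qed.

Section Reweighting.
Context {R : realType} {V : countType} (G : @wgraph R V) (graphG : is_graph G).
Context (m' : V -> R) (m'0 : forall x, 0 < m' x).

(* Scaling each edge by the smaller of the two mass ratios keeps the weights
   symmetric and does not increase the degree. *)
Definition reweight : wgraph V :=
  {| weight := fun x y => weight G x y * Num.min (m' x / mass G x) (m' y / mass G y);
     mass := m' |}.

Let w0 x y : 0 <= weight G x y. Proof. by have [[h _] _ _ _ _] := graphG; exact: h. Qed.
Let m0 x : 0 < mass G x. Proof. by have [_ h _ _ _] := graphG; exact: h. Qed.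
Let r0 x y : 0 < Num.min (m' x / mass G x) (m' y / mass G y).
Proof. by rewrite lt_min !divr_gt0. Qed.

Lemma reweight_adj : adj reweight = adj G.
Proof. by apply: funext => x; apply: funext => y; rewrite /adj /= pmulr_lgt0. Qed.

Lemma reweight_graph : is_graph reweight.
Proof.
have [[_ wC] _ wxx lf conn] := graphG.
split=> //=.
- by split=> [x y|x y]; [rewrite mulr_ge0// ltW|rewrite wC minC].
- by move=> x; rewrite wxx mul0r.
- by move=> x; rewrite reweight_adj.
- by rewrite reweight_adj.
Qed.

Lemma reweight_zero x y : weight G x y = 0 <-> weight reweight x y = 0.
Proof.
split=> /= [->|/eqP]; first by rewrite mul0r.
by rewrite mulf_eq0 [X in _ || X]gt_eqF// orbF => /eqP.
Qed.

Lemma reweight_deg x : deg reweight x <= deg G x.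
Proof.
rewrite -(ler_pM2l (m'0 x)) -lee_fin -(esum_deg x reweight_graph).
apply: (@le_trans _ _ (\esum_(y in [set: V]) ((m' x / mass G x) * weight G x y)%:E)%E).
  apply: le_esum => y _; rewrite lee_fin /= mulrC; apply: ler_wpM2r => //.
  by rewrite ge_min lexx.
rewrite esumZ ?divr_ge0 ?(ltW (m'0 x)) ?(ltW (m0 x))// esum_deg// -EFinM lee_fin.
by rewrite mulrA divfK// gt_eqF.
Qed.

End Reweighting.

Theorem corollary2p16 (R : realType) (V1 V2 : countType)
    (G1 : @wgraph R V1) (G2 : @wgraph R V2)
    (theta1 : V1 -> V1 -> R) (theta2 : V2 -> V2 -> R) (I : set V2)
    (graph1 : is_graph G1) (graph2 : is_graph G2)
    (V1_infinite : infinite_set [set: V1])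
    (potential1 : is_potential G1 theta1) (potential2 : is_potential G2 theta2)
    (I_nonempty : I !=set0)
    (cusp : discrete_cusp G1 G2)
    (deg2_constant : exists d : R, forall y, deg G2 y = d)
    (hol2 : ~ Hol_zero G2 theta2) :
  forall a : R, 1 <= a ->
    exists G1' : @wgraph R V1,
      let G' := gprod G1' G2 I in
      let theta := theta_prod G1' G2 I theta1 theta2 in
      is_graph G1' /\
      discrete_cusp G1' G2 /\
      (forall x y, weight G1 x y = 0 <-> weight G1' x y = 0) /\
      (forall x, deg G1' x <= deg G1 x) /\
      compact_resolvent (mass G') (magnetic_laplacian G' theta) /\
      fine (counting_function (mass G') (magnetic_laplacian G' theta) lambda) /
      fine (counting_function (mass G') (deg_op G') lambda)
        @[lambda --> +oo] --> a.
Proof.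
move=> a a1.
have [[base cusp_mass] fin2 [Dmax degD]] := cusp.
have [d dE] := deg2_constant.
have [N [la [psi [ortho parseval energy la0 [NE _ la_lt]]]]] :=
  finite_magnetic_spectrum graph2 potential2 fin2 dE hol2.
have d0 : 0 < d by have [k lk] := la_lt; exact: lt_trans (la0 k) lk.
have [s s0 sa] := exponent_exists d0 la0 la_lt a1.
have [Phi [gr [Phi1 Phi_gr gr0 gry grr]]] := growth_function s0.
have [rho rho_bij] := infinite_countable_bij V1_infinite.
have [rhoV rhoK rhoVK] := rho_bij.
pose m' x := (Phi (rho x))^-1.
have Phi_gt0 k : 0 < Phi k by exact: lt_le_trans (Phi1 k).
have m'0 x : 0 < m' x by rewrite invr_gt0.
pose G1' := reweight G1 m'.
have graph1' : is_graph G1' by exact: reweight_graph.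
have m'V x : (mass G1' x)^-1 = Phi (rho x) by rewrite /= invrK.
pose c t := size (sublevel (fun x => (mass G1' x)^-1) t).
(* [Phi k <= t] means [k + 1 <= gr t], that is, [k < truncn (gr t)]: the sublevel set corresponds to
   an initial segment of the enumeration, which gives both finiteness and the exact count. *)
have below t : 1 <= t -> [set x | (mass G1' x)^-1 <= t] = [set` map rhoV (iota 0 (Num.truncn (gr t)))].
  move=> t1; apply/seteqP; split=> x /=; rewrite m'V Phi_gr// -truncn_gt_nat.
    by move=> h; apply/mapP; exists (rho x); rewrite ?rhoK// mem_iota.
  by move=> /mapP[k]; rewrite mem_iota add0n => /andP[_ h] ->; rewrite rhoVK.
have fin1 t : finite_set [set x | (mass G1' x)^-1 <= t].
  have [t1|t1] := leP 1 t; first by rewrite below//; exact: finite_seq.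
  apply: (@sub_finite_set _ _ set0) => // x /=; rewrite m'V leNgt => /negP; apply.
  exact: lt_le_trans t1 (Phi1 _).
have cE t : 1 <= t -> gr t - 1 <= (c t)%:R <= gr t.
  move=> t1; have -> : c t = Num.truncn (gr t).
    rewrite /c -[RHS](size_iota 0) -(size_map rhoV); apply: perm_size; apply: uniq_perm.
    - exact: finmap.fset_uniq.
    - by rewrite map_inj_uniq ?iota_uniq//; exact: can_inj rhoVK.
    move=> x; rewrite /sublevel in_fset_set// below//.
    by apply/idP/idP => [/set_mem//|h]; exact/mem_set.
  have /andP[lo up] := truncn_itv (gr0 t t1).
  by rewrite lo lerBlDr natr1 ltW.
(* A sum over the finite fibre instead of a maximum: it dominates each [|Dmax| / mass G2 y]. The
   absolute value settles its sign. *)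
pose K : R := \sum_(y <- finmap.enum_fset (fset_set [set: V2])) `|Dmax| / mass G2 y.
have m2 y : 0 < mass G2 y by have [_ h _ _ _] := graph2; exact: h.
have K0 : 0 <= K by apply: sumr_ge0 => y _; rewrite divr_ge0// ltW.
have degK x y : deg G1' x <= K * mass G2 y.
  apply: (le_trans (reweight_deg graph1 m'0 x)); apply: (@le_trans _ _ `|Dmax|).
    by apply: le_trans (ler_norm Dmax); apply: degD; exists x.
  rewrite -ler_pdivrMr// /K (big_rem y)/=; last by rewrite in_fset_set// in_setT.
  by rewrite lerDl; apply: sumr_ge0 => z _; rewrite divr_ge0// ltW.
have m'1 x : mass G1' x <= 1 by rewrite /= invf_le1.
have lap_count := laplacian_counting theta1 graph1' graph2 I_nonempty fin2 K0 degK m'1 fin1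
  ortho parseval energy la0.
have deg_count := degree_counting graph1' graph2 I_nonempty fin2 K0 degK fin1 (ltW d0) dE.
exists G1'; split=> //; split; [|split; [|split; [|split]]].
- split=> //; last first.
    exists Dmax => _ [x _ <-]; apply: (le_trans (reweight_deg graph1 m'0 x)).
    by apply: degD; exists x.
  exists base => e e0.
  (* Only finitely many vertices have mass at least [e]; one more than their largest distance from
     the base is a threshold. *)
  exists (\max_(x <- finmap.enum_fset (fset_set [set x | (mass G1' x)^-1 <= e^-1])) gdist G1' base x).+1.
  move=> x far; rewrite ltNge; apply/negP => ex; move: far; rewrite ltnNge => /negP; apply.
  apply: leq_bigmax_seq => //; rewrite in_fset_set//; apply/mem_set => /=.
  by rewrite lef_pV2 ?posrE.
- exact: reweight_zero.
- exact: reweight_deg.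
- exact: (product_compact_resolvent theta1 graph1' graph2 I_nonempty fin2 K0 degK m'1 fin1 parseval energy la0).
have lim1 : fine (counting_function (mass (gprod G1' G2 I))
    (magnetic_laplacian (gprod G1' G2 I) (theta_prod G1' G2 I theta1 theta2)) l) / gr l
    @[l --> +oo] --> \sum_k expR (- s * ln (la k)).
  (* The shifts are those of [laplacian_counting]; [near] supplies [1 + 2 * K <= l]. *)
  apply: (cvg_counting_over_growth (a1 := - 1 - 2 * K) (a2 := 1) gry grr cE la0).
  near=> l; rewrite addrA; apply: lap_count.
  by near: l; apply: nbhs_pinfty_ge; exact: num_real.
have lim2 : fine (counting_function (mass (gprod G1' G2 I)) (deg_op (gprod G1' G2 I)) l) / gr l
    @[l --> +oo] --> \sum_(k < N) expR (- s * ln d).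
  (* The degree fits the same limit with all [N] parameters equal to [d], as [N] is the number of
     vertices of [G2]. *)
  apply: (cvg_counting_over_growth (a1 := - 1 - 2 * K) (a2 := 1) gry grr cE (fun=> d0)).
  near=> l; have lK : 1 + 2 * K <= l by near: l; apply: nbhs_pinfty_ge; exact: num_real.
  by rewrite addrA !sum_nat_const card_ord NE; exact: deg_count.
have N0 : (0 < N)%N by have [k _] := la_lt; exact: leq_ltn_trans (ltn_ord k).
have sumd : \sum_(k < N) expR (- s * ln d) = N%:R * expR (- s * ln d).
  by rewrite sumr_const card_ord mulr_natl.
have nz : \sum_(k < N) expR (- s * ln d) != 0.
  by rewrite sumd mulf_neq0 ?pnatr_eq0 -?lt0n// gt_eqF ?expR_gt0.
rewrite -sa -sumd; apply: cvg_trans (cvgM lim1 (cvgV nz lim2)).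
apply: near_eq_cvg; near=> l.
have g0 : gr l != 0 by rewrite gt_eqF//; near: l; move/cvgryPgt: gry; apply.
by rewrite /= invfM invrK mulrACA mulVf ?mulr1.
Unshelve. all: by end_near. Qed.
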